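(* Let $u_0\in H^s(\mathbb R)$, $s\ge0$, let $\Omega\subseteq\mathbb R$ be an open set, and let $u$ be the corresponding (global) solution of $$\partial_t u+(1-\partial_x^2)^{-1}(\partial_x u+u\,\partial_x u)=0,\qquad u(x,0)=u_0(x),\quad x\in\mathbb R.$$ (a) If $s\le1/2$ and $u_0\in H^{s+\eta}(\Omega)$ with $\eta\in(0,s+1/2)$, then $u|_\Omega\in C(\mathbb R:H^{s+\eta}(\Omega))$. (b) If $s\le1/2$ and $u_0\notin H^{s+\eta}(\Omega)$ with $\eta\in(0,s+1/2)$, then $u(\cdot,t)|_\Omega\notin H^{s+\eta}(\Omega)$ for all $t\in\mathbb R$. (c) If $s>1/2$ and $u_0\in H^{s+\eta}(\Omega)$ with $\eta\in(0,1]$, then $u|_\Omega\in C(\mathbb R:H^{s+\eta}(\Omega))$. (d) If $s>1/2$ and $u_0\notin H^{s+\eta}(\Omega)$ with $\eta\in(0,1]$, then $u(\cdot,t)|_\Omega\notin H^{s+\eta}(\Omega)$ for all $t\in\mathbb R$.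
   Context: For $r\ge0$ and $\Omega\subset\mathbb R$ open, $f:\Omega\to\mathbb R$ belongs to $H^r(\Omega)$ if there is $F\in H^r(\mathbb R)$ with $F|_\Omega=f$; its norm is the infimum of $\|F\|_{H^r(\mathbb R)}$ over all such extensions. For $u_0$ defined on $\mathbb R$, ''$u_0\in H^r(\Omega)$'' means $u_0|_\Omega\in H^r(\Omega)$. The equation is understood in the integral form $u(t)=u_0-\int_0^t\partial_x(1-\partial_x^2)^{-1}\big(u+\tfrac{u^2}{2}\big)(t')\,dt'$, where $\partial_x(1-\partial_x^2)^{-1}g=K*g$ with $K(x)=-\tfrac12\,\mathrm{sgn}(x)e^{-|x|}$. It is known (Bona-Tzvetkov) that for every $s\ge0$, $u_0\in H^s(\mathbb R)$ and every $T>0$ there is a unique solution $u\in C([-T,T]:H^s(\mathbb R))$; hence the solution is defined for all $t\in\mathbb R$. *)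

(* Defs.v *)
From HB Require Import structures.
From mathcomp Require Import all_boot all_order all_algebra.
From mathcomp Require Import all_classical all_reals all_analysis.
From mathcomp.real_closed Require Import complex.

Set Implicit Arguments.
Unset Strict Implicit.
Unset Printing Implicit Defensive.

Import Order.TTheory GRing.Theory Num.Theory.
Import numFieldNormedType.Exports.

Local Open Scope classical_set_scope.
Local Open Scope ring_scope.
Local Open Scope complex_scope.

(* Elements of L^2(R), H^r(R), H^r(Omega) are represented by real-valued
   functions on the whole line; everything below is invariant under
   modification on a null set, and for H^r(Omega) only the values on Omega
   matter. *)

(* int_(-n)^n f(x) e^(-i x xi) dx *)
Definition fourier_trunc (R : realType) (f : R -> R) (n : nat) (xi : R) : R[i] :=
  (\int[lebesgue_measure]_(x in `[- n%:R, n%:R]) (f x * cos (x * xi)))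
  -i* (\int[lebesgue_measure]_(x in `[- n%:R, n%:R]) (f x * sin (x * xi))).

(* Plancherel: the transform of f in L^2 is the L^2 limit of the truncated
   transforms. *)
Definition is_fourier (R : realType) (f : R -> R) (g : R -> R[i]) : Prop :=
  [/\ (fun xi : R => complex.Re (g xi)) \in Lfun lebesgue_measure 2%:E,
      (fun xi : R => complex.Im (g xi)) \in Lfun lebesgue_measure 2%:E &
      'N[lebesgue_measure]_2%:E[
         (fun xi : R => (Normc.normc (g xi - fourier_trunc f n xi))%:E)]%E
        @[n --> \oo] --> 0%E].

Definition fourier (R : realType) (f : R -> R) : R -> R[i] :=
  xget (fun=> 0) [set g | is_fourier f g].

(* || (1 + xi^2)^(r/2) f^(xi) ||_(L^2); meaningful for f in L^2 *)
Definition sobolev_norm (R : realType) (r : R) (f : R -> R) : \bar R :=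
  'N[lebesgue_measure]_2%:E[
    (fun xi : R =>
       ((1 + xi ^+ 2) `^ (r / 2) * Normc.normc (fourier f xi))%:E)]%E.

Definition sobolev (R : realType) (r : R) : set (R -> R) :=
  [set f | f \in Lfun lebesgue_measure 2%:E /\ (sobolev_norm r f < +oo)%E].

Definition sobolev_ext (R : realType) (r : R) (Omega : set R) (f : R -> R)
    : set (R -> R) :=
  [set F | sobolev r F /\ ae_eq lebesgue_measure Omega F f].

Definition sobolev_on (R : realType) (r : R) (Omega : set R) : set (R -> R) :=
  [set f | exists F, sobolev_ext r Omega f F].

Definition sobolev_on_norm (R : realType) (r : R) (Omega : set R) (f : R -> R)
    : \bar R :=
  ereal_inf [set sobolev_norm r F | F in sobolev_ext r Omega f].

(* u in C(R : X), where X is the space S with norm N *)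
Definition continuous_curve (R : realType) (S : set (R -> R))
    (N : (R -> R) -> \bar R) (u : R -> R -> R) : Prop :=
  (forall t, S (u t)) /\
  (forall t0, N (fun x => u t x - u t0 x) @[t --> t0] --> 0%E).

Definition oriented_integral (R : realType) (a b : R) (f : R -> R) : R :=
  if a <= b then \int[lebesgue_measure]_(x in `[a, b]) f x
  else - \int[lebesgue_measure]_(x in `[b, a]) f x.

Definition convolution (R : realType) (k g : R -> R) (x : R) : R :=
  \int[lebesgue_measure]_y (k (x - y) * g y).

(* kernel of d/dx (1 - d^2/dx^2)^(-1) *)
Definition bbm_kernel (R : realType) (x : R) : R :=
  - (1 / 2) * Num.sg x * expR (- `|x|).

(* The time integral is taken pointwise in x.  For u in C(R : H^s) with
   s >= 0, u + u^2/2 is continuous in time with values in L^2 + L^1, which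
   bbm_kernel * _ maps continuously into bounded continuous functions, so for
   every x the integrand is continuous in t' and the pointwise integral
   agrees with the vector-valued one. *)
Definition bbm_solution (R : realType) (s : R) (u0 : R -> R) (u : R -> R -> R)
    : Prop :=
  continuous_curve (sobolev s) (sobolev_norm s) u /\
  forall t, ae_eq lebesgue_measure setT (u t)
    (fun x => u0 x - oriented_integral 0 t (fun t' =>
       convolution (@bbm_kernel R) (fun y => u t' y + u t' y ^+ 2 / 2) x)).

(* Main.v *)
(** Put [w = u t - u t0]: then [w] is minus the time integral of
    [K * (u + u^2/2)], and everything reduces to the claim that [w] lies in
    [H^(s+eta)] with norm [O(|t - t0|)]; the regularity of [u0] on [Omega] is
    then carried to [u t] and back by adding or subtracting [w].

    By duality the claim is a bound for the pairing of [K * (u + u^2/2)] with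
    the transform of a test function [phi] by the [L^2] norm of
    [<xi>^(-s-eta) phi].  The linear part gains one derivative.  For the
    quadratic part, the transform of [u^2] is a self-convolution, and with
    [<x>^(s-a) <z>^(-s) <x-z>^(-s) <= C (<x>^(-b) + <z>^(-b) + <x-z>^(-b))],
    [a = 1 - eta >= 0], [b = a + s > 1/2], the trilinear form splits into three
    terms, each bounded by Cauchy-Schwarz because [<.>^(-b)] is in [L^2].  This
    is where [eta <= 1] and [eta < s + 1/2] enter.  The bound is local in time;
    connectedness of the time line makes membership global.

    The Hartley transform [int f(x) (cos(x xi) + sin(x xi)) dx] replaces the
    Fourier transform so that all functions stay real valued: with [G] the
    Hartley transform of [f], [|f^(xi)|^2 = (G(xi)^2 + G(-xi)^2) / 2]. *)
Require Import Defs.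
From mathcomp Require Import all_boot all_order all_algebra.
From mathcomp Require Import all_classical all_reals all_analysis.
From mathcomp.real_closed Require Import complex.
From mathcomp Require Import measurable_realfun lra ring.

Set Implicit Arguments.
Unset Strict Implicit.
Unset Printing Implicit Defensive.

Import Order.TTheory GRing.Theory Num.Theory.
Import numFieldNormedType.Exports.

Local Open Scope classical_set_scope.
Local Open Scope ring_scope.

(** * Integrable functions *)

Section Integrals.
Context {R : realType}.
Notation mu := (@lebesgue_measure R).
Notation msr f := (measurable_fun [set: R] (f : R -> R)).
Implicit Types f g h : R -> R.

(** [u] is only known to be square-integrable, so [u^2] is merely integrable and need not have a
    square-integrable transform; this obstacle imposes the duality. The test functions [phi] are
    both integrable and square-integrable, so [hartley1 phi] is bounded as well as
    square-integrable: the first serves [u^2], the second serves [u]. The test side carries the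
    whole weight. The symbol of the kernel contributes [<xi>^(-1)], and with [X = <xi>^(-s-eta) phi]
    what stands against the transform of [u^2] is, up to a reflection, at most [<xi>^(s+eta-1) |X|]:
    this is the origin of [a = 1 - eta].

    In time only the increment [u t - u t0] is followed, since [u t] itself need not lie in
    [H^(s+eta)] of the whole line.

    The isometry of the Hartley transform rests on the damping [e^(-e|xi|)], whose transform is the
    Poisson kernel, a positive approximate identity: positivity gives the upper bound, concentration
    at the origin the lower one. *)

Definition intg f : Prop := mu.-integrable [set: R] (EFin \o f).
(** This is [fine] of the extended integral, hence 0 for a measurable function that is not
    integrable; most rules below therefore assume [intg]. *)
Definition I f : R := \int[mu]_x f x.

Lemma msrE f : msr f -> measurable_fun [set: R] (fun x => (f x)%:E).
Proof. by move=> mf; apply/measurable_EFinP. Qed.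

Lemma intg_msr f : intg f -> msr f.
Proof. by move=> /measurable_int /measurable_EFinP. Qed.

Lemma intg_le f g : msr f -> (forall x, `|f x| <= g x) -> intg g -> intg f.
Proof.
move=> mf fg ig; apply: (le_integrable _ _ _ ig) => //.
  exact/measurable_EFinP.
by move=> x _ /=; rewrite lee_fin (le_trans (fg x))// ler_norm.
Qed.

Lemma intgD f g : intg f -> intg g -> intg (fun x => f x + g x).
Proof. by move=> i1 i2; have := integrableD measurableT i1 i2. Qed.
Lemma intgB f g : intg f -> intg g -> intg (fun x => f x - g x).
Proof. by move=> i1 i2; have := integrableB measurableT i1 i2. Qed.
Lemma intgZ a f : intg f -> intg (fun x => a * f x).
Proof. by move=> i1; have := integrableZl measurableT a i1. Qed.
Lemma intg_abs f : intg f -> intg (fun x => `|f x|).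
Proof. by move=> i1; have := integrable_abse i1. Qed.

Lemma ID f g : intg f -> intg g -> I (fun x => f x + g x) = I f + I g.
Proof. by move=> i1 i2; rewrite /I RintegralD. Qed.
Lemma IB f g : intg f -> intg g -> I (fun x => f x - g x) = I f - I g.
Proof. by move=> i1 i2; rewrite /I RintegralB. Qed.
Lemma IZ a f : intg f -> I (fun x => a * f x) = a * I f.
Proof. by move=> i1; rewrite /I RintegralZl. Qed.
Lemma IN f : intg f -> I (fun x => - f x) = - I f.
Proof.
move=> i; rewrite -mulN1r -IZ//; apply: eq_Rintegral => x _; by rewrite mulN1r.
Qed.
Lemma eqI f g : (forall x, f x = g x) -> I f = I g.
Proof. by move=> fg; apply: eq_Rintegral => x _. Qed.
Lemma I_ge0 f : (forall x, 0 <= f x) -> 0 <= I f.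
Proof. by move=> f0; apply: Rintegral_ge0. Qed.
Lemma I_le f g : intg f -> intg g -> (forall x, f x <= g x) -> I f <= I g.
Proof. by move=> *; apply: le_Rintegral. Qed.
Lemma I_abs f : intg f -> `|I f| <= I (fun x => `|f x|).
Proof. by move=> *; apply: le_normr_Rintegral. Qed.
Lemma I_le_abs f g : intg f -> intg g -> (forall x, `|f x| <= g x) -> `|I f| <= I g.
Proof.
move=> i1 i2 fg; apply: (le_trans (I_abs i1)); apply: I_le => //.
exact: intg_abs.
Qed.
Lemma I0 : I (fun=> 0) = 0.
Proof. by rewrite /I /Rintegral integral0. Qed.
Lemma intg0 : intg (fun=> 0).
Proof. exact: integrable0. Qed.

Lemma intgE f : intg f -> (\int[mu]_x (f x)%:E)%E = (I f)%:E.
Proof. by move=> i; rewrite /I /Rintegral fineK//; exact: integrable_fin_num. Qed.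

Lemma ge0_intg f : msr f -> (forall x, 0 <= f x) ->
  intg f <-> (\int[mu]_x (f x)%:E < +oo)%E.
Proof.
move=> mf f0; split.
  by move=> i; rewrite intgE// ltry.
move=> foo; apply/integrableP; split; first exact/measurable_EFinP.
by under eq_integral do rewrite gee0_abs ?lee_fin//.
Qed.

Lemma ae_mono (P Q : R -> Prop) : (forall x, P x -> Q x) ->
  {ae mu, forall x, P x} -> {ae mu, forall x, Q x}.
Proof. by move=> PQ; apply: negligibleS => x /= nQ Px; exact/nQ/PQ. Qed.

Lemma ae_mono2 (P Q S : R -> Prop) : (forall x, P x -> Q x -> S x) ->
  {ae mu, forall x, P x} -> {ae mu, forall x, Q x} -> {ae mu, forall x, S x}.
Proof.
move=> PQS aP aQ; have : mu.-negligible (~` [set x | P x] `|` ~` [set x | Q x]).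
  exact: negligibleU.
apply: negligibleS => x /= nS; have [Px|] := pselect (P x); last by left.
by right => Qx; exact/nS/PQS.
Qed.

Lemma I_ae f g : msr f -> msr g -> ae_eq mu setT f g -> I f = I g.
Proof.
move=> mf mg fg; rewrite /I /Rintegral; congr fine; apply: ae_eq_integral => //.
- exact/measurable_EFinP.
- exact/measurable_EFinP.
- by apply: filterS fg => x /= h _; rewrite h.
Qed.

Lemma intg_ae f g : msr f -> msr g -> ae_eq mu setT f g -> intg f -> intg g.
Proof.
move=> mf mg fg /integrableP[_ i]; apply/integrableP; split; first exact/measurable_EFinP.
rewrite (_ : integral _ _ _ = (\int[mu]_x `|(EFin \o f) x|)%E) //.
apply: ae_eq_integral => //.
- by do 2 apply: measurableT_comp => //.
- by do 2 apply: measurableT_comp => //.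
- by apply: filterS fg => x /= h _; rewrite h.
Qed.

Lemma msr_shift f a : msr f -> msr (fun x => f (x + a)).
Proof. by move=> mf; apply: measurableT_comp => //; apply: measurable_funD. Qed.
Lemma msr_opp f : msr f -> msr (fun x => f (- x)).
Proof. by move=> mf; apply: measurableT_comp => //; apply: oppr_measurable. Qed.

(** Translated half-open intervals keep their length, and the values on half-open intervals
    determine Lebesgue measure. *)
Lemma lebesgue_measureD a (A : set R) : measurable A ->
  pushforward mu ((fun x => x + a) : _ -> measurableTypeR R) A = mu A.
Proof.
move=> mA; apply/esym/lebesgue_measure_unique => //=.
  exact: measurable_funD.
move=> mf0 _ [[b c]] _ <-.
rewrite /pushforward (_ : _ @^-1` _ = `]b - a, c - a]%classic); last first.
  by apply/seteqP; split => x /=; rewrite /= !in_itv/= ltrBlDr lerBrDr.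
rewrite !lebesgue_measure_itv/= !lte_fin ltrD2r.
by case: ifP => // _; rewrite -!EFinB opprB addrA subrK.
Qed.

(** The non-negative extended version asks for no integrability, so it can be used to prove that
    translation preserves integrability; [I_shift] comes after that. *)
Lemma J_shift (f : R -> \bar R) (a : R) : measurable_fun [set: R] f -> (forall x, 0 <= f x)%E ->
  (\int[mu]_x f (x + a)%R)%E = (\int[mu]_x f x)%E.
Proof.
move=> mf f0.
have mp : measurable_fun [set: measurableTypeR R] ((fun x => x + a) : _ -> measurableTypeR R).
  exact: measurable_funD.
have := @ge0_integral_pushforward _ _ _ _ _ _ mp mu setT f measurableT mf (fun y _ => f0 y).
rewrite preimage_setT /comp => <-.
by apply: eq_measure_integral => A mA _; exact: lebesgue_measureD.
Qed.

Lemma J_opp (f : R -> \bar R) : measurable_fun [set: R] f -> (forall x, 0 <= f x)%E ->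
  (\int[mu]_x f (- x)%R)%E = (\int[mu]_x f x)%E.
Proof.
move=> mf f0.
have mp : measurable_fun [set: measurableTypeR R] ((fun x => - x) : _ -> measurableTypeR R).
  exact: oppr_measurable.
have := @ge0_integral_pushforward _ _ _ _ _ _ mp mu setT f measurableT mf (fun y _ => f0 y).
rewrite preimage_setT /comp => <-.
by apply: eq_measure_integral => A mA _; exact: lebesgue_measureN.
Qed.

Lemma intg_shift f a : intg f -> intg (fun x => f (x + a)).
Proof.
move=> /[dup] /intg_msr mf /integrableP[m i]; apply/integrableP; split.
  by apply/measurable_EFinP; apply: msr_shift.
by rewrite (J_shift (f := fun x => `|(f x)%:E|)%E) //; do 2 apply: measurableT_comp => //.
Qed.

Lemma intg_opp f : intg f -> intg (fun x => f (- x)).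
Proof.
move=> /[dup] /intg_msr mf /integrableP[m i]; apply/integrableP; split.
  by apply/measurable_EFinP; apply: msr_opp.
by rewrite (J_opp (f := fun x => `|(f x)%:E|)%E) //; do 2 apply: measurableT_comp => //.
Qed.

Lemma I_shift f a : intg f -> I (fun x => f (x + a)) = I f.
Proof.
move=> i; have mf := intg_msr i.
have mp : measurable_fun [set: measurableTypeR R] ((fun x => x + a) : _ -> measurableTypeR R).
  exact: measurable_funD.
rewrite /I /Rintegral; congr fine.
have := @integral_pushforward _ _ _ _ _ _ mp mu setT (EFin \o f).
rewrite preimage_setT /comp => <- //; last 2 first.
- exact: msrE.
- exact: intg_shift.
by apply: eq_measure_integral => A mA _; exact: lebesgue_measureD.
Qed.

Lemma I_opp f : intg f -> I (fun x => f (- x)) = I f.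
Proof.
move=> i; have mf := intg_msr i.
have mp : measurable_fun [set: measurableTypeR R] ((fun x => - x) : _ -> measurableTypeR R).
  exact: oppr_measurable.
rewrite /I /Rintegral; congr fine.
have := @integral_pushforward _ _ _ _ _ _ mp mu setT (EFin \o f).
rewrite preimage_setT /comp => <- //; last 2 first.
- exact: msrE.
- exact: intg_opp.
by apply: eq_measure_integral => A mA _; exact: lebesgue_measureN.
Qed.

Lemma intg_refl f a : intg f -> intg (fun x => f (a - x)).
Proof.
move=> i; have := intg_opp (intg_shift a i).
by under [X in intg X -> _]eq_fun do rewrite addrC.
Qed.
Lemma I_refl f a : intg f -> I (fun x => f (a - x)) = I f.
Proof.
move=> i; rewrite -[RHS](I_shift a i) -[RHS]I_opp; last exact: intg_shift.
by apply: eqI => x; rewrite addrC.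
Qed.
Lemma J_refl (f : R -> \bar R) (a : R) : measurable_fun [set: R] f -> (forall x, 0 <= f x)%E ->
  (\int[mu]_x f (a - x)%R)%E = (\int[mu]_x f x)%E.
Proof.
move=> mf f0; rewrite -[RHS](J_shift a mf f0) -[RHS]J_opp//; last first.
  by apply: measurableT_comp => //; apply: measurable_funD.
by apply: eq_integral => x _; rewrite addrC.
Qed.

Lemma dominated (f_ : nat -> R -> R) f g : (forall n, msr (f_ n)) -> msr f ->
  (forall x, f_ n x @[n --> \oo] --> f x) -> intg g ->
  (forall n x, `|f_ n x| <= g x) -> I (f_ n) @[n --> \oo] --> I f.
Proof.
move=> mf_ mf ff ig fg.
have [|||||i _ h] := @dominated_convergence _ _ _ mu setT measurableT (fun n x => (f_ n x)%:E)
  (EFin \o f) (EFin \o g).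
- by move=> n; exact: msrE.
- exact: msrE.
- apply: aeW => x _ /=; apply: cvg_EFin; last exact: ff.
  by apply: nearW.
- exact: ig.
- by apply: aeW => x n _ /=; rewrite lee_fin.
have -> : I f = fine (\int[mu]_x (f x)%:E)%E by [].
have e n : (\int[mu]_x (f_ n x)%:E)%E = (I (f_ n))%:E.
  by rewrite intgE//; exact: (intg_le (mf_ n) (fg n) ig).
move: h; rewrite [in X in X -> _](_ : (\int[mu]_x _)%E = (I f)%:E); last first.
  by rewrite -intgE.
rewrite (_ : (fun n => _) = (fun n => (I (f_ n))%:E)); last by apply/funext => n; rewrite -e.
by move=> /fine_cvg.
Qed.

(** Fatou with the limit known only almost everywhere and the bound only from some index on, as
    happens for the limit of a subsequence. *)
Lemma fatou_bound (f_ : nat -> R -> R) f (M : R) : (forall n, msr (f_ n)) -> msr f ->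
  (forall n x, 0 <= f_ n x) -> {ae mu, forall x, limn_einf (fun n => (f_ n x)%:E) = (f x)%:E} ->
  (\forall n \near \oo, (\int[mu]_x (f_ n x)%:E <= M%:E)%E) ->
  (\int[mu]_x (f x)%:E <= M%:E)%E.
Proof.
move=> mf_ mf f0 ff fM.
have mF n : measurable_fun [set: R] (fun x => (f_ n x)%:E) by exact: msrE.
have := @fatou _ _ _ mu setT measurableT (fun n x => (f_ n x)%:E) mF
  (fun n x _ => f0 n x).
rewrite (_ : integral _ _ _ = \int[mu]_x (f x)%:E)%E; last first.
  apply: ae_eq_integral => //; last by apply: (ae_mono _ ff) => x h _.
- rewrite (_ : (fun x => _) = (fun x => - limn_esup (fun n => - (f_ n x)%:E))%E).
    apply: measurableT_comp => //; apply: measurable_fun_limn_esup => n.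
    by apply: (msrE (f := fun x => - f_ n x)); apply: measurable_funN.
  by apply/funext => x; rewrite -limn_einfN; congr limn_einf; apply/funext => n /=; rewrite opprK.
- exact: msrE.
move/le_trans; apply.
rewrite limn_einf_lim; apply: lime_le.
  by apply: is_cvg_einfs.
apply: nearW => n.
have [N _ NM] := fM.
(* The infimum over the tail from [n] is at most its term of index [maxn n N], for which the bound
   [M] is available. *)
apply: (@le_trans _ _ (\int[mu]_x (f_ (maxn n N) x)%:E)%E).
  by apply: ereal_inf_lbound => /=; exists (maxn n N) => //=; exact: leq_maxl.
by apply: NM => /=; exact: leq_maxr.
Qed.

Lemma limn_einf_EFin (u : nat -> R) (l : R) : u n @[n --> \oo] --> l ->
  limn_einf (fun n => (u n)%:E) = l%:E.
Proof.
move=> ul; have h : (u n)%:E @[n --> \oo] --> l%:E by apply: cvg_EFin => //; exact: nearW.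
by rewrite is_cvg_limn_einfE; [exact: cvg_lim h|exact: cvgP h].
Qed.

Lemma fatou_intg (f_ : nat -> R -> R) f (M : R) : (forall n, msr (f_ n)) -> msr f ->
  (forall n x, 0 <= f_ n x) -> (forall x, f_ n x @[n --> \oo] --> f x) ->
  (forall n, intg (f_ n) /\ I (f_ n) <= M) -> intg f /\ I f <= M.
Proof.
move=> mf_ mf f0 ff fM.
have ff0 x : 0 <= f x.
  by have <- := cvg_lim (@norm_hausdorff _ _) (ff x); apply: limr_ge; [exact: cvgP (ff x)|exact: nearW].
have b : (\int[mu]_x (f x)%:E <= M%:E)%E.
  apply: (@fatou_bound f_) => //.
  - by apply: aeW => x; apply: limn_einf_EFin.
  - apply: nearW => n; have [i h] := fM n; by rewrite intgE// lee_fin.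
have i : intg f by apply/ge0_intg => //; apply: (le_lt_trans b); rewrite ltry.
by split=> //; rewrite -lee_fin -intgE.
Qed.

Notation msr2 F := (measurable_fun [set: R * R] (F : R * R -> R)).
Implicit Types F G : R * R -> R.

(* Absolute integrability on the plane, the hypothesis under which both iterated integrals agree (Fubini). *)
Definition fub F : Prop := (mu \x mu)%E.-integrable [set: R * R] (EFin \o F).

Lemma msr_fst f : msr f -> msr2 (fun p => f p.1).
Proof. by move=> mf; apply: (measurableT_comp mf); exact: measurable_fst. Qed.
Lemma msr_snd f : msr f -> msr2 (fun p => f p.2).
Proof. by move=> mf; apply: (measurableT_comp mf); exact: measurable_snd. Qed.
Lemma msr_diff f : msr f -> msr2 (fun p => f (p.1 - p.2)).
Proof.
move=> mf; apply: (measurableT_comp mf); apply: measurable_funB.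
- exact: measurable_fst.
- exact: measurable_snd.
Qed.

Lemma msr_pair1 F x : msr2 F -> msr (fun y => F (x, y)).
Proof. by move=> mF; apply: (measurableT_comp mF); exact: measurable_pair1. Qed.

Lemma fub_le F G : msr2 F -> (forall p, `|F p| <= G p) -> fub G -> fub F.
Proof.
move=> mF FG iG; apply: (le_integrable _ _ _ iG) => //.
  by apply/measurable_EFinP.
by move=> x _ /=; rewrite lee_fin (le_trans (FG x))// ler_norm.
Qed.

Lemma fubD F G : fub F -> fub G -> fub (fun p => F p + G p).
Proof. by move=> i1 i2; have := integrableD measurableT i1 i2. Qed.
Lemma fubZ a F : fub F -> fub (fun p => a * F p).
Proof. by move=> i1; have := integrableZl measurableT a i1. Qed.

Lemma fubP F : msr2 F -> fub F <-> (\int[mu]_x \int[mu]_y `|F (x, y)|%:E < +oo)%E.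
Proof.
move=> mF; have mF' : measurable_fun [set: R * R] (EFin \o F) by apply/measurable_EFinP.
exact: (@integrable12ltyP _ _ _ _ _ mu mu (EFin \o F) mF').
Qed.
Lemma fubP2 F : msr2 F -> fub F <-> (\int[mu]_y \int[mu]_x `|F (x, y)|%:E < +oo)%E.
Proof.
move=> mF; have mF' : measurable_fun [set: R * R] (EFin \o F) by apply/measurable_EFinP.
exact: (@integrable21ltyP _ _ _ _ _ mu mu (EFin \o F) mF').
Qed.

Lemma fub_msr F : fub F -> msr2 F.
Proof. by move=> /measurable_int/measurable_EFinP. Qed.

Lemma fub_swap F : fub F -> fub (fun p => F (p.2, p.1)).
Proof.
move=> /[dup] /fub_msr mF /(fubP2 mF) h; apply/fubP => //.
apply: (measurableT_comp mF).
exact: measurable_swap.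
Qed.

Lemma fub_prod f g : intg f -> intg g -> fub (fun p => f p.1 * g p.2).
Proof.
move=> jf jg; have mf := intg_msr jf; have mg := intg_msr jg.
apply/fubP; first by apply: measurable_funM; [exact: msr_fst|exact: msr_snd].
rewrite [X in (X < _)%E](_ : _ = \int[mu]_x (`|f x| * I (fun y => `|g y|))%:E)%E; last first.
  apply: eq_integral => x _ /=; rewrite EFinM -intgE; last exact: intg_abs.
  rewrite -ge0_integralZl //.
  - by apply: eq_integral => y _; rewrite normrM EFinM.
  - by apply: msrE; apply: measurableT_comp.
rewrite intgE ?ltry//.
under [X in intg X]eq_fun do rewrite mulrC.
exact/intgZ/intg_abs.
Qed.

Lemma fub_conv k g : intg k -> intg g -> fub (fun p => k (p.1 - p.2) * g p.2).
Proof.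
move=> jf jg; have mf := intg_msr jf; have mg := intg_msr jg.
apply/fubP2; first by apply: measurable_funM; [exact: msr_diff|exact: msr_snd].
rewrite [X in (X < _)%E](_ : _ = \int[mu]_x (`|g x| * I (fun y => `|k y|))%:E)%E; last first.
  apply: eq_integral => x _ /=; rewrite EFinM -intgE; last exact: intg_abs.
  rewrite -(J_shift (f := fun y => `|k y|%:E) (- x)) //; last first.
    by apply: msrE; apply: measurableT_comp.
  rewrite -ge0_integralZl //.
  - by apply: eq_integral => y _; rewrite normrM EFinM muleC.
  - by apply: msrE; apply: measurableT_comp => //; exact: msr_shift.
rewrite intgE ?ltry//.
under [X in intg X]eq_fun do rewrite mulrC.
exact/intgZ/intg_abs.
Qed.

Lemma msr_fub1 F : fub F -> msr (fun x => I (fun y => F (x, y))).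
Proof.
move=> h; rewrite /I /Rintegral; have m := @measurable_fubini_F _ _ _ _ _ mu mu _ h.
by apply: (measurableT_comp (f := fine) _ m); exact: fine_measurable.
Qed.

Lemma intg_fub1 F : fub F -> intg (fun x => I (fun y => F (x, y))).
Proof.
move=> h; have m := msr_fub1 h.
have /integrableP[m2 i2] := @integrable_fubini_F _ _ _ _ _ mu mu _ h.
apply/integrableP; split; first exact: msrE.
apply: le_lt_trans i2; apply: ge0_le_integral => //.
- by apply: msrE; apply: measurableT_comp.
- by apply: measurableT_comp.
(* [fine] sends an infinite inner integral to 0, so the real inner integral is still dominated in
   absolute value by the extended one. *)
- move=> x _ /=; rewrite /I /Rintegral /fubini_F /=.
  by case: (integral _ _ _) => [r||] /=; rewrite ?leey ?normr0 ?lexx.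
Qed.

Lemma ae_fub1 F : fub F -> ae_eq mu setT (fun x => (I (fun y => F (x, y)))%:E)
  (fun x => \int[mu]_y (F (x, y))%:E)%E.
Proof.
move=> h; have := @ae_integrable1 _ _ _ _ _ mu mu _ h.
by apply: filterS => x /= i _; rewrite -intgE.
Qed.
Lemma intg_fub2 F : fub F -> intg (fun y => I (fun x => F (x, y))).
Proof. by move=> h; exact: (intg_fub1 (fub_swap h)). Qed.

Lemma I_fub1 F : fub F -> (I (fun x => I (fun y => F (x, y))))%:E = (\int[mu \x mu]_p (F p)%:E)%E.
Proof.
move=> h; rewrite -intgE; last exact: intg_fub1.
rewrite -(integral12_prod_meas1 h); apply: ae_eq_integral => //.
- exact: (msrE (msr_fub1 h)).
- exact: (measurable_fubini_F h).
- exact: ae_fub1.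
Qed.
Lemma I_fub2 F : fub F -> (I (fun y => I (fun x => F (x, y))))%:E = (\int[mu \x mu]_p (F p)%:E)%E.
Proof.
move=> h; rewrite -intgE; last exact: intg_fub2.
rewrite -(integral21_prod_meas1 h); apply: ae_eq_integral => //.
- exact: (msrE (msr_fub1 (fub_swap h))).
- exact: (measurable_fubini_G h).
- exact: (ae_fub1 (fub_swap h)).
Qed.
Lemma fubini F : fub F -> I (fun x => I (fun y => F (x, y))) = I (fun y => I (fun x => F (x, y))).
Proof. by move=> h; apply: EFin_inj; rewrite (I_fub1 h) (I_fub2 h). Qed.
End Integrals.

(** * Square-integrable functions *)

Section SquareIntegrable.
Context {R : realType}.
Notation mu := (@lebesgue_measure R).
Notation msr f := (measurable_fun [set: R] (f : R -> R)).
Notation sq f := (fun x => f x ^+ 2).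
Implicit Types f g h : R -> R.

Definition L2 f := msr f /\ intg (sq f).
Definition nrm f : R := Num.sqrt (I (sq f)).

Lemma L2_msr f : L2 f -> msr f. Proof. by case. Qed.

Lemma I_sq_ge0 f : 0 <= I (sq f).
Proof. by apply: I_ge0 => x; exact: sqr_ge0. Qed.
Lemma nrm_ge0 f : 0 <= nrm f. Proof. exact: sqrtr_ge0. Qed.
Lemma nrm_sq f : nrm f ^+ 2 = I (sq f).
Proof. by rewrite sqr_sqrtr// I_sq_ge0. Qed.

Lemma L2_le f g : msr f -> (forall x, `|f x| <= g x) -> L2 g -> L2 f.
Proof.
move=> mf fg [mg ig]; split=> //; apply: (intg_le _ _ ig).
  exact: measurable_funX.
move=> x; rewrite ger0_norm ?sqr_ge0// -real_normK ?num_real//.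
by rewrite ler_sqr ?nnegrE// (le_trans _ (fg x)).
Qed.

Lemma L2M f g : L2 f -> L2 g -> intg (fun x => f x * g x).
Proof.
move=> [mf jf] [mg jg]; apply: (intg_le _ _ (intgD jf jg)).
  exact: measurable_funM.
by move=> x; rewrite ler_norml; apply/andP; split; nra.
Qed.

Lemma L2Z a f : L2 f -> L2 (fun x => a * f x).
Proof.
move=> [mf jf]; split; first exact: measurable_funM.
under [X in intg X]eq_fun do rewrite exprMn.
exact: intgZ.
Qed.
Lemma L2D f g : L2 f -> L2 g -> L2 (fun x => f x + g x).
Proof.
move=> [mf jf] [mg jg]; split; first exact: measurable_funD.
apply: (intg_le _ _ (intgD (intgZ 2 jf) (intgZ 2 jg))).
  by apply: measurable_funX; exact: measurable_funD.
by move=> x; rewrite ger0_norm ?sqr_ge0//; have := sqr_ge0 (f x - g x); nra.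
Qed.
Lemma L2N f : L2 f -> L2 (fun x => - f x).
Proof. by move=> /(L2Z (-1)); under [X in L2 X -> _]eq_fun do rewrite mulN1r. Qed.
Lemma L2B f g : L2 f -> L2 g -> L2 (fun x => f x - g x).
Proof. by move=> lf /L2N; exact: L2D. Qed.
Lemma L2_abs f : L2 f -> L2 (fun x => `|f x|).
Proof.
move=> [mf jf]; split; first exact: measurableT_comp.
by under [X in intg X]eq_fun do rewrite real_normK ?num_real//.
Qed.
Lemma L2_0 : L2 (fun=> 0).
Proof. by split => //; under [X in intg X]eq_fun do rewrite expr0n; exact: intg0. Qed.
Lemma L2_shift f a : L2 f -> L2 (fun x => f (x + a)).
Proof. by move=> [mf jf]; split; [exact: msr_shift|exact: (intg_shift a jf)]. Qed.
Lemma L2_opp f : L2 f -> L2 (fun x => f (- x)).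
Proof. by move=> [mf jf]; split; [exact: msr_opp|exact: (intg_opp jf)]. Qed.
Lemma L2_refl f a : L2 f -> L2 (fun x => f (a - x)).
Proof.
move=> h; have := L2_opp (L2_shift a h).
by under [X in L2 X -> _]eq_fun do rewrite addrC.
Qed.
Lemma nrm_shift f a : L2 f -> nrm (fun x => f (x + a)) = nrm f.
Proof. by move=> [mf jf]; rewrite /nrm (I_shift a jf). Qed.
Lemma nrm_opp f : L2 f -> nrm (fun x => f (- x)) = nrm f.
Proof. by move=> [mf jf]; rewrite /nrm (I_opp jf). Qed.
Lemma nrm_refl f a : L2 f -> nrm (fun x => f (a - x)) = nrm f.
Proof. by move=> [mf jf]; rewrite /nrm (I_refl a jf). Qed.
Lemma nrm_abs f : nrm (fun x => `|f x|) = nrm f.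
Proof. by congr Num.sqrt; apply: eqI => x; rewrite real_normK ?num_real. Qed.
Lemma nrmN f : nrm (fun x => - f x) = nrm f.
Proof. by congr Num.sqrt; apply: eqI => x; rewrite sqrrN. Qed.
Lemma nrmZ a f : L2 f -> nrm (fun x => a * f x) = `|a| * nrm f.
Proof.
move=> [mf jf]; rewrite /nrm.
under [X in I X]eq_fun do rewrite exprMn.
by rewrite IZ// sqrtrM ?sqr_ge0// sqrtr_sqr.
Qed.

Lemma I_sqB f g t : L2 f -> L2 g ->
  I (fun x => (f x - t * g x) ^+ 2) =
  I (sq f) - 2 * t * I (fun x => f x * g x) + t ^+ 2 * I (sq g).
Proof.
move=> lf lg; have ifg := L2M lf lg; move: lf lg => [mf jf] [mg jg].
rewrite -IZ// -IB//; last exact: intgZ.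
rewrite -IZ// -ID//; first by apply: eqI => x; ring.
  by apply: intgB => //; exact: intgZ.
exact: intgZ.
Qed.

(** The quadratic polynomial [I ((f - t g)^2)] in [t] is non-negative, so its discriminant is not
    positive. *)
Lemma cauchy_schwarz f g : L2 f -> L2 g -> `|I (fun x => f x * g x)| <= nrm f * nrm g.
Proof.
move=> lf lg; rewrite -ler_sqr ?nnegrE ?mulr_ge0 ?nrm_ge0//.
rewrite real_normK ?num_real// exprMn !nrm_sq.
set B := I _; set A := I (sq f); set C := I (sq g).
have P t : 0 <= A - 2 * t * B + t ^+ 2 * C.
  by rewrite -I_sqB//; apply: I_ge0 => x; exact: sqr_ge0.
have A0 : 0 <= A by exact: I_sq_ge0.
(* Degenerate case: the polynomial is affine in [t], and if [B] were nonzero the [t] chosen below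
   would give it the value [-1]. *)
have [C0|C0] := eqVneq C 0.
  have [->|B0] := eqVneq B 0; first by rewrite expr0n mulr_ge0 ?C0.
  have := P ((A + 1) / (2 * B)); rewrite C0 mulr0 addr0.
  rewrite (_ : 2 * _ * B = A + 1); last by field.
  by move=> h; exfalso; lra.
have Cp : 0 < C by rewrite lt_def C0 I_sq_ge0.
(* [B / C] is the minimiser in [t]. *)
have := P (B / C).
rewrite (_ : A - _ + _ = (A * C - B ^+ 2) / C); last by field.
by rewrite pmulr_lge0 ?invr_gt0// subr_ge0.
Qed.

Lemma cauchy_schwarz_abs f g : L2 f -> L2 g -> I (fun x => `|f x| * `|g x|) <= nrm f * nrm g.
Proof.
move=> lf lg; have := cauchy_schwarz (L2_abs lf) (L2_abs lg); rewrite !nrm_abs.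
by apply: le_trans; exact: ler_norm.
Qed.

Lemma I_sqD f g : L2 f -> L2 g -> I (fun x => (f x + g x) ^+ 2) =
  I (sq f) + 2 * I (fun x => f x * g x) + I (sq g).
Proof.
move=> lf lg; rewrite (_ : I _ = I (fun x => (f x - (-1) * g x) ^+ 2)).
  by rewrite I_sqB//; ring.
by apply: eqI => x; congr (_ ^+ 2); ring.
Qed.

Lemma nrmD f g : L2 f -> L2 g -> nrm (fun x => f x + g x) <= nrm f + nrm g.
Proof.
move=> lf lg; rewrite -ler_sqr ?nnegrE ?addr_ge0 ?nrm_ge0// nrm_sq I_sqD//.
have := le_trans (ler_norm _) (cauchy_schwarz lf lg).
by rewrite -!nrm_sq sqrrD; lra.
Qed.
Lemma nrm_sub f g h : L2 f -> L2 g -> L2 h ->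
  nrm (fun x => f x - h x) <= nrm (fun x => f x - g x) + nrm (fun x => g x - h x).
Proof.
move=> lf lg lh; rewrite [X in X <= _](_ : _ = nrm (fun x => (f x - g x) + (g x - h x))).
  by apply: nrmD; exact: L2B.
by congr nrm; apply/funext => x; rewrite addrA subrK.
Qed.
Lemma nrm_subC f g : nrm (fun x => f x - g x) = nrm (fun x => g x - f x).
Proof. by rewrite -nrmN; congr nrm; apply/funext => x; rewrite opprB. Qed.

Lemma nrm_le f g : L2 f -> L2 g -> (forall x, `|f x| <= `|g x|) -> nrm f <= nrm g.
Proof.
move=> [mf jf] [mg jg] fg; rewrite ler_wsqrtr//; apply: I_le => // x.
by rewrite -real_normK ?num_real// -[leRHS]real_normK ?num_real// ler_sqr ?nnegrE.
Qed.

Lemma L2_ae f g : L2 f -> msr g -> ae_eq mu setT f g -> L2 g.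
Proof.
move=> [mf jf] mg fg; split => //; apply: (intg_ae _ _ _ jf).
- exact: measurable_funX.
- exact: measurable_funX.
- by apply: filterS fg => x /= h Tx; rewrite h.
Qed.
Lemma nrm_ae f g : msr f -> msr g -> ae_eq mu setT f g -> nrm f = nrm g.
Proof.
move=> mf mg fg; rewrite /nrm; congr Num.sqrt; apply: I_ae.
- exact: measurable_funX.
- exact: measurable_funX.
- by apply: filterS fg => x /= h Tx; rewrite h.
Qed.

Lemma nrm_eq0 f : L2 f -> nrm f = 0 -> ae_eq mu setT f (fun=> 0).
Proof.
move=> [mf jf] /eqP; rewrite -sqrf_eq0 nrm_sq => /eqP h.
have : (\int[mu]_x `|(f x ^+ 2)%:E| = 0)%E.
  rewrite -[RHS](congr1 EFin h) -intgE//; apply: eq_integral => x _.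
  by rewrite gee0_abs// lee_fin sqr_ge0.
move=> /(ae_eq_integral_abs mu measurableT _).1 hh.
have := hh (msrE (measurable_funX 2 mf)).
by apply: filterS => x /= h2 _; have := h2 Logic.I => -[/eqP]; rewrite sqrf_eq0 => /eqP.
Qed.
End SquareIntegrable.

(** * Damped trigonometric integrals and the Poisson kernel *)

Section ExplicitIntegrals.
Context {R : realType}.
Notation mu := (@lebesgue_measure R).
Notation msr f := (measurable_fun [set: R] (f : R -> R)).
Implicit Types f g h F : R -> R.

(** For a non-negative integrand the fundamental theorem of calculus on the half line gives
    integrability together with the value; evenness doubles it. *)
Lemma even_half_line f F (l : R) : (forall x, 0 <= x -> 0 <= f x) -> continuous f ->
  (forall x : R, 0 <= x -> is_derive x 1 F (f x)) -> F x @[x --> +oo] --> l ->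
  intg (fun x => f `|x|) /\ I (fun x => f `|x|) = 2 * (l - F 0).
Proof.
move=> f0 cf dF Fl.
have mf : msr (fun x => f `|x|).
  by apply: measurableT_comp => //; exact: continuous_measurable_fun.
have h : (\int[mu]_(x in `[0%R, +oo[) (f x)%:E = l%:E - (F 0)%:E)%E.
  apply: ge0_continuous_FTC2y => //.
  - exact: continuous_subspaceT.
  - by move=> x x0; have [] := dF x (ltW x0).
  - apply: cvg_at_right_filter; apply: differentiable_continuous; apply/derivable1_diffP.
    by have [] := dF 0 (lexx 0).
  - move=> x; rewrite in_itv/= andbT => x0; rewrite derive1E.
    by have [_ ->] := dF x (ltW x0).
have h1 : (\int[mu]_(x in `[0%R, +oo[) (f `|x|)%:E = l%:E - (F 0)%:E)%E.
  rewrite -h; apply: eq_integral => x; rewrite inE/= in_itv/= andbT => x0.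
  by rewrite ger0_norm.
have h2 : (\int[mu]_(x in `]-oo, 0%R[) (f `|x|)%:E = l%:E - (F 0)%:E)%E.
  rewrite integral_itv_bndo_bndc//; last by apply: measurable_funTS; exact: msrE.
  rewrite -h1 (ge0_integration_by_substitution0 (f := fun x => (f `|x|)%:E)) //.
  - by apply: eq_integral => x _; rewrite normrN.
  - exact: msrE.
  - by move=> x; rewrite lee_fin f0.
have e : (\int[mu]_x (f `|x|)%:E = (2 * (l - F 0))%:E)%E.
  rewrite -(set_itvNyy R) (@itv_bndbnd_setU _ _ _ (BLeft 0))//.
  rewrite ge0_integral_setU//=.
  - by rewrite h1 h2 -EFinB -EFinD; congr EFin; ring.
  - by apply: measurable_funTS; exact: msrE.
  - by move=> x _; rewrite lee_fin f0.
  - apply/disj_setPS => x [/=]; rewrite !in_itv/= andbT => x0 x1.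
    by move: (le_lt_trans x1 x0); rewrite ltxx.
split; last by rewrite /I /Rintegral e.
by apply/ge0_intg => //; [move=> x; exact: f0|rewrite e ltry].
Qed.

(** The constant [1] makes the integrand non-negative, as [even_half_line] requires; subtracting
    [damp e] afterwards isolates the cosine or the sine integral. *)
Lemma damped_trig_integral (e z a b : R) : 0 < e -> (forall y, 0 <= 1 + a * cos y + b * sin y) ->
  let f := fun x => expR (- (e * x)) * (1 + a * cos (z * x) + b * sin (z * x)) in
  intg (fun x => f `|x|) /\
  I (fun x => f `|x|) = 2 * (e^-1 + (a * e + b * z) / (e ^+ 2 + z ^+ 2)).
Proof.
move=> e0 ab f.
(* The trigonometric terms are the real and imaginary parts of [exp (-(e - i z) x) / (e - i z)]. *)
pose F x := - (expR (- (e * x)) * (e^-1 + (a * (e * cos (z * x) - z * sin (z * x)) +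
   b * (e * sin (z * x) + z * cos (z * x))) / (e ^+ 2 + z ^+ 2))).
have D0 : e ^+ 2 + z ^+ 2 != 0 by rewrite gt_eqF// ltr_pwDl ?sqr_ge0// exprn_gt0.
have -> : 2 * (e^-1 + (a * e + b * z) / (e ^+ 2 + z ^+ 2)) = 2 * (0 - F 0).
  by rewrite /F !mulr0 oppr0 expR0 cos0 sin0; field; rewrite D0 gt_eqF.
apply: even_half_line.
- by move=> x _; rewrite mulr_ge0 ?expR_ge0.
- move=> x; apply: cvgM.
    apply: continuous_comp; last exact: continuous_expR.
    by apply: cvgN; apply: cvgMr; exact: cvg_id.
  have cz : {for x, continuous (fun x : R => z * x)} by apply: cvgMr; exact: cvg_id.
  apply: cvgD; first apply: cvgD; first exact: cvg_cst.
    apply: cvgMr; apply: continuous_comp => //; exact: continuous_cos.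
  apply: cvgMr; apply: continuous_comp => //; exact: continuous_sin.
- move=> x _; rewrite /F /f.
  apply: is_derive_eq.
  rewrite /GRing.scale /=; field.
  by rewrite D0 gt_eqF.
- pose C := e^-1 + (`|a| * (e + `|z|) + `|b| * (e + `|z|)) / (e ^+ 2 + z ^+ 2).
  have ce : expR (- (e * x)) @[x --> +oo] --> 0.
    by apply: (cvg_comp (fun x => e * x) (fun x => expR (- x)));
      [exact: gt0_cvgMry|exact: cvgr_expR].
  have FC x : `|F x| <= C * expR (- (e * x)).
    rewrite normrN normrM ger0_norm ?expR_ge0// mulrC ler_wpM2r ?expR_ge0//.
    apply: (le_trans (ler_normD _ _)); rewrite [X in X + _]ger0_norm ?invr_ge0 ?(ltW e0)// lerD2l.
    have Dp : 0 < e ^+ 2 + z ^+ 2 by rewrite ltr_pwDl ?sqr_ge0// exprn_gt0.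
    have Di : 0 <= (e ^+ 2 + z ^+ 2)^-1 by rewrite invr_ge0 ltW.
    rewrite normrM (ger0_norm Di) ler_wpM2r//.
    rewrite (le_trans (ler_normD _ _))// !normrM lerD// ler_wpM2l//.
      rewrite (le_trans (ler_normB _ _))// !normrM (ger0_norm (ltW e0)) lerD//.
        by rewrite ler_piMr ?(ltW e0)// cos_max.
      by rewrite ler_piMr// sin_max.
    rewrite (le_trans (ler_normD _ _))// !normrM (ger0_norm (ltW e0)) lerD//.
      by rewrite ler_piMr ?(ltW e0)// sin_max.
    by rewrite ler_piMr// cos_max.
  apply/norm_cvg0P; apply: (@squeeze_cvgr _ _ _ _ (fun=> 0) (fun x => C * expR (- (e * x)))).
  - by apply: nearW => x; rewrite normr_ge0 FC.
  - exact: cvg_cst.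
  - by rewrite -[X in _ --> X](mulr0 C); apply: cvgMr.
Qed.

Definition damp (e x : R) : R := expR (- (e * `|x|)).

Lemma damp_ge0 e x : 0 <= damp e x. Proof. exact: expR_ge0. Qed.
Lemma damp_le1 e x : 0 <= e -> damp e x <= 1.
Proof. by move=> e0; rewrite /damp -expR0 ler_expR oppr_le0 mulr_ge0. Qed.
Lemma dampN e x : damp e (- x) = damp e x. Proof. by rewrite /damp normrN. Qed.

Lemma intg_damp e : 0 < e -> intg (damp e).
Proof.
move=> e0; have [|] := @damped_trig_integral e 0 0 0 e0; first by move=> y; rewrite !mul0r !addr0.
by under [X in intg X -> _]eq_fun do rewrite !mul0r !addr0 mulr1.
Qed.
Lemma msr_damp e : 0 < e -> msr (damp e).
Proof. by move=> /intg_damp/intg_msr. Qed.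
Lemma I_damp e : 0 < e -> I (damp e) = 2 / e.
Proof.
move=> e0; have [|_] := @damped_trig_integral e 0 0 0 e0; first by move=> y; rewrite !mul0r !addr0.
rewrite !mul0r addr0 mul0r addr0 => <-.
by apply: eqI => x; rewrite !mul0r !addr0 mulr1.
Qed.

Lemma I_damp_cos e z : 0 < e -> I (fun x => damp e x * cos (z * x)) = 2 * e / (e ^+ 2 + z ^+ 2).
Proof.
move=> e0; have [|i1 h] := @damped_trig_integral e z 1 0 e0.
  by move=> y; rewrite mul0r addr0 mul1r -lerBlDl sub0r; have := cos_max y; rewrite ler_norml => /andP[].
have -> : (fun x => damp e x * cos (z * x)) = fun x =>
  expR (- (e * `|x|)) * (1 + 1 * cos (z * `|x|) + 0 * sin (z * `|x|)) - damp e x.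
  apply/funext => x.
  have -> : cos (z * `|x|) = cos (z * x) by case: (ger0P x) => x0; rewrite ?mulrN ?cosN.
  by rewrite /damp; ring.
rewrite IB//; last exact: intg_damp.
by rewrite h I_damp//; ring.
Qed.

(** With [|x|] inside the sine the integrand is even; this is what the product of the odd kernel and
    a sine reduces to. *)
Lemma I_damp_sin_abs z : I (fun x => damp 1 x * sin (z * `|x|)) = 2 * z / (1 + z ^+ 2).
Proof.
have [//||i1 h] := @damped_trig_integral 1 z 0 1.
  by move=> y; rewrite mul0r addr0 mul1r -lerBlDl sub0r; have := sin_max y; rewrite ler_norml => /andP[].
have -> : (fun x => damp 1 x * sin (z * `|x|)) = fun x =>
  expR (- (1 * `|x|)) * (1 + 0 * cos (z * `|x|) + 1 * sin (z * `|x|)) - damp 1 x.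
  by apply/funext => x; rewrite /damp; ring.
rewrite IB//; last exact: intg_damp.
by rewrite h I_damp// invr1 mul0r add0r mul1r expr1n; ring.
Qed.

Lemma intg_damp_bounded e f : 0 < e -> msr f -> (forall x, `|f x| <= 1) -> intg (fun x => damp e x * f x).
Proof.
move=> e0 mf f1; apply: (intg_le _ _ (intg_damp e0)).
  by apply: measurable_funM => //; exact: msr_damp.
by move=> x; rewrite normrM (ger0_norm (damp_ge0 _ _)) ler_piMr ?damp_ge0.
Qed.

Lemma I_odd f : intg f -> (forall x, f (- x) = - f x) -> I f = 0.
Proof.
move=> jf fN; have := I_opp jf; rewrite (eqI fN) IN// => h; lra.
Qed.

(** The transform of [damp e], by [I_damp_cos]: the Poisson kernel of the upper half plane at height
    [e], scaled to total mass [2 pi]. *)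
Definition poisson (e z : R) : R := 2 * e / (e ^+ 2 + z ^+ 2).

Lemma poisson_ge0 e z : 0 < e -> 0 <= poisson e z.
Proof. by move=> e0; rewrite divr_ge0 ?mulr_ge0 ?addr_ge0 ?sqr_ge0 ?ltW. Qed.

Lemma poissonN e z : poisson e (- z) = poisson e z.
Proof. by rewrite /poisson sqrrN. Qed.

Lemma intg_I_poisson e : 0 < e -> intg (poisson e) /\ I (poisson e) = 2 * pi.
Proof.
move=> e0.
have D0 x : e ^+ 2 + x ^+ 2 != 0 by rewrite gt_eqF// ltr_pwDl ?sqr_ge0// exprn_gt0.
have h : (fun x => poisson e `|x|) = poisson e.
  by apply/funext => x; rewrite /poisson real_normK ?num_real.
have := @even_half_line (poisson e) (fun x => 2 * atan (e^-1 * x)) pi.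
rewrite h mulr0 atan0 mulr0 subr0; apply.
- by move=> x _; exact: poisson_ge0.
- move=> x; apply: cvgM; first exact: cvg_cst.
  apply: cvgV => //; apply: cvgD; first exact: cvg_cst.
  exact: exprn_continuous.
- move=> x _; apply: is_derive_eq; rewrite /GRing.scale /= /poisson.
  have D1 : 1 + (e^-1 * x) ^+ 2 != 0 by rewrite gt_eqF// ltr_pwDl ?sqr_ge0.
  field.
  by rewrite D0 gt_eqF.
- have -> : pi = 2 * (pi / 2) :> R by field.
  apply: cvgMr; apply: (cvg_comp (fun x => e^-1 * x) (@atan R)); last exact: cvgy_atan.
  by apply: gt0_cvgMry => //; rewrite invr_gt0.
Qed.

(** Concentration at the origin: away from it the kernel is [O(e)] times a fixed integrable
    function. The factor comes from [1 + z^2 <= (1 + d^-2) z^2]. *)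
Lemma poisson_small e z d : 0 < e -> 0 < d -> d <= `|z| -> poisson e z <= e * (1 + d ^- 2) * poisson 1 z.
Proof.
move=> e0 d0 dz.
have z2 : d ^+ 2 <= z ^+ 2 by rewrite -[leRHS]real_normK ?num_real// ler_sqr ?nnegrE// ltW.
have d2 : 0 < d ^+ 2 by rewrite exprn_gt0.
have e2 : 0 < e ^+ 2 by rewrite exprn_gt0.
rewrite /poisson expr1n mulr1.
rewrite (_ : e * _ * _ = 2 * e * ((1 + d ^- 2) / (1 + z ^+ 2))); last by field; lra.
rewrite ler_pM2l ?mulr_gt0// -[leLHS]mul1r ler_pdivrMr; last by lra.
rewrite mulrAC ler_pdivlMr; last by lra.
have : 1 <= d ^- 2 * z ^+ 2 by rewrite mulrC ler_pdivlMr// mul1r.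
have : 0 < d ^- 2 by rewrite invr_gt0.
by move: (d ^- 2) => k k0 kz; nra.
Qed.
End ExplicitIntegrals.

(** * Integrals over the plane *)

Section DoubleIntegrals.
Context {R : realType}.
Notation mu := (@lebesgue_measure R).
Implicit Types F G : R * R -> R.

Definition II F : R := \int[(mu \x mu)%E]_p F p.

Lemma II1 F : fub F -> I (fun x => I (fun y => F (x, y))) = II F.
Proof. by move=> h; rewrite /II /Rintegral -I_fub1. Qed.
Lemma II2 F : fub F -> I (fun y => I (fun x => F (x, y))) = II F.
Proof. by move=> h; rewrite /II /Rintegral -I_fub2. Qed.
Lemma IID F G : fub F -> fub G -> II (fun p => F p + G p) = II F + II G.
Proof. by move=> h1 h2; rewrite /II RintegralD. Qed.
Lemma IIZ a F : fub F -> II (fun p => a * F p) = a * II F.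
Proof. by move=> h1; rewrite /II RintegralZl. Qed.
Lemma II_le F G : fub F -> fub G -> (forall p, F p <= G p) -> II F <= II G.
Proof. by move=> h1 h2 h; apply: le_Rintegral. Qed.
End DoubleIntegrals.

(** * The Hartley transform of integrable functions *)

Section Hartley.
Context {R : realType}.
Notation mu := (@lebesgue_measure R).
Notation msr f := (measurable_fun [set: R] (f : R -> R)).
Notation msr2 F := (measurable_fun [set: R * R] (F : R * R -> R)).
Notation sq f := (fun x => f x ^+ 2).
Implicit Types f g h : R -> R.

Definition cas (x : R) : R := cos x + sin x.

Lemma continuous_cas : continuous cas.
Proof. by move=> x; apply: cvgD; [exact: continuous_cos|exact: continuous_sin]. Qed.
Lemma msr_cas : msr cas.
Proof. by apply: continuous_measurable_fun; exact: continuous_cas. Qed.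
Lemma cas_le2 x : `|cas x| <= 2.
Proof. by rewrite (le_trans (ler_normD _ _))// (_ : 2 = 1 + 1)// lerD ?cos_max ?sin_max. Qed.
Lemma casM_le4 x y : `|cas x * cas y| <= 4.
Proof. by rewrite normrM (_ : 4 = 2 * 2) ?ler_pM ?cas_le2//; ring. Qed.
Lemma msr_casM xi : msr (fun x => cas (x * xi)).
Proof. by apply: (measurableT_comp msr_cas); exact: measurable_funM. Qed.
Lemma casM x y : cas x * cas y = cos (x - y) + sin (x + y).
Proof. by rewrite /cas cosB sinD; ring. Qed.
Lemma casD x y : cas (x + y) = cos x * cas y + sin x * cas (- y).
Proof. by rewrite /cas cosD sinD cosN sinN; ring. Qed.

Definition hartley1 f (xi : R) : R := I (fun x => f x * cas (x * xi)).

Lemma intg_bounded f b (C : R) : intg f -> msr b -> (forall x, `|b x| <= C) -> intg (fun x => f x * b x).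
Proof.
move=> jf mb bC; apply: (intg_le _ _ (intgZ C (intg_abs jf))).
  by apply: measurable_funM => //; exact: intg_msr.
by move=> x; rewrite normrM mulrC ler_wpM2r.
Qed.
Lemma intg_cas f xi : intg f -> intg (fun x => f x * cas (x * xi)).
Proof.
move=> jf; apply: (@intg_bounded _ _ 2 jf); first exact: msr_casM.
by move=> x; exact: cas_le2.
Qed.

Lemma hartley1D f g xi : intg f -> intg g ->
  hartley1 (fun x => f x + g x) xi = hartley1 f xi + hartley1 g xi.
Proof.
move=> jf jg; rewrite /hartley1 -ID; [|exact: intg_cas..].
by apply: eqI => x; rewrite mulrDl.
Qed.
Lemma hartley1B f g xi : intg f -> intg g ->
  hartley1 (fun x => f x - g x) xi = hartley1 f xi - hartley1 g xi.
Proof.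
move=> jf jg; rewrite /hartley1 -IB; [|exact: intg_cas..].
by apply: eqI => x; rewrite mulrBl.
Qed.
Lemma hartley1_abs f xi : intg f -> `|hartley1 f xi| <= 2 * I (fun x => `|f x|).
Proof.
move=> jf; rewrite -IZ; last exact: intg_abs.
apply: I_le_abs; [exact: intg_cas|exact/intgZ/intg_abs|].
by move=> x; rewrite normrM mulrC ler_wpM2r// cas_le2.
Qed.

Lemma hartley1_continuous f : intg f -> continuous (hartley1 f).
Proof.
move=> jf xi.
apply: (@continuity_under_integral R _ _ mu (fun xi x => f x * cas (x * xi)) setT measurableT (xi - 1) (xi + 1)
   _ _ (fun x => 2 * `|f x|)).
- by move=> z _; exact: intg_cas.
- apply: aeW => y _ z _; apply: cvgM; first exact: cvg_cst.
  apply: (@continuous_comp _ _ _ (fun z : R => y * z) cas).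
    by apply: cvgM; [exact: cvg_cst|exact: cvg_id].
  exact: continuous_cas.
- exact/intgZ/intg_abs.
- by move=> z _; apply: aeW => x _; rewrite normrM mulrC ler_wpM2r// cas_le2.
- by rewrite inE/= in_itv/= ltrBlDr ltrDl ltr01.
Qed.
Lemma msr_hartley1 f : intg f -> msr (hartley1 f).
Proof. by move=> h; apply: continuous_measurable_fun; exact: hartley1_continuous. Qed.

Lemma msr2_cas : msr2 (fun p => cas (p.1 * p.2)).
Proof.
apply: (measurableT_comp msr_cas); apply: measurable_funM.
- exact: measurable_fst.
- exact: measurable_snd.
Qed.

(** The multiplication formula: Fubini for the bounded symmetric kernel [cas (x * y)]. *)
Lemma hartley1_sym f g : intg f -> intg g ->
  I (fun x => f x * hartley1 g x) = I (fun x => hartley1 f x * g x).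
Proof.
move=> jf jg; pose F (p : R * R) := f p.1 * g p.2 * cas (p.1 * p.2).
have hF : fub F.
  apply: (fub_le _ _ (fubZ 2 (fub_prod (intg_abs jf) (intg_abs jg)))).
    apply: measurable_funM; last exact: msr2_cas.
    apply: measurable_funM; [apply: msr_fst|apply: msr_snd]; exact: intg_msr.
  move=> p; rewrite normrM mulrC normrM ler_wpM2r ?mulr_ge0//; exact: cas_le2.
have := fubini hF; rewrite /F /= => h.
transitivity (I (fun x => I (fun y => f x * g y * cas (x * y)))).
  apply: eqI => x; rewrite /hartley1 -IZ; last exact: intg_cas.
  by apply: eqI => y; rewrite mulrA (mulrC y).
rewrite h; apply: eqI => y; rewrite /hartley1 mulrC -IZ; last exact: intg_cas.
by apply: eqI => x; ring.
Qed.

(** The product of the two kernels is [cos ((x - y) xi) + sin ((x + y) xi)]. The sine is odd in [xi]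
    and drops out against the even weight, which leaves a function of [x - y] alone. *)
Lemma I_damp_cas e x y : 0 < e ->
  I (fun xi => damp e xi * (cas (x * xi) * cas (y * xi))) = poisson e (x - y).
Proof.
move=> e0; rewrite /poisson -I_damp_cos//.
have cM z : msr (fun xi => cos (z * xi)).
  by apply: (measurableT_comp (@continuous_measurable_fun _ _ (@continuous_cos R))); exact: measurable_funM.
have sM z : msr (fun xi => sin (z * xi)).
  by apply: (measurableT_comp (@continuous_measurable_fun _ _ (@continuous_sin R))); exact: measurable_funM.
have i1 : intg (fun xi => damp e xi * cos ((x - y) * xi)).
  by apply: intg_damp_bounded => // t; exact: cos_max.
have i2 : intg (fun xi => damp e xi * sin ((x + y) * xi)).
  by apply: intg_damp_bounded => // t; exact: sin_max.
rewrite -[RHS]addr0 -[X in _ = _ + X](I_odd i2) -?ID//.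
  by apply: eqI => xi; rewrite casM mulrBl mulrDl mulrDr.
by move=> t; rewrite dampN mulrN sinN mulrN.
Qed.

(** A regularised inversion formula: Fubini turns the damped double transform into Poisson smoothing
    of [f]. *)
Lemma hartley1_damp e f x : 0 < e -> intg f ->
  hartley1 (fun xi => damp e xi * hartley1 f xi) x = I (fun y => f y * poisson e (x - y)).
Proof.
move=> e0 jf.
pose F (p : R * R) := damp e p.1 * f p.2 * (cas (x * p.1) * cas (p.2 * p.1)).
have hF : fub F.
  apply: (fub_le _ _ (fubZ 4 (fub_prod (intg_damp e0) (intg_abs jf)))).
    apply: measurable_funM.
      apply: measurable_funM; [apply: msr_fst|apply: msr_snd]; first exact: msr_damp.
      exact: intg_msr.
    apply: measurable_funM.
      apply: (msr_fst (f := fun t => cas (x * t))).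
      by apply: (measurableT_comp msr_cas); exact: measurable_funM.
    apply: (measurableT_comp msr_cas); apply: measurable_funM.
      exact: measurable_snd.
    exact: measurable_fst.
  move=> p; rewrite normrM (normrM (damp _ _)) (ger0_norm (damp_ge0 _ _)) mulrC.
  by rewrite ler_wpM2r ?casM_le4// mulr_ge0 ?damp_ge0.
have := fubini hF; rewrite /F /= => h.
transitivity (I (fun xi => I (fun y => damp e xi * f y * (cas (x * xi) * cas (y * xi))))).
  apply: eqI => xi; rewrite /hartley1 mulrAC -IZ; last exact: intg_cas.
  by apply: eqI => y; rewrite (mulrC xi); ring.
rewrite h; apply: eqI => y; rewrite -(I_damp_cas _ _ e0) -IZ.
  by apply: eqI => xi; ring.
apply: (@intg_bounded _ _ 4); first exact: intg_damp.
  by apply: measurable_funM; apply: (measurableT_comp msr_cas); exact: measurable_funM.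
by move=> t; exact: casM_le4.
Qed.

Lemma intg_damp_hartley1 e f : 0 < e -> intg f -> intg (fun xi => damp e xi * hartley1 f xi).
Proof.
move=> e0 jf; apply: (@intg_bounded _ _ (2 * I (fun x => `|f x|))).
- exact: intg_damp.
- exact: msr_hartley1.
- by move=> t; exact: hartley1_abs.
Qed.

Lemma fub_poisson e f : 0 < e -> L2 f -> fub (fun p => poisson e (p.1 - p.2) * f p.1 ^+ 2) /\
  II (fun p => poisson e (p.1 - p.2) * f p.1 ^+ 2) = 2 * pi * I (sq f).
Proof.
move=> e0 [mf jf]; have [ip Ip] := intg_I_poisson e0.
have h : fub (fun p => poisson e (p.1 - p.2) * f p.1 ^+ 2).
  have := fub_swap (fub_conv ip jf); apply: fub_le => /=.
    by apply: measurable_funM; [apply: msr_diff; exact: intg_msr|apply: (msr_fst (f := sq f)); exact: measurable_funX].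
  move=> p; rewrite -poissonN opprB ger0_norm// mulr_ge0 ?sqr_ge0//.
  exact: poisson_ge0.
split => //; rewrite -(II1 h) /= -IZ//; apply: eqI => x.
rewrite (_ : I _ = I (fun y => f x ^+ 2 * poisson e (x - y))); last by apply: eqI => y; rewrite mulrC.
rewrite IZ; last exact: (intg_refl x ip).
by rewrite (I_refl x ip) Ip mulrC.
Qed.

Lemma fub_poisson2 e f : 0 < e -> L2 f -> fub (fun p => poisson e (p.1 - p.2) * f p.2 ^+ 2) /\
  II (fun p => poisson e (p.1 - p.2) * f p.2 ^+ 2) = 2 * pi * I (sq f).
Proof.
move=> e0 lf; have [h e1] := fub_poisson e0 lf.
have E : (fun p : R * R => poisson e (p.1 - p.2) * f p.2 ^+ 2) =
   (fun p => (fun p => poisson e (p.1 - p.2) * f p.1 ^+ 2) (p.2, p.1)).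
  by apply/funext => p /=; rewrite -poissonN opprB.
have h2 := fub_swap h; rewrite E; split => //.
by rewrite -e1 -(II1 h2) -(II2 h).
Qed.

(* Equals [int e^(-e|xi|) (hartley1 f)^2], since [poisson e] is the transform of [e^(-e|xi|)]; letting [e] tend to [0] gives Bessel and Parseval. *)
Definition poisson_form e f : R := II (fun p => poisson e (p.1 - p.2) * (f p.1 * f p.2)).

Lemma fub_poisson_form e f : 0 < e -> L2 f -> fub (fun p => poisson e (p.1 - p.2) * (f p.1 * f p.2)).
Proof.
move=> e0 lf; have [h1 _] := fub_poisson e0 lf; have [h2 _] := fub_poisson2 e0 lf.
have [ip _] := intg_I_poisson e0; have mf := L2_msr lf.
apply: (fub_le _ _ (fubD h1 h2)).
  apply: measurable_funM; first by apply: msr_diff; exact: intg_msr.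
  by apply: measurable_funM; [exact: msr_fst|exact: msr_snd].
move=> p; rewrite normrM (ger0_norm (poisson_ge0 _ e0)) -mulrDr ler_wpM2l ?poisson_ge0//.
by rewrite ler_norml; apply/andP; split; nra.
Qed.

Lemma I_damp_hartley1 e f : 0 < e -> intg f -> L2 f ->
  I (fun xi => damp e xi * hartley1 f xi ^+ 2) = poisson_form e f.
Proof.
move=> e0 jf lf.
rewrite (_ : I _ = I (fun xi => hartley1 f xi * (damp e xi * hartley1 f xi))); last first.
  by apply: eqI => xi; ring.
rewrite -hartley1_sym//; last exact: intg_damp_hartley1.
rewrite /poisson_form -(II1 (fub_poisson_form e0 lf)) /=.
apply: eqI => x; rewrite hartley1_damp// -IZ.
  by apply: eqI => y; ring.
have [ip _] := intg_I_poisson e0.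
apply: (@intg_bounded _ _ (2 / e)) => //; first exact: (intg_msr (intg_refl x ip)).
move=> y; rewrite ger0_norm ?poisson_ge0// /poisson.
have e2 : 0 < e ^+ 2 by rewrite exprn_gt0.
rewrite ler_pdivrMr; last by rewrite ltr_pwDl ?sqr_ge0.
rewrite (_ : 2 * e = 2 / e * e ^+ 2); last by field; rewrite gt_eqF.
by rewrite ler_pM2l ?divr_gt0// lerDl sqr_ge0.
Qed.

(** From [2 f(x) f(y) <= f(x)^2 + f(y)^2]; the kernel integrates to [2 pi] in either variable. *)
Lemma poisson_form_le e f : 0 < e -> L2 f -> poisson_form e f <= 2 * pi * I (sq f).
Proof.
move=> e0 lf; have [h1 E1] := fub_poisson e0 lf; have [h2 E2] := fub_poisson2 e0 lf.
have -> : 2 * pi * I (sq f) = 2^-1 * II (fun p => poisson e (p.1 - p.2) * f p.1 ^+ 2 + poisson e (p.1 - p.2) * f p.2 ^+ 2).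
  by rewrite IID// E1 E2; field.
rewrite -IIZ; last exact: fubD.
apply: II_le; [exact: fub_poisson_form|exact/fubZ/fubD|].
move=> p; rewrite -mulrDr [leRHS]mulrCA ler_wpM2l ?poisson_ge0//.
by have := sqr_ge0 (f p.1 - f p.2); nra.
Qed.

(** Fatou along [e = 1/(n+1)], because the square of the transform is not yet known to be
    integrable. Only an inequality comes out of this; equality needs a lower bound for
    [poisson_form]. *)
Lemma hartley1_bessel f : intg f -> L2 f -> L2 (hartley1 f) /\ I (sq (hartley1 f)) <= 2 * pi * I (sq f).
Proof.
move=> jf lf; have mh := msr_hartley1 jf.
have en n : 0 < n.+1%:R^-1 :> R by rewrite invr_gt0.
have [i Il] : intg (sq (hartley1 f)) /\ I (sq (hartley1 f)) <= 2 * pi * I (sq f).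
  apply: (@fatou_intg _ (fun n xi => damp n.+1%:R^-1 xi * hartley1 f xi ^+ 2)).
  - by move=> n; apply: measurable_funM; [exact: msr_damp|exact: measurable_funX].
  - exact: measurable_funX.
  - by move=> n x; rewrite mulr_ge0 ?damp_ge0 ?sqr_ge0.
  - move=> x; rewrite -[X in _ --> X]mul1r; apply: cvgM; last exact: cvg_cst.
    rewrite /damp -[X in _ --> X]expR0.
    apply: (cvg_comp (fun n => - (n.+1%:R^-1 * `|x|)) expR); last exact: continuous_expR.
    have -> : 0 = - (0 * `|x|) :> R by rewrite mul0r oppr0.
    apply: cvgN; apply: cvgM; last exact: cvg_cst.
    exact: cvg_harmonic.
  - move=> n; split.
      rewrite (_ : (fun xi => _) = (fun xi => (damp n.+1%:R^-1 xi * hartley1 f xi) * hartley1 f xi)); last first.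
        by apply/funext => xi; ring.
      apply: (@intg_bounded _ _ (2 * I (fun x => `|f x|))) => //; first exact: intg_damp_hartley1.
      by move=> t; exact: hartley1_abs.
    rewrite I_damp_hartley1//; exact: poisson_form_le.
by split.
Qed.
End Hartley.

(** * Truncation to [[-n, n]] *)

Section Truncation.
Context {R : realType}.
Notation mu := (@lebesgue_measure R).
Notation msr f := (measurable_fun [set: R] (f : R -> R)).
Notation sq f := (fun x => f x ^+ 2).
Implicit Types f g h : R -> R.

Definition box (n : nat) : R -> R := \1_(`[- n%:R, n%:R]%classic : set R).

Lemma boxE n x : box n x = (`|x| <= n%:R)%R%:R.
Proof. by rewrite /box indicE mem_setE in_itv/= -ler_norml. Qed.
Lemma box_ge0 n x : 0 <= box n x. Proof. by rewrite boxE. Qed.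
Lemma box_le1 n x : box n x <= 1. Proof. by rewrite boxE lern1 leq_b1. Qed.
Lemma msr_box n : msr (box n). Proof. exact: measurable_indic. Qed.
Lemma intg_box n : intg (box n).
Proof.
apply/ge0_intg; [exact: msr_box|exact: box_ge0|].
rewrite integral_indic//= setIT lebesgue_measure_itv/=; case: ifP => _; last by rewrite ltry.
by rewrite -EFinB ltry.
Qed.
Lemma box_sq n x : box n x ^+ 2 = box n x.
Proof. by rewrite boxE -natrX; case: (_ <= _). Qed.
Lemma L2_box n : L2 (box n).
Proof. by split; [exact: msr_box|under [X in intg X]eq_fun do rewrite box_sq; exact: intg_box]. Qed.

(** The same cut-off as in [fourier_trunc], so that the limits defining the two transforms can be
    compared. *)
Definition trunc n f : R -> R := fun x => f x * box n x.

Lemma truncE n f : \int[mu]_(x in `[- n%:R, n%:R]) f x = I (trunc n f).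
Proof. by rewrite Rintegral_mkcond patch_indic. Qed.

Lemma trunc_le n f x : `|trunc n f x| <= `|f x|.
Proof. by rewrite normrM (ger0_norm (box_ge0 _ _)) ler_piMr ?box_le1. Qed.
Lemma msr_trunc n f : msr f -> msr (trunc n f).
Proof. by move=> mf; apply: measurable_funM => //; exact: msr_box. Qed.
Lemma L2_trunc n f : L2 f -> L2 (trunc n f).
Proof.
move=> lf; apply: (L2_le _ _ (L2_abs lf)); first exact: (msr_trunc n (L2_msr lf)).
exact: trunc_le.
Qed.
Lemma intg_trunc n f : L2 f -> intg (trunc n f).
Proof. by move=> lf; exact: (L2M lf (L2_box n)). Qed.

Lemma box_cvg x : box n x @[n --> \oo] --> (1 : R).
Proof.
apply: cvg_near_cst; exists (Num.truncn `|x|).+1 => // n /= xn.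
rewrite boxE (le_trans (ltW (truncnS_gt _)))// ler_nat//.
Qed.
Lemma trunc_cvg f x : trunc n f x @[n --> \oo] --> f x.
Proof. by rewrite -[X in _ --> X]mulr1; apply: cvgM; [exact: cvg_cst|exact: box_cvg]. Qed.

Lemma nrm_trunc_cvg f : L2 f -> nrm (fun x => f x - trunc n f x) @[n --> \oo] --> 0.
Proof.
move=> lf; rewrite -sqrtr0; apply: (cvg_comp (fun n => I (fun x => (f x - trunc n f x) ^+ 2)) Num.sqrt);
  last exact: sqrt_continuous.
rewrite -I0; case: (lf) => mf jf; apply: (@dominated _ _ _ (sq f)) => //.
- by move=> n; apply: measurable_funX; apply: measurable_funB => //; exact: msr_trunc.
- move=> x; have -> : 0 = (f x - f x) ^+ 2 :> R by rewrite subrr expr0n.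
  apply: (cvg_comp (fun n => f x - trunc n f x) (fun z => z ^+ 2)); last exact: exprn_continuous.
  by apply: cvgB; [exact: cvg_cst|exact: trunc_cvg].
- move=> n x; rewrite ger0_norm ?sqr_ge0// /trunc -{1}(mulr1 (f x)) -mulrBr exprMn ler_piMr ?sqr_ge0//.
  by rewrite boxE; case: (`|x| <= n%:R); rewrite ?subrr ?subr0 ?expr0n ?expr1n.
Qed.
End Truncation.

(** * Continuity of translation in [L^1] *)

Section Translation.
Context {R : realType}.
Notation mu := (@lebesgue_measure R).
Notation msr f := (measurable_fun [set: R] (f : R -> R)).
Notation sq f := (fun x => f x ^+ 2).
Implicit Types f g h : R -> R.

(** For such [h] the integral of [|h x - h (x - z)|] is a continuous function of [z] by dominated
    convergence, and it vanishes at [z = 0]. *)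
Lemma continuous_translation h n : continuous h -> (forall x, n%:R < `|x| -> h x = 0) ->
  intg h /\ forall eta : R, 0 < eta -> exists2 d : R, 0 < d &
    forall z, `|z| < d -> I (fun x => `|h x - h (x - z)|) <= eta.
Proof.
move=> ch h0; have mh : msr h by apply: continuous_measurable_fun.
have [C hC] : exists C : R, forall x, `|h x| <= C * box n x.
  have nn : - n%:R <= n%:R :> R by rewrite -subr_ge0 opprK addr_ge0.
  have [c _ Hc] := @EVT_max R (fun x => `|h x|) _ _ nn (continuous_subspaceT (fun x => cvg_norm (ch x))).
  exists `|h c| => x; rewrite boxE; case: (leP `|x| n%:R) => xn; last by rewrite h0// normr0 mulr0.
  by rewrite mulr1 Hc// in_itv/= -ler_norml.
have C0 : 0 <= C.
  have := hC 0; rewrite boxE normr0 ler0n mulr1; exact: le_trans.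
have ih : intg h by apply: (intg_le mh hC); exact/intgZ/intg_box.
split => // eta eta0.
have G z : intg (fun x => `|h x - h (x - z)|).
  by apply: intg_abs; apply: intgB => //; exact: intg_shift.
have cF : {for 0, continuous (fun z => I (fun x => `|h x - h (x - z)|))}.
  apply: (@continuity_under_integral R _ _ mu (fun z x => `|h x - h (x - z)|) setT measurableT (- 1) 1
    _ _ (fun x => C * box n x + C * box n.+1 x)).
  - by move=> z _; exact: G.
  - apply: aeW => y _ z _; apply: cvg_norm; apply: cvgB; first exact: cvg_cst.
    apply: (@continuous_comp _ _ _ (fun z : R => y - z) h); last exact: ch.
    by apply: cvgB; [exact: cvg_cst|exact: cvg_id].
  - by apply: intgD; apply: intgZ; exact: intg_box.
  (* For [|z| < 1] the translate is supported in [[-n-1, n+1]]; this explains the second box of the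
     majorant. *)
  - move=> z /=; rewrite in_itv/= => z1; apply: aeW => x _.
    rewrite normr_id (le_trans (ler_normB _ _))// lerD// (le_trans (hC _))// ler_wpM2l//.
    rewrite !boxE; case: (leP `|x - z| n%:R) => // xz; rewrite (_ : `|x| <= _ = true)//.
    rewrite -[x](subrK z) (le_trans (ler_normD _ _))// -natr1 lerD// ltW//.
    by rewrite ltr_norml.
  - by rewrite inE/= in_itv/= ltrN10 ltr01.
have F0 : I (fun x => `|h x - h (x - 0)|) = 0.
  by rewrite -[RHS]I0; apply: eqI => x; rewrite subr0 subrr normr0.
have {}cF : I (fun x => `|h x - h (x - z)|) @[z --> 0] --> I (fun x => `|h x - h (x - 0)|) by exact: cF.
move: cF; rewrite F0 => /cvgr0_norm_le/(_ eta eta0).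
move=> /nbhs_ballP[d /= d0 H]; exists d => // z zd.
have := H z; rewrite /= /ball/= sub0r normrN => /(_ zd).
by rewrite ger0_norm// I_ge0.
Qed.

(** Approximation by a continuous function of compact support, with one third of [eta] for each of
    the two replacements and one for [continuous_translation]. *)
Lemma L1_translation f n (eta : R) : intg f -> (forall x, n%:R < `|x| -> f x = 0) -> 0 < eta ->
  exists2 d : R, 0 < d & forall z, `|z| < d -> I (fun x => `|f x - f (x - z)|) <= eta.
Proof.
move=> jf f0 eta0; pose E : set R := `[- n.+1%:R, n.+1%:R]%classic.
have mE : measurable E by exact: measurable_itv.
have jE : mu.-integrable E (EFin \o f) by apply: (integrableS measurableT).
have Efin : (mu E < +oo)%E.
  by rewrite lebesgue_measure_itv/=; case: ifP => _; rewrite ?ltry// -EFinB ltry.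
have [g_ [cg _ gf]] := approximation_continuous_integrable mE Efin jE.
(* A trapezoidal cut-off, 1 on [[-n, n]] and 0 outside [[-n-1, n+1]]. It gives the approximant
   compact support without moving it away from [f], because [f] vanishes wherever [chi] differs from
   1. *)
pose chi (x : R) : R := Num.max 0 (Num.min 1 (n.+1%:R - `|x|)).
have chi1 x : `|x| <= n%:R -> chi x = 1.
  move=> xn; rewrite /chi min_l ?max_r//.
  by rewrite lerBrDr -natr1 addrC lerD2r.
have chi0 x : n.+1%:R < `|x| -> chi x = 0.
  by move=> xn; rewrite /chi max_l// ge_min subr_le0 (ltW xn) orbT.
have chi01 x : 0 <= chi x <= 1.
  by rewrite /chi le_max lexx ge_max ler01 ge_min lexx.
have [k gk] : exists k, (\int[mu]_(z in E) `|(f z - g_ k z)%:E| < (eta / 3)%:E)%E.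
  have e3 : (0 < (eta / 3)%:E)%E by rewrite lte_fin divr_gt0.
  have /= := gf [set z | z < (eta / 3)%:E]%E (open_ereal_lt' e3).
  by move=> [N _ /(_ N (leqnn N))]; exists N.
have cchi : continuous chi.
  have c1 : continuous (fun x : R => n.+1%:R - `|x| : R^o).
    by move=> x; apply: cvgB; [exact: cvg_cst|apply: cvg_norm; exact: cvg_id].
  have c2 : continuous ((fun=> 1) \min (fun x : R => n.+1%:R - `|x| : R^o)).
    by move=> x; apply: continuous_min; [exact: cvg_cst|exact: c1].
  by move=> x; apply: (@continuous_max _ _ (fun=> 0) _ x); [exact: cvg_cst|exact: c2].
pose h x := g_ k x * chi x.
have ch : continuous h by move=> x; apply: cvgM; [exact: cg|exact: cchi].
have h0 x : n.+1%:R < `|x| -> h x = 0 by move=> xn; rewrite /h chi0 ?mulr0.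
have e3 : 0 < eta / 3 by rewrite divr_gt0.
have [ih /(_ (eta / 3) e3)[d d0 H]] := continuous_translation ch h0.
have ifh := intgB jf ih.
have fh : I (fun x => `|f x - h x|) <= eta / 3.
  rewrite -lee_fin -intgE; last exact: intg_abs.
  apply: le_trans (ltW gk); rewrite [leRHS]integral_mkcond.
  apply: ge0_le_integral => //.
  - exact: (msrE (intg_msr (intg_abs ifh))).
  - apply/(measurable_restrictT _ mE); apply: measurable_funTS.
    apply: measurableT_comp => //; apply: msrE; apply: measurable_funB; first exact: intg_msr.
    by apply: continuous_measurable_fun; exact: cg.
  - move=> x _; rewrite patchE mem_setE in_itv/= -ler_norml; case: (leP `|x| n.+1%:R) => xn; last first.
      by rewrite h0// f0 ?subrr ?normr0// (lt_trans _ xn)// ltr_nat.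
    rewrite lee_fin; have [xn'|xn'] := leP `|x| n%:R; first by rewrite /h chi1 ?mulr1.
    rewrite /h f0// !sub0r !normrN normrM; have /andP[a b] := chi01 x.
    by rewrite (ger0_norm a) ler_piMr.
exists d => // z zd.
have i1 := intg_abs ifh; have i2 := intg_abs (intg_shift (- z) ifh).
have i3 := intg_abs (intgB ih (intg_shift (- z) ih)).
have -> : eta = eta / 3 + eta / 3 + eta / 3 by field.
apply: (@le_trans _ _ (I (fun x => `|f x - h x| + `|f (x - z) - h (x - z)| + `|h x - h (x - z)|))).
  apply: I_le.
  - by apply/intg_abs/intgB => //; exact: intg_shift.
  - by apply: intgD => //; exact: intgD.
  move=> x; rewrite (_ : f x - _ = (f x - h x) - (f (x - z) - h (x - z)) + (h x - h (x - z))); last by ring.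
  by rewrite (le_trans (ler_normD _ _))// lerD2r (le_trans (ler_normB _ _)).
rewrite ID//; last exact: intgD.
rewrite ID// lerD ?H// lerD//.
by have -> := I_shift (- z) i1.
Qed.
End Translation.

(** * Parseval for bounded functions of compact support *)

Section Isometry.
Context {R : realType}.
Notation mu := (@lebesgue_measure R).
Notation msr f := (measurable_fun [set: R] (f : R -> R)).
Notation msr2 F := (measurable_fun [set: R * R] (F : R * R -> R)).
Notation sq f := (fun x => f x ^+ 2).
Implicit Types f g h : R -> R.

Lemma sqrB_le (a b : R) : (a - b) ^+ 2 <= 2 * a ^+ 2 + 2 * b ^+ 2.
Proof. by have := sqr_ge0 (a + b); nra. Qed.

(* The defect from Parseval is a Poisson average of the translation moduli of [f], which vanishes in the limit [e -> 0]. *)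
Lemma poisson_form_defect e f (B : R) : 0 < e -> L2 f -> (forall x, `|f x| <= B) ->
  let D z := I (fun x => (f x - f (x - z)) ^+ 2) in
  intg (fun z => poisson e z * D z) /\
  2 * pi * I (sq f) - poisson_form e f = 2^-1 * I (fun z => poisson e z * D z).
Proof.
move=> e0 lf fB D; have [h1 E1] := fub_poisson e0 lf; have [h2 E2] := fub_poisson2 e0 lf.
have h3 := fub_poisson_form e0 lf; have mf := L2_msr lf.
have [ip Ip] := intg_I_poisson e0; have mp := intg_msr ip.
pose G (p : R * R) := poisson e (p.1 - p.2) * (f p.1 - f p.2) ^+ 2.
have GE : G = fun p => (poisson e (p.1 - p.2) * f p.1 ^+ 2 + poisson e (p.1 - p.2) * f p.2 ^+ 2) +
   (-2) * (poisson e (p.1 - p.2) * (f p.1 * f p.2)).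
  by apply/funext => p; rewrite /G; ring.
have h12 := fubD h1 h2; have h4 := fubZ (-2) h3.
have hG : fub G by rewrite GE; exact: fubD.
have IG : II G = 4 * pi * I (sq f) - 2 * poisson_form e f.
  by rewrite GE IID// IID// IIZ// E1 E2 /poisson_form; ring.
pose F (p : R * R) := poisson e p.2 * (f p.1 - f (p.1 - p.2)) ^+ 2.
have hF : fub F.
  have k1 := fubZ 2 (fub_prod lf.2 ip); have k2 := fubZ 2 (fub_conv lf.2 ip).
  apply: (fub_le _ _ (fubD k1 k2)).
    apply: measurable_funM; first exact: msr_snd.
    apply: measurable_funX; apply: measurable_funB; [exact: msr_fst|exact: msr_diff].
  move=> p; have P0 := poisson_ge0 p.2 e0.
  rewrite ger0_norm; last by rewrite mulr_ge0 ?sqr_ge0.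
  have -> : 2 * (f p.1 ^+ 2 * poisson e p.2) + 2 * (f (p.1 - p.2) ^+ 2 * poisson e p.2) =
    poisson e p.2 * (2 * f p.1 ^+ 2 + 2 * f (p.1 - p.2) ^+ 2) by ring.
  by apply: ler_wpM2l => //; exact: sqrB_le.
(* On each slice the substitution [y = x - z] makes the translation parameter an integration
   variable. *)
have FG : II F = II G.
  rewrite -(II1 hF) -(II1 hG); apply: eqI => x /=.
  rewrite -(I_refl x).
    by apply: eqI => y; rewrite /F /G /= opprB addrCA subrr addr0.
  apply: (@intg_bounded _ _ _ ((B + B) ^+ 2)) => //.
    apply: measurable_funX; apply: (@measurable_funB _ _ _ _ (fun=> f x)) => //.
    by apply: (measurableT_comp mf) => /=; exact: measurable_funB.
  move=> z; rewrite normrX ler_sqr ?nnegrE ?normr_ge0 ?addr_ge0 ?(le_trans _ (fB 0))//.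
  by rewrite (le_trans (ler_normB _ _))// lerD.
have DE z : I (fun x => F (x, z)) = poisson e z * D z.
  rewrite /F /= IZ//; exact: (L2B lf (L2_shift (- z) lf)).2.
split.
  have := intg_fub2 hF.
  by rewrite (_ : (fun y => _) = fun z => poisson e z * D z)//; apply/funext.
by rewrite -(eqI DE) (II2 hF) FG IG; field.
Qed.

(** With [hartley1_bessel] at hand, it remains to make the defect of [poisson_form] small. For
    [|z| < d] the bound on [f] turns the square into [2 B] times the absolute difference, controlled
    by [L1_translation]; for [|z| >= d] the modulus is at most [M] and the kernel is [O(e)]. *)
Lemma hartley1_isometry_bounded f (B : R) n : L2 f -> (forall x, `|f x| <= B) ->
  (forall x, n%:R < `|x| -> f x = 0) -> I (sq (hartley1 f)) = 2 * pi * I (sq f).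
Proof.
move=> lf fB f0.
have jf : intg f.
  have -> : f = trunc n f.
    apply/funext => x; rewrite /trunc boxE; case: (leP `|x| n%:R) => xn; rewrite ?mulr1//.
    by rewrite f0// mul0r.
  exact: intg_trunc.
have [lh hle] := hartley1_bessel jf lf.
apply/eqP; rewrite eq_le hle /=; apply/ler_addgt0Pr => eps eps0.
have B0 : 0 <= B by rewrite (le_trans _ (fB 0)).
have [M ME] : exists M, M = 4 * I (sq f) by eexists.
have M0 : 0 <= M by rewrite ME mulr_ge0 ?I_sq_ge0.
have pi0 : 0 < pi :> R by exact: pi_gt0.
(* [eta] here and [e] below are such that, after integration against kernels of mass [2 pi], each of
   the two contributions is at most [eps]; the summands [1] keep the denominators positive when [B]
   or [M] is 0. *)
have [eta etaE] : exists eta, eta = eps / (2 * pi * (2 * B + 1)) by eexists.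
have D1 : 0 < 2 * pi * (2 * B + 1) by rewrite !mulr_gt0// ltr_wpDl// mulr_ge0.
have eta0 : 0 < eta by rewrite etaE divr_gt0.
have [d d0 H] := L1_translation jf f0 eta0.
have dp : 0 < 1 + d ^- 2 by rewrite ltr_pwDl// invr_ge0 sqr_ge0.
have [e eE] : exists e, e = eps / (2 * pi * (M + 1) * (1 + d ^- 2)) by eexists.
have D2 : 0 < 2 * pi * (M + 1) * (1 + d ^- 2) by rewrite !mulr_gt0// ltr_wpDl.
have e0 : 0 < e by rewrite eE divr_gt0.
have [ipD EpD] := poisson_form_defect e0 lf fB.
have hform : poisson_form e f <= I (sq (hartley1 f)).
  have dle x : damp e x * hartley1 f x ^+ 2 <= hartley1 f x ^+ 2.
    by apply: ler_piMl; [exact: sqr_ge0|exact/damp_le1/ltW].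
  rewrite -I_damp_hartley1//; apply: I_le; last exact: dle.
  - apply: (intg_le _ _ lh.2); first by apply: measurable_funM; [exact: msr_damp|exact: measurable_funX lh.1].
    by move=> x; rewrite ger0_norm// mulr_ge0 ?damp_ge0 ?sqr_ge0.
  - exact: lh.2.
rewrite -lerBlDl; apply: (@le_trans _ _ (2 * pi * I (sq f) - poisson_form e f)); first by rewrite lerD2l lerN2.
rewrite EpD.
have [ip Ip] := intg_I_poisson e0; have [ip1 Ip1] := intg_I_poisson (@ltr01 R).
have Dle z : poisson e z * I (fun x => (f x - f (x - z)) ^+ 2) <=
   2 * B * eta * poisson e z + M * e * (1 + d ^- 2) * poisson 1 z.
  have ls := L2_shift (- z) lf; have lD := L2B lf ls.
  have p0 := poisson_ge0 z e0; have p1 := poisson_ge0 z (@ltr01 R).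
  have t1 : 0 <= 2 * B * eta * poisson e z by rewrite mulr_ge0// !mulr_ge0// ltW.
  have t2 : 0 <= M * e * (1 + d ^- 2) * poisson 1 z.
    by apply: mulr_ge0 => //; apply: mulr_ge0; [apply: mulr_ge0 => //; exact: ltW|exact: ltW].
  have [zd|zd] := ltP `|z| d.
    apply: ler_wpDr => //; rewrite mulrC; apply: ler_wpM2r => //.
    apply: (@le_trans _ _ (2 * B * I (fun x => `|f x - f (x - z)|))); last first.
      by rewrite ler_wpM2l ?mulr_ge0 ?H.
    have ia := intg_abs (intgB jf (intg_shift (- z) jf)).
    rewrite -IZ//; apply: I_le; [exact: lD.2|exact: intgZ|].
    move=> x; rewrite -real_normK ?num_real// expr2 ler_wpM2r//.
    by rewrite (le_trans (ler_normB _ _))// mulr_natl mulr2n lerD.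
  apply: ler_wpDl => //.
  rewrite mulrC (_ : M * e * _ * _ = M * (e * (1 + d ^- 2) * poisson 1 z)); last by ring.
  apply: ler_pM; [exact: I_sq_ge0|exact: p0| |exact: poisson_small].
  have -> : M = I (fun x => 2 * f x ^+ 2 + 2 * f (x - z) ^+ 2).
    rewrite ID; [|exact/intgZ/lf.2|exact/intgZ/ls.2].
    rewrite (IZ 2 lf.2) (IZ 2 ls.2) (I_shift (- z) lf.2) ME; ring.
  apply: I_le; [exact: lD.2|by apply: intgD; apply: intgZ; [exact: lf.2|exact: ls.2]|].
  by move=> x; exact: sqrB_le.
apply: (@le_trans _ _ (2^-1 * I (fun z => 2 * B * eta * poisson e z + M * e * (1 + d ^- 2) * poisson 1 z))).
  by rewrite ler_pM2l ?invr_gt0//; apply: I_le => //; apply: intgD; exact: intgZ.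
rewrite ID; [|exact: intgZ..]; rewrite (IZ _ ip) (IZ _ ip1) Ip Ip1.
have pi1 := lt0r_neq0 pi0.
have B1 : 2 * B + 1 != 0 by rewrite gt_eqF// ltr_wpDl// mulr_ge0.
have M1 : M + 1 != 0 by rewrite gt_eqF// ltr_wpDl.
have a1 : 2 * B * eta * (2 * pi) <= eps.
  have -> : 2 * B * eta * (2 * pi) = eps * (2 * B / (2 * B + 1)).
    move: B1 pi1; rewrite etaE; move: (2 * B + 1) (pi : R) => q p q0 p0; field.
    by rewrite q0.
  by rewrite ler_piMr ?(ltW eps0)// ler_pdivrMr ?mul1r ?lerDl// ltr_wpDl// mulr_ge0.
have a2 : M * e * (1 + d ^- 2) * (2 * pi) <= eps.
  have -> : M * e * (1 + d ^- 2) * (2 * pi) = eps * (M / (M + 1)).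
    move: M1 pi1 (lt0r_neq0 dp); rewrite eE; move: (M + 1) (1 + d ^- 2) (pi : R) => q k p q0 p0 k0; field.
    by rewrite q0 p0 k0.
  by rewrite ler_piMr ?(ltW eps0)// ler_pdivrMr ?mul1r ?lerDl// ltr_wpDl.
by rewrite mulrC ler_pdivrMr// mulr_natr mulr2n lerD.
Qed.

(** Values larger than [n] are replaced by 0 rather than by [n], so that [clip n f] equals [f] or 0
    at every point and [f * clip n f] is the square of [clip n f]. *)
Definition clip n f : R -> R := fun x => f x * (box n (f x) * box n x).

Lemma clip_bound n f x : `|clip n f x| <= n%:R.
Proof.
rewrite normrM !boxE; case: (leP `|f x| n%:R) => fn; last by rewrite mul0r normr0 mulr0.
by case: (`|x| <= n%:R); rewrite ?mul1r ?mulr1 ?mulr0 ?normr1 ?mulr1 ?normr0 ?mulr0.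
Qed.
Lemma clip_supp n f x : n%:R < `|x| -> clip n f x = 0.
Proof. by move=> xn; rewrite /clip !boxE (lt_geF xn) !mulr0. Qed.
Lemma clip_le n f x : `|clip n f x| <= `|f x|.
Proof.
by rewrite normrM ler_piMr// ger0_norm ?mulr_ge0 ?box_ge0// mulr_ile1 ?box_ge0 ?box_le1.
Qed.
Lemma msr_clip n f : msr f -> msr (clip n f).
Proof.
move=> mf; apply: measurable_funM => //; apply: measurable_funM; last exact: msr_box.
exact: (measurableT_comp (msr_box n) mf).
Qed.
Lemma L2_clip n f : L2 f -> L2 (clip n f).
Proof.
move=> lf; apply: (L2_le _ _ (L2_abs lf)); first exact: (msr_clip n (L2_msr lf)).
exact: clip_le.
Qed.
Lemma intg_clip n f : L2 f -> intg (clip n f).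
Proof.
move=> lf; have := intg_trunc n (L2_clip n lf).
rewrite (_ : trunc n _ = clip n f)//; apply/funext => x.
by rewrite /trunc /clip -!mulrA -expr2 box_sq.
Qed.
Lemma nrm_clip_cvg f : L2 f -> nrm (fun x => f x - clip n f x) @[n --> \oo] --> 0.
Proof.
move=> lf; rewrite -sqrtr0; apply: (cvg_comp (fun n => I (fun x => (f x - clip n f x) ^+ 2)) Num.sqrt);
  last exact: sqrt_continuous.
rewrite -I0; case: (lf) => mf jf; apply: (@dominated _ _ _ (sq f)) => //.
- by move=> n; apply: measurable_funX; apply: measurable_funB => //; exact: msr_clip.
- move=> x; have -> : 0 = (f x - f x * (1 * 1)) ^+ 2 :> R by rewrite !mulr1 subrr expr0n.
  apply: (cvg_comp (fun n => f x - clip n f x) (fun z => z ^+ 2)); last exact: exprn_continuous.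
  apply: cvgB; first exact: cvg_cst.
  by apply: cvgM; [exact: cvg_cst|apply: cvgM; exact: box_cvg].
- move=> n x; rewrite ger0_norm ?sqr_ge0// /clip -{1}(mulr1 (f x)) -mulrBr exprMn ler_piMr ?sqr_ge0//.
  by rewrite !boxE; case: (`|x| <= n%:R); case: (`|f x| <= n%:R); rewrite ?mulr1 ?mulr0 ?subrr ?subr0 ?expr0n ?expr1n.
Qed.
End Isometry.

(** * Completeness of [L^2] *)

Section Completeness.
Context {R : realType}.
Notation mu := (@lebesgue_measure R).
Notation msr f := (measurable_fun [set: R] (f : R -> R)).
Notation sq f := (fun x => f x ^+ 2).
Implicit Types f g h : R -> R.

Lemma L2_sum (d : nat -> R -> R) K : (forall k, L2 (d k)) -> L2 (fun x => \sum_(k < K) d k x).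
Proof.
move=> ld; elim: K => [|K IH].
  by under eq_fun do rewrite big_ord0; exact: L2_0.
by under eq_fun do rewrite big_ord_recr; exact: L2D.
Qed.

Lemma nrm_sum (d : nat -> R -> R) K : (forall k, L2 (d k)) ->
  nrm (fun x => \sum_(k < K) d k x) <= \sum_(k < K) nrm (d k).
Proof.
move=> ld; elim: K => [|K IH].
  rewrite big_ord0 /nrm; under [X in I X]eq_fun do rewrite big_ord0 expr0n.
  by rewrite I0 sqrtr0.
under eq_fun do rewrite big_ord_recr /=.
rewrite big_ord_recr /= (le_trans (nrmD _ _))// ?lerD//; exact: L2_sum.
Qed.

(** The partial sums [S] of the absolute increments have norm at most 2, so by monotone convergence
    the limit of [S^2] is integrable, hence finite almost everywhere; there the telescoping series
    converges absolutely. *)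
Lemma fast_cauchy_cvg (v : nat -> R -> R) : (forall k, L2 (v k)) ->
  (forall k, nrm (fun x => v k.+1 x - v k x) <= (1 / 2) ^+ k) ->
  exists2 g, msr g & {ae mu, forall x, v k x @[k --> \oo] --> g x}.
Proof.
move=> lv vk.
pose d k (x : R) : R := `|v k.+1 x - v k x|.
have ld k : L2 (d k) by apply: L2_abs; exact: L2B.
pose S K (x : R) : R := \sum_(k < K) d k x.
have lS K : L2 (S K) by exact: L2_sum.
have S0 K x : 0 <= S K x by apply: sumr_ge0 => k _; exact: normr_ge0.
have Snd x : nondecreasing_seq (fun K => S K x).
  by apply/nondecreasing_seqP => K; rewrite /S big_ord_recr/= lerDl; exact: normr_ge0.
have nS K : nrm (S K) <= 2.
  apply: (le_trans (nrm_sum K ld)).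
  apply: (@le_trans _ _ (\sum_(k < K) (1 / 2) ^+ k)).
    by apply: ler_sum => k _; rewrite /d nrm_abs.
  have -> : \sum_(k < K) (1 / 2) ^+ k = 2 - 2 * (1 / 2) ^+ K :> R.
    elim: K => [|K IH]; first by rewrite big_ord0 expr0; ring.
    by rewrite big_ord_recr /= IH exprS; field.
  by rewrite gerBl mulr_ge0// exprn_ge0.
pose F K x := (S K x ^+ 2)%:E.
have mF K : measurable_fun [set: R] (F K).
  by apply: (@msrE _ (sq (S K))); apply: measurable_funX; exact: L2_msr.
have Fnd x : nondecreasing_seq (F^~ x).
  by move=> m n mn; rewrite lee_fin ler_sqr ?nnegrE//; exact: Snd.
pose T x := limn (F^~ x).
have cT x : F^~ x @ \oo --> T x by exact: ereal_nondecreasing_is_cvgn.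
have mT : measurable_fun [set: R] T by apply: (emeasurable_fun_cvg F).
have iT : (\int[mu]_x T x <= 4%:E)%E.
  have F0 n x : [set: R] x -> (0 <= F n x)%E by rewrite lee_fin sqr_ge0.
  rewrite /T (monotone_convergence mu measurableT mF F0 (fun x _ => Fnd x)); apply: lime_le.
    apply: ereal_nondecreasing_is_cvgn => m n mn; apply: ge0_le_integral => //.
    - by move=> x _; exact: F0.
    - exact: mF.
    - exact: mF.
    - by move=> x _; exact: Fnd.
  apply: nearW => K; rewrite /F intgE; last exact: (lS K).2.
  rewrite lee_fin -nrm_sq (_ : 4 = 2 ^+ 2); last by ring.
  by rewrite ler_sqr ?nnegrE ?nrm_ge0.
have T0 x : (0 <= T x)%E.
  by apply: lime_ge; [exact: cvgP (cT x)|apply: nearW => n; rewrite lee_fin sqr_ge0].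
have aT : {ae mu, forall x, T x \is a fin_num}.
  have jT : mu.-integrable setT T.
    apply/integrableP; split => //; under eq_integral do rewrite gee0_abs//.
    by apply: (le_lt_trans iT); rewrite ltry.
  have := integrable_ae measurableT jT.
  by apply: filterS => x /= h; exact: h.
have cv x : T x \is a fin_num -> cvgn (v^~ x).
  move=> Tf.
  have Sb K : S K x <= fine (T x) + 1.
    have : S K x ^+ 2 <= fine (T x).
      rewrite -lee_fin fineK//; apply: lime_ge; first exact: cvgP (cT x).
      by exists K => // n /= Kn; exact: Fnd.
    have := sqr_ge0 (S K x - 1); move: (S K x) (fine (T x)) => s t h1 h2; nra.
  have cS : cvgn (fun K => S K x).
    apply: nondecreasing_is_cvgn; first exact: Snd.
    by exists (fine (T x) + 1) => _ [K _ <-].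
  have cN : cvgn [normed series (fun k => v k.+1 x - v k x)].
    rewrite (_ : [normed series _] = fun K => S K x)//.
    by apply/funext => K; rewrite /S /d -(big_mkord xpredT (fun k => `|v k.+1 x - v k x|)).
  have := normed_cvg cN; rewrite (_ : series _ = fun K => v K x - v 0%N x); last first.
    by apply/funext => K; rewrite /series /= telescope_sumr.
  move=> h; have -> : v^~ x = fun K => (v K x - v 0%N x) + v 0%N x by apply/funext => K; rewrite subrK.
  by apply: is_cvgD => //; exact: is_cvg_cst.
pose A := [set x | T x \is a fin_num].
have mA : measurable A.
  rewrite -[A]setTI; exact: emeasurable_fin_num.
(* Setting the sequence to 0 on the exceptional set makes it converge everywhere, so that its limit
   is measurable. *)
pose w k x := v k x * \1_A x.
have cw x : cvgn (w^~ x).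
  rewrite /w indicE; case: (boolP (x \in A)) => xA.
    by under eq_fun do rewrite mulr1; apply: cv; rewrite inE in xA.
  by under eq_fun do rewrite mulr0; exact: is_cvg_cst.
exists (fun x => limn (w^~ x)).
  apply: (measurable_fun_cvg (h := w)) => [k|x _]; last exact: cw.
  by apply: measurable_funM; [exact: L2_msr|exact: measurable_indic].
apply: (ae_mono _ aT) => x Tx.
have := cw x; rewrite /w indicE (_ : x \in A); last by rewrite inE.
by under eq_fun do rewrite mulr1; move=> h; exact: h.
Qed.

Lemma L2_complete (u : nat -> R -> R) : (forall n, L2 (u n)) ->
  (forall e : R, 0 < e -> exists N, forall m n, (N <= m)%N -> (N <= n)%N ->
     nrm (fun x => u m x - u n x) <= e) ->
  exists2 g, L2 g & nrm (fun x => g x - u n x) @[n --> \oo] --> 0.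
Proof.
move=> lu cu.
have e2 k : 0 < (1 / 2) ^+ k :> R by rewrite exprn_gt0.
pose N k := projT1 (cid (cu _ (e2 k))).
have NP k m n : (N k <= m)%N -> (N k <= n)%N -> nrm (fun x => u m x - u n x) <= (1 / 2) ^+ k.
  exact: (projT2 (cid (cu _ (e2 k)))).
(* The sum makes [phi] monotone and at least [N k]; the summand [k] makes it tend to infinity. *)
pose phi k := (\sum_(i < k.+1) N i + k)%N.
have phiN k : (N k <= phi k)%N by rewrite /phi big_ord_recr /= addnAC leq_addl.
have phiS k : (phi k <= phi k.+1)%N.
  by rewrite /phi (big_ord_recr k.+1)/= leq_add// leq_addr.
have phik k : (k <= phi k)%N by rewrite /phi leq_addl.
have [g mg cg] := @fast_cauchy_cvg (fun k => u (phi k)) (fun k => lu _)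
  (fun k => NP k _ _ (leq_trans (phiN k) (phiS k)) (phiN k)).
(* Fatou along the subsequence bounds the distance from [g] to [u n] before [g] itself is known to
   be square-integrable. *)
have key (e : R) n : 0 < e -> (\forall k \near \oo, nrm (fun x => u (phi k) x - u n x) <= e) ->
    L2 (fun x => g x - u n x) /\ nrm (fun x => g x - u n x) <= e.
  move=> e0 ek.
  have mgu : msr (fun x => g x - u n x) by apply: measurable_funB => //; exact: L2_msr.
  have b : (\int[mu]_x ((g x - u n x) ^+ 2)%:E <= (e ^+ 2)%:E)%E.
    apply: (@fatou_bound _ (fun k x => (u (phi k) x - u n x) ^+ 2)).
    - by move=> k; apply: measurable_funX; apply: measurable_funB; exact: L2_msr.
    - exact: measurable_funX.
    - by move=> k x; exact: sqr_ge0.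
    - apply: (ae_mono _ cg) => x cx; apply: limn_einf_EFin.
      apply: (cvg_comp (fun k => u (phi k) x - u n x) (fun z => z ^+ 2)); last exact: exprn_continuous.
      by apply: cvgB => //; exact: cvg_cst.
    - apply: filterS ek => k h; rewrite intgE; last exact: (L2B (lu _) (lu _)).2.
      by rewrite lee_fin -nrm_sq ler_sqr ?nnegrE ?nrm_ge0// ltW.
  have lgu : L2 (fun x => g x - u n x).
    split => //; apply/ge0_intg; first exact: measurable_funX.
      by move=> x; exact: sqr_ge0.
    by apply: (le_lt_trans b); rewrite ltry.
  split => //; rewrite -ler_sqr ?nnegrE ?nrm_ge0// ?(ltW e0)// nrm_sq -lee_fin -intgE//.
  exact: lgu.2.
have key2 (e : R) : 0 < e -> exists M, forall n, (M <= n)%N -> L2 (fun x => g x - u n x) /\ nrm (fun x => g x - u n x) <= e.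
  move=> e0; have [M HM] := cu e e0; exists M => n Mn; apply: key => //.
  by exists M => // k /= Mk; apply: HM => //; exact: leq_trans (phik k).
exists g.
  have [M HM] := key2 1 ltr01; have [l _] := HM M (leqnn M).
  have -> : g = fun x => (g x - u M x) + u M x by apply/funext => x; rewrite subrK.
  exact: L2D.
apply/cvgrPdist_le => e e0; have [M HM] := key2 e e0.
exists M => // n /= Mn; rewrite sub0r normrN ger0_norm ?nrm_ge0//.
by have [] := HM n Mn.
Qed.
End Completeness.

(** * The Hartley transform on L2 *)

Section HartleyL2.
Context {R : realType}.
Notation mu := (@lebesgue_measure R).
Notation msr f := (measurable_fun [set: R] (f : R -> R)).
Notation sq f := (fun x => f x ^+ 2).
Implicit Types f g h G : R -> R.

Lemma cvg0_le (a b : nat -> R) : (forall n, 0 <= a n <= b n) -> b n @[n --> \oo] --> 0 -> a n @[n --> \oo] --> 0.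
Proof.
move=> ab b0; apply: (@squeeze_cvgr _ _ _ _ (fun=> 0) b) => //; last exact: cvg_cst.
by apply: nearW.
Qed.

Lemma cvg0_ae (x : R) (a : nat -> R) : (forall n, 0 <= x <= a n) -> a n @[n --> \oo] --> 0 -> x = 0.
Proof.
move=> xa a0; apply/eqP; rewrite eq_le; have /andP[_ x0] := xa 0%N.
have := xa 0%N => /andP[-> _]; rewrite andbT.
rewrite -(cvg_lim (@norm_hausdorff _ _) a0); apply: limr_ge; first exact: cvgP a0.
by apply: nearW => n; have /andP[] := xa n.
Qed.

Lemma cvg0D (a b : nat -> R) : a n @[n --> \oo] --> 0 -> b n @[n --> \oo] --> 0 ->
  a n + b n @[n --> \oo] --> 0.
Proof. by move=> a0 b0; rewrite -[X in _ --> X](addr0 (0 : R)); exact: cvgD. Qed.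
Lemma cvg0Z c (a : nat -> R) : a n @[n --> \oo] --> 0 -> c * a n @[n --> \oo] --> 0.
Proof. by move=> a0; rewrite -[X in _ --> X](mulr0 c); exact: cvgMr. Qed.

Definition L2lim (u : nat -> R -> R) g := nrm (fun x => g x - u n x) @[n --> \oo] --> (0 : R).

Lemma L2lim_unique (u : nat -> R -> R) g h : (forall n, L2 (u n)) -> L2 g -> L2 h ->
  L2lim u g -> L2lim u h -> ae_eq mu setT g h.
Proof.
move=> lu lg lh ug uh.
have e : nrm (fun x => g x - h x) = 0.
  apply: (@cvg0_ae _ (fun n => nrm (fun x => g x - u n x) + nrm (fun x => h x - u n x))).
    by move=> n; rewrite nrm_ge0 (nrm_subC h) nrm_sub.
  exact: cvg0D.
have := nrm_eq0 (L2B lg lh) e.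
by apply: ae_mono => x /= a Tx; have /eqP := a Tx; rewrite subr_eq0 => /eqP.
Qed.

Lemma nrm_dist f g : L2 f -> L2 g -> `|nrm f - nrm g| <= nrm (fun x => f x - g x).
Proof.
move=> lf lg; have h1 := nrmD (L2B lf lg) lg; have h2 := nrmD (L2B lg lf) lf.
move: h1 h2; under [X in nrm X <= _ + nrm g -> _]eq_fun do rewrite subrK.
under [X in _ -> nrm X <= _ -> _]eq_fun do rewrite subrK.
rewrite (nrm_subC g) => h1 h2; rewrite ler_norml; apply/andP; split; lra.
Qed.

Lemma L2lim_nrm (u : nat -> R -> R) g : (forall n, L2 (u n)) -> L2 g ->
  L2lim u g -> nrm (u n) @[n --> \oo] --> nrm g.
Proof.
move=> lu lg ug; apply/cvgrPdist_le => e e0.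
have /cvgrPdist_le/(_ e e0) := ug; apply: filterS => n.
by rewrite sub0r normrN (ger0_norm (nrm_ge0 _)); apply: le_trans; exact: nrm_dist.
Qed.

Lemma L2lim_ip (u : nat -> R -> R) g h : (forall n, L2 (u n)) -> L2 g -> L2 h ->
  L2lim u g -> I (fun x => u n x * h x) @[n --> \oo] --> I (fun x => g x * h x).
Proof.
move=> lu lg lh ug; apply/cvgrPdist_le => e e0.
have k0 : 0 < nrm h + 1 by rewrite ltr_wpDl ?nrm_ge0.
have e1 : 0 < e / (nrm h + 1) by rewrite divr_gt0.
have /cvgrPdist_le/(_ _ e1) := ug; apply: filterS => n.
rewrite sub0r normrN (ger0_norm (nrm_ge0 _)) => hn.
rewrite -IB; [|exact: L2M..].
rewrite (_ : I _ = I (fun x => (g x - u n x) * h x)); last by apply: eqI => x; rewrite mulrBl.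
apply: (le_trans (cauchy_schwarz (L2B lg (lu n)) lh)).
apply: (@le_trans _ _ (nrm (fun x => g x - u n x) * (nrm h + 1))).
  by rewrite ler_wpM2l ?nrm_ge0// lerDl.
by rewrite -ler_pdivlMr.
Qed.

Lemma L2limD (u v : nat -> R -> R) g h : (forall n, L2 (u n)) -> (forall n, L2 (v n)) -> L2 g -> L2 h ->
  L2lim u g -> L2lim v h -> L2lim (fun n x => u n x + v n x) (fun x => g x + h x).
Proof.
move=> lu lv lg lh ug vh.
apply: (cvg0_le (b := fun n => nrm (fun x => g x - u n x) + nrm (fun x => h x - v n x))); last first.
  exact: cvg0D.
move=> n; rewrite nrm_ge0 /= (le_trans _ (nrmD (L2B lg (lu n)) (L2B lh (lv n))))//.
by rewrite le_eqVlt; apply/orP; left; apply/eqP; congr nrm; apply/funext => x; ring.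
Qed.

Lemma L2limZ (u : nat -> R -> R) g a : (forall n, L2 (u n)) -> L2 g ->
  L2lim u g -> L2lim (fun n x => a * u n x) (fun x => a * g x).
Proof.
move=> lu lg ug; rewrite /L2lim.
under eq_cvg => n.
  rewrite (_ : nrm _ = nrm (fun x => a * (g x - u n x))); last first.
    by congr nrm; apply/funext => x; rewrite mulrBr.
  rewrite nrmZ; last exact: L2B.
  over.
exact: cvg0Z.
Qed.

Lemma L2lim_shift (u : nat -> R -> R) g a : (forall n, L2 (u n)) -> L2 g ->
  L2lim u g -> L2lim (fun n x => u n (x + a)) (fun x => g (x + a)).
Proof.
move=> lu lg ug; rewrite /L2lim; under eq_cvg => n.
  rewrite (nrm_shift a (L2B lg (lu n))); over.
exact: ug.
Qed.
Lemma L2lim_refl (u : nat -> R -> R) g a : (forall n, L2 (u n)) -> L2 g ->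
  L2lim u g -> L2lim (fun n x => u n (a - x)) (fun x => g (a - x)).
Proof.
move=> lu lg ug; rewrite /L2lim; under eq_cvg => n.
  rewrite (nrm_refl a (L2B lg (lu n))); over.
exact: ug.
Qed.

Definition rt2pi : R := Num.sqrt (2 * pi).
Lemma pi2_gt0 : 0 < 2 * pi :> R. Proof. by rewrite mulr_gt0// pi_gt0. Qed.
Lemma rt2pi_gt0 : 0 < rt2pi. Proof. by rewrite sqrtr_gt0 pi2_gt0. Qed.
Lemma rt2pi_sq : rt2pi ^+ 2 = 2 * pi. Proof. by rewrite sqr_sqrtr// ltW// pi2_gt0. Qed.

Lemma hartley1_L2 f : intg f -> L2 f -> L2 (hartley1 f).
Proof. by move=> jf lf; have [] := hartley1_bessel jf lf. Qed.
Lemma nrm_hartley1 f : intg f -> L2 f -> nrm (hartley1 f) <= rt2pi * nrm f.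
Proof.
move=> jf lf; have [_ h] := hartley1_bessel jf lf.
by rewrite /nrm -sqrtrM ?(ltW pi2_gt0)// ler_wsqrtr.
Qed.

Lemma truncD n f g : trunc n (fun x => f x + g x) = fun x => trunc n f x + trunc n g x.
Proof. by apply/funext => x; rewrite /trunc mulrDl. Qed.

Definition hartley_seq f n := hartley1 (trunc n f).
Lemma L2_hartley_seq f n : L2 f -> L2 (hartley_seq f n).
Proof. by move=> lf; apply: hartley1_L2; [exact: intg_trunc|exact: L2_trunc]. Qed.

Lemma hartley1_funB f g : intg f -> intg g ->
  hartley1 (fun x => f x - g x) = fun xi => hartley1 f xi - hartley1 g xi.
Proof. by move=> jf jg; apply/funext => xi; exact: hartley1B. Qed.
Lemma hartley1_funD f g : intg f -> intg g ->
  hartley1 (fun x => f x + g x) = fun xi => hartley1 f xi + hartley1 g xi.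
Proof. by move=> jf jg; apply/funext => xi; exact: hartley1D. Qed.

Lemma nrm_hartley1B f g : intg f -> L2 f -> intg g -> L2 g ->
  nrm (fun xi => hartley1 f xi - hartley1 g xi) <= rt2pi * nrm (fun x => f x - g x).
Proof.
move=> jf lf jg lg; rewrite -hartley1_funB//.
by apply: nrm_hartley1; [exact: intgB|exact: L2B].
Qed.

Lemma hartley_exists f : L2 f -> exists2 G, L2 G & L2lim (hartley_seq f) G.
Proof.
move=> lf; apply: L2_complete; first by move=> n; exact: L2_hartley_seq.
move=> e e0; have c0 := rt2pi_gt0.
have e1 : 0 < e / (2 * rt2pi) by rewrite divr_gt0// mulr_gt0.
have /cvgrPdist_le/(_ _ e1)[N _ HN] := nrm_trunc_cvg lf.
have HN' n : (N <= n)%N -> nrm (fun x => f x - trunc n f x) <= e / (2 * rt2pi).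
  by move=> Nn; have := HN n Nn; rewrite sub0r normrN (ger0_norm (nrm_ge0 _)).
exists N => m n Nm Nn.
apply: (le_trans (nrm_hartley1B (intg_trunc _ lf) (L2_trunc _ lf) (intg_trunc _ lf) (L2_trunc _ lf))).
rewrite mulrC -ler_pdivlMr// (le_trans (nrm_sub (L2_trunc m lf) lf (L2_trunc n lf)))//.
rewrite nrm_subC (le_trans (lerD (HN' m Nm) (HN' n Nn)))//.
by rewrite le_eqVlt; apply/orP; left; apply/eqP; field; rewrite gt_eqF.
Qed.

(** A choice among functions equal almost everywhere; additivity and the comparison with [hartley1]
    can hold only almost everywhere. *)
Definition hartley f : R -> R := xget (fun=> 0) [set G | L2 G /\ L2lim (hartley_seq f) G].

Lemma hartleyP f : L2 f -> L2 (hartley f) /\ L2lim (hartley_seq f) (hartley f).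
Proof.
move=> lf; have [G lG h] := hartley_exists lf.
by rewrite /hartley; case: xgetP => [G' -> //|/(_ G)]; case.
Qed.
#[global] Opaque hartley.

Lemma L2_hartley f : L2 f -> L2 (hartley f).
Proof. by move=> /hartleyP[]. Qed.
Lemma msr_hartley f : L2 f -> msr (hartley f).
Proof. by move=> /L2_hartley/L2_msr. Qed.
Lemma hartley_lim f : L2 f -> L2lim (hartley_seq f) (hartley f).
Proof. by move=> /hartleyP[]. Qed.

Lemma hartley_unique f G : L2 f -> L2 G -> L2lim (hartley_seq f) G -> ae_eq mu setT (hartley f) G.
Proof.
move=> lf lG h; have [l1 h1] := hartleyP lf.
by apply: (L2lim_unique _ l1 lG h1 h) => n; exact: L2_hartley_seq.
Qed.

Lemma hartleyD f g : L2 f -> L2 g ->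
  ae_eq mu setT (hartley (fun x => f x + g x)) (fun xi => hartley f xi + hartley g xi).
Proof.
move=> lf lg; have [l1 h1] := hartleyP lf; have [l2 h2] := hartleyP lg.
apply: hartley_unique; [exact: L2D|exact: L2D|].
rewrite (_ : hartley_seq _ = fun n x => hartley_seq f n x + hartley_seq g n x).
  by apply: L2limD => // n; exact: L2_hartley_seq.
apply/funext => n; rewrite /hartley_seq truncD; apply: hartley1_funD; exact: intg_trunc.
Qed.

Lemma hartley_intg f : intg f -> L2 f -> ae_eq mu setT (hartley f) (hartley1 f).
Proof.
move=> jf lf; apply: hartley_unique => //; first exact: hartley1_L2.
apply: (cvg0_le (b := fun n => rt2pi * nrm (fun x => f x - trunc n f x))); last first.
  by apply: cvg0Z; exact: nrm_trunc_cvg.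
move=> n; rewrite nrm_ge0 /=; apply: nrm_hartley1B => //; [exact: intg_trunc|exact: L2_trunc].
Qed.

Lemma hartleyN f : L2 f -> ae_eq mu setT (hartley (fun x => - f x)) (fun xi => - hartley f xi).
Proof.
move=> lf; have [l1 h1] := hartleyP lf.
apply: hartley_unique; [exact: L2N|exact: L2N|].
apply: (cvg0_le (b := fun n => nrm (fun x => hartley f x - hartley_seq f n x))); last exact: h1.
move=> n; rewrite nrm_ge0 /= -[leRHS]nrmN le_eqVlt; apply/orP; left; apply/eqP.
congr nrm; apply/funext => x; rewrite opprB addrC /hartley_seq; congr (_ + _).
rewrite /hartley1 -IN; last by apply: intg_cas; apply: intg_trunc; exact: L2N.
by apply: eqI => y; rewrite /trunc; ring.
Qed.

Lemma hartleyB f g : L2 f -> L2 g ->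
  ae_eq mu setT (hartley (fun x => f x - g x)) (fun xi => hartley f xi - hartley g xi).
Proof.
move=> lf lg; apply: ae_mono2 (hartleyD lf (L2N lg)) (hartleyN lg) => x /= h1 h2 Tx.
by rewrite h1// h2.
Qed.

Lemma nrm_hartley_le f : L2 f -> nrm (hartley f) <= rt2pi * nrm f.
Proof.
move=> lf; have [l1 h1] := hartleyP lf.
have c := L2lim_nrm (fun n => L2_hartley_seq n lf) l1 h1.
rewrite -(cvg_lim (@norm_hausdorff _ _) c); apply: limr_le; first exact: cvgP c.
apply: nearW => n; apply: (le_trans (nrm_hartley1 (intg_trunc n lf) (L2_trunc n lf))).
by rewrite ler_pM2l ?rt2pi_gt0// nrm_le//; [exact: L2_trunc|move=> x; exact: trunc_le].
Qed.

(** Both sides are continuous in the [L^2] norm, and the bounded, compactly supported [clip n f],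
    for which the isometry is known, tends to [f]. *)
Lemma nrm_hartley f : L2 f -> nrm (hartley f) = rt2pi * nrm f.
Proof.
move=> lf.
have lc n := L2_clip n lf; have jc n := intg_clip n lf.
have ec n : nrm (hartley (clip n f)) = rt2pi * nrm (clip n f).
  rewrite (nrm_ae _ _ (hartley_intg (jc n) (lc n))); last 2 first.
  - exact: msr_hartley.
  - exact: msr_hartley1.
  rewrite /nrm (hartley1_isometry_bounded (lc n) (clip_bound n f) (@clip_supp _ n f)).
  by rewrite sqrtrM ?(ltW pi2_gt0).
have h1 : rt2pi * nrm (clip n f) @[n --> \oo] --> rt2pi * nrm f.
  by apply: cvgMr; apply: L2lim_nrm => //; exact: nrm_clip_cvg.
have h2 : nrm (hartley (clip n f)) @[n --> \oo] --> nrm (hartley f).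
  apply: L2lim_nrm => [n| |]; [exact: L2_hartley|exact: L2_hartley|].
  apply: (cvg0_le (b := fun n => rt2pi * nrm (fun x => f x - clip n f x))); last first.
    by apply: cvg0Z; exact: nrm_clip_cvg.
  move=> n; rewrite nrm_ge0 /=; apply: le_trans (nrm_hartley_le (L2B lf (lc n))).
  rewrite le_eqVlt; apply/orP; left; apply/eqP; apply: nrm_ae.
  - by apply: measurable_funB; exact: msr_hartley.
  - by apply: msr_hartley; exact: L2B.
  - by apply: ae_mono (hartleyB lf (lc n)) => x /= h Tx; rewrite h.
rewrite (_ : (fun n => nrm _) = fun n => rt2pi * nrm (clip n f)) in h2; last exact/funext.
exact: (cvg_unique (@norm_hausdorff _ _) h2 h1).
Qed.

Lemma polar_cancel (a b c a' b' d p : R) : a + 2 * c + b = p * (a' + 2 * d + b') ->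
  a = p * a' -> b = p * b' -> c = p * d.
Proof. by move=> h ha hb; move: h; rewrite ha hb => h; lra. Qed.

(** Polarisation of the isometry at [f], [g] and [f + g]. *)
Lemma hartley_parseval f g : L2 f -> L2 g ->
  I (fun xi => hartley f xi * hartley g xi) = 2 * pi * I (fun x => f x * g x).
Proof.
move=> lf lg; have l1 := L2_hartley lf; have l2 := L2_hartley lg.
have e h : L2 h -> I (sq (hartley h)) = 2 * pi * I (sq h).
  by move=> lh; rewrite -!nrm_sq nrm_hartley// exprMn rt2pi_sq.
have e1 := e _ (L2D lf lg).
have e2 : I (sq (hartley (fun x => f x + g x))) = I (fun xi => (hartley f xi + hartley g xi) ^+ 2).
  apply: I_ae.
  - by apply: measurable_funX; apply: msr_hartley; exact: L2D.
  - by apply: measurable_funX; apply: measurable_funD; exact: msr_hartley.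
  - by apply: ae_mono (hartleyD lf lg) => x /= h Tx; rewrite h.
have H := etrans (esym (I_sqD l1 l2)) (etrans (esym e2) (etrans e1 (congr1 _ (I_sqD lf lg)))).
exact: (polar_cancel H (e _ lf) (e _ lg)).
Qed.

(** The limit of [hartley1_sym] along the truncations of [f]; the transform on the right stays an
    honest integral. *)
Lemma hartley_sym f g : L2 f -> intg g -> L2 g ->
  I (fun xi => hartley f xi * g xi) = I (fun x => f x * hartley1 g x).
Proof.
move=> lf jg lg; have [l1 h1] := hartleyP lf.
have c1 := L2lim_ip (fun n => L2_hartley_seq n lf) l1 lg h1.
have lh := hartley1_L2 jg lg.
have c2 := L2lim_ip (fun n => L2_trunc n lf) lf lh (nrm_trunc_cvg lf).
apply: (cvg_unique (@norm_hausdorff _ _) c1); rewrite /=.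
by under [X in X @ _]eq_fun => n do rewrite /hartley_seq -(hartley1_sym (intg_trunc n lf) jg).
Qed.

(** [cas p * cas q = cos (p - q) + sin (p + q)], where a cosine is the half sum and a sine the half
    difference of [cas] at opposite points. Hence the four terms and the single minus sign; the
    identity passes from the truncations to the limit. *)
Lemma hartley_modulation u x0 : L2 u ->
  let B := fun z => 2^-1 * (hartley u (z - x0) + hartley u (x0 - z) + hartley u (z + x0) + (-1) * hartley u (- x0 - z)) in
  [/\ L2 (fun x => u x * cas (x * x0)), L2 B & ae_eq mu setT (hartley (fun x => u x * cas (x * x0))) B].
Proof.
move=> lu B; have [lU hU] := hartleyP lu.
have lu' : L2 (fun x => u x * cas (x * x0)).
  apply: (L2_le _ _ (L2Z 2 (L2_abs lu))).
    by apply: measurable_funM; [exact: L2_msr|exact: msr_casM].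
  by move=> x; rewrite normrM mulrC ler_wpM2r// cas_le2.
have ls n := L2_hartley_seq n lu.
have s1 := L2lim_shift (- x0) ls lU hU.
have s2 := L2lim_refl x0 ls lU hU.
have s3 := L2lim_shift x0 ls lU hU.
have s4 := L2limZ (-1) (fun n => L2_refl (- x0) (ls n)) (L2_refl (- x0) lU) (L2lim_refl (- x0) ls lU hU).
have t1 := L2limD (fun n => L2_shift (- x0) (ls n)) (fun n => L2_refl x0 (ls n)) (L2_shift (- x0) lU) (L2_refl x0 lU) s1 s2.
have m1 := L2D (L2_shift (- x0) lU) (L2_refl x0 lU).
have t2 := L2limD (fun n => L2D (L2_shift (- x0) (ls n)) (L2_refl x0 (ls n))) (fun n => L2_shift x0 (ls n)) m1 (L2_shift x0 lU) t1 s3.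
have m2 := L2D m1 (L2_shift x0 lU).
have lz := L2Z (-1) (L2_refl (- x0) lU).
have t3 := L2limD (fun n => L2D (L2D (L2_shift (- x0) (ls n)) (L2_refl x0 (ls n))) (L2_shift x0 (ls n)))
  (fun n => L2Z (-1) (L2_refl (- x0) (ls n))) m2 lz t2 s4.
have m3 := L2D m2 lz.
have t4 := L2limZ 2^-1 (fun n => L2D (L2D (L2D (L2_shift (- x0) (ls n)) (L2_refl x0 (ls n))) (L2_shift x0 (ls n)))
  (L2Z (-1) (L2_refl (- x0) (ls n)))) m3 t3.
have lB : L2 B := L2Z 2^-1 m3.
split; [exact: lu'|exact: lB|apply: (hartley_unique lu' lB)].
rewrite /L2lim (_ : hartley_seq _ = fun n z => 2^-1 * (hartley_seq u n (z - x0) + hartley_seq u n (x0 - z) +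
  hartley_seq u n (z + x0) + (-1) * hartley_seq u n (- x0 - z))); first exact: t4.
apply/funext => n; apply/funext => z; rewrite /hartley_seq /hartley1.
have jt xi := intg_cas xi (intg_trunc n lu).
rewrite -(IZ (-1) (jt _)) -ID// -ID//; last exact: intgD.
rewrite -ID; [|by apply: intgD => //; exact: intgD|exact: intgZ].
rewrite -IZ; last by apply: intgD; [apply: intgD => //; exact: intgD|exact: intgZ].
apply: eqI => x; rewrite /trunc.
rewrite (mulrBr x z x0) (mulrBr x x0 z) (mulrDr x z x0) (mulrBr x (- x0) z) mulrN /cas.
rewrite !(cosB, sinB, cosD, sinD) !cosN !sinN.
by field.
Qed.

(** An even majorant of [|U|], which absorbs the reflections in the modulation formula. *)
Definition even_abs (U : R -> R) (z : R) : R := `|U z| + `|U (- z)|.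

Lemma even_abs_ge0 U z : 0 <= even_abs U z.
Proof. by rewrite addr_ge0. Qed.
Lemma L2_even_abs U : L2 U -> L2 (even_abs U).
Proof. by move=> lU; apply: L2D; [exact: L2_abs|exact: L2_opp (L2_abs lU)]. Qed.

(* The convolution theorem for [u^2] as an inequality: Parseval applied to [u] and to its modulation [u * cas(. x0)], whose transform is a sum of four reflected translates of [hartley u]. *)
Lemma hartley1_sq_bound u x0 : L2 u ->
  `|hartley1 (sq u) x0| <= I (fun z => even_abs (hartley u) z * even_abs (hartley u) (x0 - z)).
Proof.
move=> lu; have [lc lB hc] := hartley_modulation x0 lu; have lU := L2_hartley lu.
set B := (fun z : R => 2^-1 * _ : R) in lB hc; pose V := even_abs (hartley u).
have lV : L2 V by exact: L2_even_abs.
have E : 2 * pi * hartley1 (sq u) x0 = I (fun z => hartley u z * B z).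
  have <- : I (fun z => hartley u z * hartley (fun x => u x * cas (x * x0)) z) = I (fun z => hartley u z * B z).
    apply: I_ae.
    - by apply: measurable_funM; exact: msr_hartley.
    - by apply: measurable_funM; [exact: msr_hartley|exact: L2_msr].
    - by apply: ae_mono hc => x /= h Tx; rewrite h.
  rewrite (hartley_parseval lu lc); congr (_ * _); apply: eqI => x; by rewrite expr2 mulrA.
have lUa := L2_abs lU.
have lV1 : L2 (fun z => V (x0 - z)) by exact: L2_refl.
have lV2 : L2 (fun z => V (x0 + z)).
  by under eq_fun do rewrite addrC; exact: L2_shift.
have j12 := intgD (L2M lUa lV1) (L2M lUa lV2).
have b : `|2 * pi * hartley1 (sq u) x0| <= 2^-1 * I (fun z => V z * V (x0 - z)).
  (* Reflecting [z] in the second summand turns [V (x0 + z)] into [V (x0 - z)] and [|hartley u z|]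
     into [|hartley u (- z)|]. *)
  have -> : I (fun z => V z * V (x0 - z)) = I (fun z => `|hartley u z| * V (x0 - z) + `|hartley u z| * V (x0 + z)).
    rewrite (ID (L2M lUa lV1) (L2M lUa lV2)).
    rewrite -[X in _ = _ + X](I_opp (L2M lUa lV2)).
    rewrite -(ID (L2M lUa lV1) (L2M (L2_opp lUa) lV1)).
    by apply: eqI => z; rewrite /V /even_abs mulrDl.
  rewrite -(IZ 2^-1 j12) E.
  apply: I_le_abs; [exact: (L2M lU lB)|exact: (intgZ 2^-1 j12)|].
  move=> z; rewrite normrM -mulrDr mulrCA ler_wpM2l//.
  rewrite /B /V /even_abs normrM (ger0_norm (_ : 0 <= 2^-1)) ?invr_ge0// ler_pM2l ?invr_gt0//.
  rewrite opprB opprD mulN1r.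
  rewrite (le_trans (ler_normB _ _))// (le_trans (lerD (ler_normD _ _) (lexx _)))//.
  rewrite (le_trans (lerD (lerD (ler_normD _ _) (lexx _)) (lexx _)))//.
  by rewrite [x0 + z]addrC (addrC `|hartley u (z - x0)|) !addrA.
(* The bound obtained has the extra factor [1 / (4 pi)], which is less than 1 and is given away. *)
have p2 : 2 <= pi :> R by exact: pi_ge2.
have I0' : 0 <= I (fun z => V z * V (x0 - z)) by apply: I_ge0 => z; rewrite mulr_ge0 ?even_abs_ge0.
move: b; rewrite normrM (ger0_norm (ltW pi2_gt0)).
move: (hartley1 _ _) (I _) I0' (pi : R) p2 => h k k0 p p2 hb.
have := normr_ge0 h; move: `|h| hb => a hb a0; nra.
Qed.
End HartleyL2.

(** * Sobolev spaces through the Hartley transform *)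

Section SobolevLink.
Context {R : realType}.
Notation mu := (@lebesgue_measure R).
Notation msr f := (measurable_fun [set: R] (f : R -> R)).
Notation sq f := (fun x => f x ^+ 2).
Implicit Types f g h G D F : R -> R.

Lemma Lnorm2E F : L2 F -> ('N[mu]_2%:E[EFin \o F] = (nrm F)%:E)%E.
Proof.
move=> [mF jF]; rewrite unlock /=.
rewrite (_ : (\int[mu]_x _)%E = (I (sq F))%:E); last first.
  rewrite -intgE//; apply: eq_integral => x _ /=.
  by rewrite powR_mulrn ?normr_ge0// real_normK ?num_real.
by rewrite /= powR12_sqrt// I_sq_ge0.
Qed.

Lemma Lfun2P F : F \in Lfun mu 2%:E <-> L2 F.
Proof.
split=> [lF|lF].
  split; last exact: Lfun2_integrable_sqr.
  by move: lF; rewrite inE => /andP[+ _]; rewrite inE.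
rewrite inE; apply/andP; split; rewrite inE /=; first exact: L2_msr.
by rewrite /finite_norm Lnorm2E// ltry.
Qed.

Lemma Lnorm2_lty F : msr F -> ('N[mu]_2%:E[EFin \o F] < +oo)%E -> L2 F.
Proof. by move=> mF h; apply/Lfun2P; rewrite inE; apply/andP; split; rewrite inE. Qed.

Definition sym_sq D : R -> R := fun xi => Num.sqrt ((D xi ^+ 2 + D (- xi) ^+ 2) / 2).

Lemma msr_sym_sq D : msr D -> msr (sym_sq D).
Proof.
move=> mD; apply: measurableT_comp.
  by apply: continuous_measurable_fun; exact: sqrt_continuous.
apply: measurable_funM => //; apply: measurable_funD; apply: measurable_funX => //.
exact: msr_opp.
Qed.
Lemma sym_sqE D xi : sym_sq D xi ^+ 2 = (D xi ^+ 2 + D (- xi) ^+ 2) / 2.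
Proof. by rewrite sqr_sqrtr// divr_ge0// addr_ge0// sqr_ge0. Qed.

Lemma sym_sq_L2 D : L2 D -> L2 (sym_sq D) /\ nrm (sym_sq D) = nrm D.
Proof.
move=> lD; have jo := intg_opp lD.2.
have e : sq (sym_sq D) = fun xi => 2^-1 * (D xi ^+ 2 + D (- xi) ^+ 2).
  by apply/funext => xi; rewrite sym_sqE mulrC.
split.
  split; first by apply: msr_sym_sq; exact: L2_msr.
  by rewrite e; apply: intgZ; apply: intgD => //; exact: lD.2.
rewrite /nrm e IZ; last by apply: intgD => //; exact: lD.2.
by rewrite (ID lD.2 jo) (I_opp lD.2); congr Num.sqrt; field.
Qed.

Lemma sym_sq_ge D xi : `|D xi| <= 2 * sym_sq D xi.
Proof.
have s0 : 0 <= sym_sq D xi by exact: sqrtr_ge0.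
rewrite -ler_sqr ?nnegrE ?mulr_ge0// real_normK ?num_real// exprMn sym_sqE.
by have := sqr_ge0 (D (- xi)); have := sqr_ge0 (D xi); lra.
Qed.

(** For a Hartley transform, [hc] is the cosine and [hs] the sine transform: the real part and minus
    the imaginary part of the Fourier transform. *)
Definition hc D : R -> R := fun xi => (D xi + D (- xi)) / 2.
Definition hs D : R -> R := fun xi => (D xi - D (- xi)) / 2.
Lemma hc_hs_sq D xi : hc D xi ^+ 2 + hs D xi ^+ 2 = sym_sq D xi ^+ 2.
Proof. by rewrite sym_sqE /hc /hs; field. Qed.

Lemma L2_hc D : L2 D -> L2 (hc D).
Proof.
move=> lD; rewrite (_ : hc D = fun xi => 2^-1 * (D xi + D (- xi))).
  by apply: L2Z; apply: L2D => //; exact: L2_opp.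
by apply/funext => xi; rewrite /hc mulrC.
Qed.
Lemma L2_hs D : L2 D -> L2 (hs D).
Proof.
move=> lD; rewrite (_ : hs D = fun xi => 2^-1 * (D xi - D (- xi))).
  by apply: L2Z; apply: L2B => //; exact: L2_opp.
by apply/funext => xi; rewrite /hs mulrC.
Qed.

Lemma fourier_truncE f n xi : L2 f ->
  fourier_trunc f n xi = Complex (hc (hartley_seq f n) xi) (- hs (hartley_seq f n) xi).
Proof.
move=> lf; have jt := intg_trunc n lf.
have cM : msr (fun x => cos (x * xi)).
  by apply: (measurableT_comp (@continuous_measurable_fun _ _ (@continuous_cos R))); exact: measurable_funM.
have sM : msr (fun x => sin (x * xi)).
  by apply: (measurableT_comp (@continuous_measurable_fun _ _ (@continuous_sin R))); exact: measurable_funM.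
have jc : intg (fun x => trunc n f x * cos (x * xi)).
  by apply: (@intg_bounded _ _ _ 1) => // x; exact: cos_max.
have js : intg (fun x => trunc n f x * sin (x * xi)).
  by apply: (@intg_bounded _ _ _ 1) => // x; exact: sin_max.
have e1 : hartley_seq f n xi = I (fun x => trunc n f x * cos (x * xi)) + I (fun x => trunc n f x * sin (x * xi)).
  by rewrite -ID//; apply: eqI => x; rewrite /cas mulrDr.
have e2 : hartley_seq f n (- xi) = I (fun x => trunc n f x * cos (x * xi)) - I (fun x => trunc n f x * sin (x * xi)).
  by rewrite -IB//; apply: eqI => x; rewrite /cas mulrN cosN sinN mulrDr mulrN.
rewrite /fourier_trunc !truncE /hc /hs e1 e2.
have c1 : I (trunc n (fun x => f x * cos (x * xi))) = I (fun x => trunc n f x * cos (x * xi)).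
  by apply: eqI => x; rewrite /trunc mulrAC.
have s1 : I (trunc n (fun x => f x * sin (x * xi))) = I (fun x => trunc n f x * sin (x * xi)).
  by apply: eqI => x; rewrite /trunc mulrAC.
by rewrite c1 s1; congr Complex; field.
Qed.

Lemma hcB D F xi : hc D xi - hc F xi = hc (fun x => D x - F x) xi.
Proof. by rewrite /hc; field. Qed.
Lemma hsB D F xi : hs D xi - hs F xi = hs (fun x => D x - F x) xi.
Proof. by rewrite /hs; field. Qed.

Definition fourier_of_hartley G : R -> R[i] := fun xi => Complex (hc G xi) (- hs G xi).

Lemma normc_fourier_of_hartley D xi : Normc.normc (fourier_of_hartley D xi) = sym_sq D xi.
Proof. by rewrite /= sqrrN hc_hs_sq sqrtr_sqr ger0_norm// sqrtr_ge0. Qed.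

Lemma is_fourier_hartley f : L2 f -> is_fourier f (fourier_of_hartley (hartley f)).
Proof.
move=> lf; have lG := L2_hartley lf; split.
- by apply/Lfun2P; exact: L2_hc.
- by apply/Lfun2P; apply: L2N; exact: L2_hs.
have E n : ('N[mu]_2%:E[(fun xi => (Normc.normc (fourier_of_hartley (hartley f) xi - fourier_trunc f n xi)%R)%:E)])%E
   = (nrm (fun xi => hartley f xi - hartley_seq f n xi))%:E.
  have lD := L2B lG (L2_hartley_seq n lf); have [l1 <-] := sym_sq_L2 lD.
  rewrite -Lnorm2E//; congr Lnorm; apply/funext => xi; congr EFin.
  rewrite fourier_truncE// -normc_fourier_of_hartley; congr Normc.normc.
  by apply/eqP; rewrite eq_complex /= -hcB -hsB; apply/andP; split; apply/eqP; ring.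
rewrite (_ : (fun n => _) = fun n => (nrm (fun xi => hartley f xi - hartley_seq f n xi))%:E); last first.
  by apply/funext => n; rewrite E.
by apply: cvg_EFin; [exact: nearW|exact: hartley_lim].
Qed.

Lemma L2lim_hc (u : nat -> R -> R) G : (forall n, L2 (u n)) -> L2 G -> L2lim u G ->
  L2lim (fun n => hc (u n)) (hc G) /\ L2lim (fun n => hs (u n)) (hs G).
Proof.
move=> lu lG uG.
have ls n := sym_sq_L2 (L2B lG (lu n)).
have s0 n x : 0 <= sym_sq (fun x => G x - u n x) x by exact: sqrtr_ge0.
split; apply: (cvg0_le _ uG) => n; rewrite nrm_ge0 /= -(ls n).2; apply: nrm_le.
- by apply: L2B; exact: L2_hc.
- exact: (ls n).1.
- move=> x; rewrite hcB (ger0_norm (s0 _ _)) -ler_sqr ?nnegrE// real_normK ?num_real// -hc_hs_sq.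
  by rewrite lerDl sqr_ge0.
- by apply: L2B; exact: L2_hs.
- exact: (ls n).1.
- move=> x; rewrite hsB (ger0_norm (s0 _ _)) -ler_sqr ?nnegrE// real_normK ?num_real// -hc_hs_sq.
  by rewrite lerDr sqr_ge0.
Qed.

Lemma normc_ge_Re (z : R[i]) : `|complex.Re z| <= Normc.normc z.
Proof. by case: z => a b /=; rewrite -sqrtr_sqr ler_wsqrtr// lerDl sqr_ge0. Qed.
Lemma normc_ge_Im (z : R[i]) : `|complex.Im z| <= Normc.normc z.
Proof. by case: z => a b /=; rewrite -sqrtr_sqr ler_wsqrtr// lerDr sqr_ge0. Qed.
Lemma normc_le (z : R[i]) : Normc.normc z <= `|complex.Re z| + `|complex.Im z|.
Proof.
case: z => a b /=; rewrite -[leRHS]ger0_norm ?addr_ge0// -sqrtr_sqr ler_wsqrtr//.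
by rewrite sqrrD !real_normK ?num_real// lerD2r lerDl mulrn_wge0// mulr_ge0.
Qed.

Lemma msr_normc (g : R -> R[i]) : msr (fun xi => complex.Re (g xi)) -> msr (fun xi => complex.Im (g xi)) ->
  msr (fun xi => Normc.normc (g xi)).
Proof.
move=> m1 m2; rewrite (_ : (fun xi => Normc.normc _) =
  fun xi => Num.sqrt (complex.Re (g xi) ^+ 2 + complex.Im (g xi) ^+ 2)); last first.
  by apply/funext => xi; case: (g xi).
apply: measurableT_comp; first by apply: continuous_measurable_fun; exact: sqrt_continuous.
by apply: measurable_funD; exact: measurable_funX.
Qed.

(** Real and imaginary parts of [g] are [L^2] limits of those of the truncated transforms, and so
    are [hc] and [- hs] of [hartley f]. This pins down, up to a null set, the arbitrary choice made
    by [fourier]. *)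
Lemma fourier_unique f (g : R -> R[i]) : L2 f -> is_fourier f g ->
  {ae mu, forall xi, g xi = fourier_of_hartley (hartley f) xi}.
Proof.
move=> lf [/Lfun2P l1 /Lfun2P l2 gn]; have lG := L2_hartley lf.
have lu n := L2_hartley_seq n lf.
pose D n (xi : R) : R[i] := g xi - fourier_trunc f n xi.
have DRe n xi : complex.Re (D n xi) = complex.Re (g xi) - hc (hartley_seq f n) xi.
  by rewrite /D fourier_truncE//; case: (g xi).
have DIm n xi : complex.Im (D n xi) = complex.Im (g xi) - - hs (hartley_seq f n) xi.
  by rewrite /D fourier_truncE//; case: (g xi).
have lRe n : L2 (fun xi => complex.Re (D n xi)).
  by under eq_fun do rewrite DRe; apply: L2B => //; exact: L2_hc.
have lIm n : L2 (fun xi => complex.Im (D n xi)).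
  by under eq_fun do rewrite DIm; apply: L2B => //; apply: L2N; exact: L2_hs.
have lN n : L2 (fun xi => Normc.normc (D n xi)).
  apply: (L2_le _ _ (L2D (L2_abs (lRe n)) (L2_abs (lIm n)))).
    by apply: msr_normc; exact: L2_msr.
  move=> xi; rewrite ger0_norm ?normc_le//; exact: le_trans (normc_ge_Re _).
have n0 : nrm (fun xi => Normc.normc (D n xi)) @[n --> \oo] --> 0.
  have : (nrm (fun xi => Normc.normc (D n xi)))%:E @[n --> \oo] --> 0%:E.
    by rewrite (_ : (fun n => _) = (fun n => 'N[mu]_2%:E[(fun xi => (Normc.normc (g xi - fourier_trunc f n xi)%R)%:E)]%E))//;
      apply/funext => n; rewrite -Lnorm2E.
  by move=> /fine_cvg.
have [c1 c2] := L2lim_hc lu lG (hartley_lim lf).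
have k1 : L2lim (fun n => hc (hartley_seq f n)) (fun xi => complex.Re (g xi)).
  apply: (cvg0_le _ n0) => n; rewrite nrm_ge0 /=; apply: nrm_le => //.
    by apply: L2B => //; exact: L2_hc.
  by move=> xi; rewrite -DRe (le_trans (normc_ge_Re _))// ler_norm.
have k2 : L2lim (fun n xi => - hs (hartley_seq f n) xi) (fun xi => complex.Im (g xi)).
  apply: (cvg0_le _ n0) => n; rewrite nrm_ge0 /=; apply: nrm_le => //.
    by apply: L2B => //; apply: L2N; exact: L2_hs.
  by move=> xi; rewrite -DIm (le_trans (normc_ge_Im _))// ler_norm.
have c3 : L2lim (fun n xi => - hs (hartley_seq f n) xi) (fun xi => - hs (hartley f) xi).
  have := L2limZ (-1) (fun n => L2_hs (lu n)) (L2_hs lG) c2.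
  rewrite (_ : (fun n x => _) = (fun n x => - hs (hartley_seq f n) x)); last first.
    by apply/funext => n; apply/funext => x; rewrite mulN1r.
  by rewrite (_ : (fun x => _ * _) = (fun x => - hs (hartley f) x))//; apply/funext => x; rewrite mulN1r.
have a1 := L2lim_unique (fun n => L2_hc (lu n)) l1 (L2_hc lG) k1 c1.
have a2 := L2lim_unique (fun n => L2N (L2_hs (lu n))) l2 (L2N (L2_hs lG)) k2 c3.
apply: ae_mono2 a1 a2 => xi /= h1 h2.
by apply/eqP; rewrite eq_complex /= h1// h2// !eqxx.
Qed.

Lemma fourier_ae f : L2 f -> is_fourier f (fourier f) /\
  {ae mu, forall xi, fourier f xi = fourier_of_hartley (hartley f) xi}.
Proof.
move=> lf; have h : is_fourier f (fourier f).
  rewrite /fourier; case: xgetP => [g -> //|/(_ (fourier_of_hartley (hartley f)))].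
  by case; exact: is_fourier_hartley.
by split => //; exact: fourier_unique.
Qed.

(* The weight [<xi>^r]. *)
Definition jap (r xi : R) : R := (1 + xi ^+ 2) `^ (r / 2).

Lemma jap_base_gt0 (xi : R) : 0 < 1 + xi ^+ 2.
Proof. by rewrite ltr_pwDl// sqr_ge0. Qed.
Lemma jap_gt0 r xi : 0 < jap r xi.
Proof. by rewrite powR_gt0// jap_base_gt0. Qed.
Lemma jap_ge0 r xi : 0 <= jap r xi.
Proof. exact/ltW/jap_gt0. Qed.
Lemma japN r xi : jap r (- xi) = jap r xi.
Proof. by rewrite /jap sqrrN. Qed.
Lemma msr_jap r : msr (jap r).
Proof.
apply: (measurableT_comp (@measurable_powR R (r / 2))).
by apply: measurable_funD => //; exact: measurable_funX.
Qed.
Lemma japD r t xi : jap (r + t) xi = jap r xi * jap t xi.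
Proof. by rewrite /jap mulrDl powRD//; apply/implyP => _; rewrite gt_eqF// jap_base_gt0. Qed.
Lemma jap0 xi : jap 0 xi = 1.
Proof. by rewrite /jap mul0r powRr0. Qed.
Lemma jap_inv r xi : jap (- r) xi * jap r xi = 1.
Proof. by rewrite -japD addNr jap0. Qed.
Lemma jap_le r t xi : r <= t -> jap r xi <= jap t xi.
Proof. by move=> rt; rewrite /jap ler_powR ?lerDl ?sqr_ge0// ler_pM2r ?invr_gt0. Qed.
Lemma jap_ge1 r xi : 0 <= r -> 1 <= jap r xi.
Proof. by move=> r0; rewrite -(jap0 xi); exact: jap_le. Qed.
Lemma jap2 xi : jap 2 xi = 1 + xi ^+ 2.
Proof. by rewrite /jap divff// powRr1// ltW// jap_base_gt0. Qed.

Definition Hs r f : Prop := L2 f /\ L2 (fun xi => jap r xi * hartley f xi).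
Definition Hs_norm r f : R := nrm (fun xi => jap r xi * hartley f xi).

Lemma msr_jap_hartley r f : L2 f -> msr (fun xi => jap r xi * hartley f xi).
Proof. by move=> lf; apply: measurable_funM; [exact: msr_jap|exact: msr_hartley]. Qed.

Lemma sym_sq_jap r G xi : sym_sq (fun xi => jap r xi * G xi) xi = jap r xi * sym_sq G xi.
Proof.
rewrite /sym_sq japN !exprMn -mulrDr -mulrA sqrtrM ?sqr_ge0// sqrtr_sqr.
by rewrite ger0_norm// jap_ge0.
Qed.

Lemma sobolev_fourier r f : L2 f ->
  msr (fun xi => jap r xi * Normc.normc (fourier f xi)) /\
  ae_eq mu setT (fun xi => jap r xi * Normc.normc (fourier f xi)) (sym_sq (fun xi => jap r xi * hartley f xi)).
Proof.
move=> lf; have [[/Lfun2P l1 /Lfun2P l2 _] ae] := fourier_ae lf; split.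
  apply: measurable_funM; first exact: msr_jap.
  by apply: msr_normc; exact: L2_msr.
by apply: ae_mono ae => xi h _; rewrite h normc_fourier_of_hartley sym_sq_jap.
Qed.

Lemma sobolev_normE r f : Hs r f -> sobolev_norm r f = (Hs_norm r f)%:E.
Proof.
move=> [lf lG]; have [mN ae] := sobolev_fourier r lf; have [ls ns] := sym_sq_L2 lG.
have lN : L2 (fun xi => jap r xi * Normc.normc (fourier f xi)).
  by apply: (L2_ae ls mN); apply: ae_mono ae => xi /= h Tx; rewrite h.
by rewrite /Hs_norm -ns -(nrm_ae mN (L2_msr ls) ae) -(Lnorm2E lN).
Qed.

(** For the forward direction, finiteness of the norm makes the weighted Fourier modulus
    square-integrable; by [sym_sq_ge] twice this modulus dominates the weighted Hartley transform
    almost everywhere. *)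
Lemma sobolevP r f : sobolev r f <-> Hs r f.
Proof.
split=> [[/Lfun2P lf fin]|h]; last first.
  by split; [apply/Lfun2P; exact: h.1|rewrite sobolev_normE// ltry].
split => //; have [mN ae] := sobolev_fourier r lf.
have lN := Lnorm2_lty mN fin.
have mG := msr_jap_hartley r lf.
have ls := L2_ae lN (msr_sym_sq mG) ae.
by apply: (L2_le mG _ (L2Z 2 ls)) => xi; exact: (sym_sq_ge (fun xi => jap r xi * hartley f xi) xi).
Qed.

Lemma HsD r f g : Hs r f -> Hs r g -> Hs r (fun x => f x + g x).
Proof.
move=> [lf hf] [lg hg]; split; first exact: L2D.
apply: (L2_ae (L2D hf hg)); first by apply: msr_jap_hartley; exact: L2D.
by apply: ae_mono (hartleyD lf lg) => xi /= h Tx; rewrite h// mulrDr.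
Qed.
Lemma HsB r f g : Hs r f -> Hs r g -> Hs r (fun x => f x - g x).
Proof.
move=> [lf hf] [lg hg]; split; first exact: L2B.
apply: (L2_ae (L2B hf hg)); first by apply: msr_jap_hartley; exact: L2B.
by apply: ae_mono (hartleyB lf lg) => xi /= h Tx; rewrite h// mulrBr.
Qed.
Lemma Hs_norm_ge0 r f : 0 <= Hs_norm r f. Proof. exact: nrm_ge0. Qed.
Lemma Hs_normB_le r f g : Hs r f -> Hs r g -> Hs_norm r f <= Hs_norm r g + Hs_norm r (fun x => f x - g x).
Proof.
move=> [lf hf] [lg hg]; rewrite /Hs_norm.
rewrite [X in _ <= _ + X](nrm_ae (g := fun xi => jap r xi * hartley f xi - jap r xi * hartley g xi)); last 3 first.
- by apply: msr_jap_hartley; exact: L2B.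
- by apply: measurable_funB; exact: msr_jap_hartley.
- by apply: ae_mono (hartleyB lf lg) => xi /= h Tx; rewrite h// mulrBr.
apply: le_trans (nrmD hg (L2B hf hg)); rewrite le_eqVlt; apply/orP; left; apply/eqP.
by congr nrm; apply/funext => xi; rewrite addrC subrK.
Qed.
(** The isometry constant [sqrt (2 pi)] is at least 1, and so is the weight. *)
Lemma nrm_le_Hs_norm r f : 0 <= r -> Hs r f -> nrm f <= Hs_norm r f.
Proof.
move=> r0 [lf hf]; apply: (@le_trans _ _ (nrm (hartley f))).
  rewrite nrm_hartley// ler_peMl ?nrm_ge0// -(sqrtr1 R) ler_wsqrtr//.
  by have := @pi_ge2 R; lra.
apply: nrm_le => //; first exact: L2_hartley.
by move=> xi; rewrite normrM ler_peMl// (ger0_norm (jap_ge0 _ _)) jap_ge1.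
Qed.
End SobolevLink.

(** * The kernel and its multiplier *)

Section Kernel.
Context {R : realType}.
Notation mu := (@lebesgue_measure R).
Notation msr f := (measurable_fun [set: R] (f : R -> R)).
Notation msr2 F := (measurable_fun [set: R * R] (F : R * R -> R)).
Notation sq f := (fun x => f x ^+ 2).
Notation K := (@bbm_kernel R).
Implicit Types f g h u v : R -> R.

Lemma msr_kernel : msr K.
Proof.
apply: measurable_funM; last first.
  have -> : (fun x : R => expR (- `|x|)) = damp 1 by apply/funext => x; rewrite /damp mul1r.
  exact: msr_damp.
apply: measurable_funM => //.
rewrite (_ : Num.sg = fun x : R => \1_(`]0, +oo[%classic) x - \1_(`]-oo, 0[%classic) x).
  by apply: measurable_funB; exact: measurable_indic.
apply/funext => x; rewrite !indicE !mem_setE !in_itv /= andbT.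
by case: (sgrP x) => x0; rewrite ?ltxx ?subrr ?subr0 ?sub0r ?(lt_gtF x0).
Qed.

Lemma kernel_abs_le x : `|K x| <= damp 1 x.
Proof.
have -> : damp 1 x = expR (- `|x|) by rewrite /damp mul1r.
rewrite /bbm_kernel normrM (ger0_norm (expR_ge0 _)); apply: ler_piMl; first exact: expR_ge0.
rewrite normrM normrN.
have h : `|Num.sg x| <= 1 by rewrite normr_sg; case: (_ != _).
rewrite mulr_ile1// ger0_norm//; lra.
Qed.

Lemma kernelN x : K (- x) = - K x.
Proof. by rewrite /bbm_kernel sgrN normrN; ring. Qed.

Lemma kernel_abs_le1 x : `|K x| <= 1.
Proof. by rewrite (le_trans (kernel_abs_le x))// damp_le1. Qed.

Lemma intg_kernel : intg K.
Proof. by apply: (intg_le msr_kernel kernel_abs_le); exact: intg_damp. Qed.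

Definition kabs (x : R) : R := `|K x|.
Lemma intg_kabs : intg kabs. Proof. exact: intg_abs intg_kernel. Qed.
Lemma I_kabs_le : I kabs <= 2.
Proof.
apply: (@le_trans _ _ (I (damp 1))); last by rewrite I_damp// divr1.
by apply: I_le; [exact: intg_kabs|exact: intg_damp|exact: kernel_abs_le].
Qed.
Lemma kabs_ge0 x : 0 <= kabs x. Proof. exact: normr_ge0. Qed.
Lemma L2_kernel : L2 K.
Proof.
split; first exact: msr_kernel.
apply: (intg_le _ _ intg_kabs); first by apply: measurable_funX; exact: msr_kernel.
by move=> x; rewrite normrX expr2 ler_piMr// kernel_abs_le1.
Qed.

(** The sine transform of the odd kernel; the Fourier multiplier is [- i] times it, that is
    [i xi / (1 + xi^2)]. *)
Definition symbol (xi : R) : R := - xi / (1 + xi ^+ 2).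

(** The gain of one derivative, from [|xi| <= <xi>]. *)
Lemma symbol_jap xi : `|symbol xi| <= jap (-1) xi.
Proof.
have b0 := jap_base_gt0 xi.
have j1 : jap 1 xi ^+ 2 = 1 + xi ^+ 2 by rewrite expr2 -japD (_ : 1 + 1 = 2) ?jap2.
have i0 : 0 <= (1 + xi ^+ 2)^-1 by rewrite invr_ge0 ltW.
rewrite /symbol normrM normrN (ger0_norm i0).
rewrite ler_pdivrMr// -j1 expr2 mulrA jap_inv mul1r.
rewrite -ler_sqr ?nnegrE ?jap_ge0// real_normK ?num_real// j1; lra.
Qed.

Lemma msr_symbol : msr symbol.
Proof.
apply: continuous_measurable_fun => x; apply: cvgM; first by apply: cvgN; exact: cvg_id.
apply: cvgV; first by rewrite gt_eqF// jap_base_gt0.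
by apply: cvgD; [exact: cvg_cst|exact: exprn_continuous].
Qed.

(** By [casD] the integrand splits into a cosine and a sine of [z xi]. The odd kernel annihilates
    the cosine, and the sine comes with the reflected factor [cas (- (y xi))]. *)
Lemma kernel_cas xi y : I (fun z => K z * cas ((z + y) * xi)) = symbol xi * cas (- (y * xi)).
Proof.
have cM : msr (fun z : R => cos (z * xi)).
  by apply: (measurableT_comp (@continuous_measurable_fun _ _ (@continuous_cos R))); exact: measurable_funM.
have sM : msr (fun z : R => sin (z * xi)).
  by apply: (measurableT_comp (@continuous_measurable_fun _ _ (@continuous_sin R))); exact: measurable_funM.
have jc : intg (fun z => K z * cos (z * xi)).
  by apply: (@intg_bounded _ _ _ 1) => //; [exact: intg_kernel|move=> t; exact: cos_max].
have js : intg (fun z => K z * sin (z * xi)).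
  by apply: (@intg_bounded _ _ _ 1) => //; [exact: intg_kernel|move=> t; exact: sin_max].
have e1 : I (fun z => K z * cos (z * xi)) = 0.
  by apply: (I_odd jc) => z; rewrite kernelN (mulNr z) cosN mulNr.
have e2 : I (fun z => K z * sin (z * xi)) = symbol xi.
  (* The sign in the kernel turns [sin (z xi)] into the even function [sin (xi |z|)]. *)
  rewrite (_ : I _ = I (fun z => - 2^-1 * (damp 1 z * sin (xi * `|z|)))).
    rewrite IZ.
      by rewrite I_damp_sin_abs /symbol; move: (1 + xi ^+ 2) (lt0r_neq0 (jap_base_gt0 xi)) => q q0; field.
    apply: intg_damp_bounded => //; last by move=> t; exact: sin_max.
    apply: (measurableT_comp (@continuous_measurable_fun _ _ (@continuous_sin R))).
    by apply: measurable_funM => //; exact: measurableT_comp.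
  apply: eqI => z; rewrite /bbm_kernel /damp mul1r.
  have [z0|z0|->] := ltrgt0P z; first 2 last.
  - by rewrite sgr0 (mulr0 xi) sin0 !mulr0 !mul0r.
  - by rewrite gtr0_sg// mulr1 (mulrC z) mul1r mulrA.
  - by rewrite ltr0_sg// (mulrN xi) sinN (mulrC z) mul1r; ring.
rewrite (_ : I _ = I (fun z => cas (y * xi) * (K z * cos (z * xi)) + cas (- (y * xi)) * (K z * sin (z * xi)))).
  by rewrite ID; [|exact: intgZ..]; rewrite (IZ _ jc) (IZ _ js) e1 e2 mulr0 add0r mulrC.
by apply: eqI => z; rewrite mulrDl casD; ring.
Qed.

(** Fubini, then [kernel_cas] for each [xi]; the substitution of [- xi] for [xi] turns
    [cas (- (y xi))] back into the Hartley kernel. *)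
Lemma kernel_hartley1 f y : intg f ->
  I (fun x => K (x - y) * hartley1 f x) = hartley1 (fun xi => symbol (- xi) * f (- xi)) y.
Proof.
move=> jf.
have jKy : intg (fun x => K (x - y)) by exact: (intg_shift (- y) intg_kernel).
pose F (p : R * R) := K (p.1 - y) * f p.2 * cas (p.1 * p.2).
have hF : fub F.
  apply: (fub_le _ _ (fubZ 2 (fub_prod (intg_abs jKy) (intg_abs jf)))).
    apply: measurable_funM; last exact: msr2_cas.
    apply: measurable_funM; [apply: (msr_fst (f := fun x => K (x - y))) | apply: msr_snd]; exact: intg_msr.
  by move=> p; rewrite normrM mulrC normrM ler_wpM2r ?mulr_ge0//; exact: cas_le2.
have := fubini hF; rewrite /F /= => h.
transitivity (I (fun x => I (fun xi => K (x - y) * f xi * cas (x * xi)))).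
  apply: eqI => x; rewrite /hartley1 -IZ; last exact: intg_cas.
  by apply: eqI => xi; rewrite (mulrC xi) mulrA.
rewrite h /hartley1.
have js : intg (fun xi => f xi * symbol xi).
  apply: (@intg_bounded _ _ _ 1 jf msr_symbol) => xi; apply: (le_trans (symbol_jap xi)).
  have : jap (-1) xi <= jap 0 xi by apply: jap_le; exact: lerN10.
  by rewrite jap0.
have js2 : intg (fun xi => f xi * symbol xi * cas (- (y * xi))).
  apply: (@intg_bounded _ _ _ 2 js); last by move=> t; exact: cas_le2.
  by apply: (measurableT_comp msr_cas); apply: measurableT_comp => //; exact: measurable_funM.
transitivity (I (fun xi => f xi * symbol xi * cas (- (y * xi)))).
  apply: eqI => xi; rewrite -mulrA -kernel_cas -IZ.
    rewrite -[LHS](I_shift y).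
      by apply: eqI => x; rewrite addrK; ring.
    have := @intg_cas _ _ xi (intgZ (f xi) jKy).
    by under eq_fun do rewrite (mulrC (f xi)).
  have := intg_shift y (@intg_cas _ _ xi jKy).
  by under eq_fun do rewrite addrK.
rewrite -[LHS](I_opp js2).
by apply: eqI => xi; rewrite mulrN opprK (mulrC xi) (mulrC (symbol _)).
Qed.
End Kernel.

(** * Weights and the trilinear estimate *)

Section Weights.
Context {R : realType}.
Notation mu := (@lebesgue_measure R).
Notation msr f := (measurable_fun [set: R] (f : R -> R)).
Notation msr2 F := (measurable_fun [set: R * R] (F : R * R -> R)).
Notation sq f := (fun x => f x ^+ 2).
Implicit Types f g h A B C : R -> R.

(** Negative powers decrease with the weight, so both may be moved to whichever of [x] and [y] has
    the smaller one. *)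
Lemma jap_prod_le (a s x y : R) : 0 <= a -> 0 <= s ->
  jap (- a) x * jap (- s) y <= jap (- (a + s)) x + jap (- (a + s)) y.
Proof.
move=> a0 s0.
have mono (t p q : R) : 0 <= t -> 1 + p ^+ 2 <= 1 + q ^+ 2 -> jap (- t) q <= jap (- t) p.
  move=> t0 pq; rewrite /jap mulNr !powRN lef_pV2 ?posrE ?powR_gt0 ?jap_base_gt0//.
  by apply: ge0_ler_powR => //; rewrite ?divr_ge0 ?nnegrE ?(ltW (jap_base_gt0 _)).
rewrite !opprD !japD.
have [xy|/ltW xy] := leP (1 + x ^+ 2) (1 + y ^+ 2).
  by rewrite ler_wpDr ?mulr_ge0 ?jap_ge0// ler_wpM2l ?jap_ge0 ?mono.
by rewrite ler_wpDl ?mulr_ge0 ?jap_ge0// ler_wpM2r ?jap_ge0 ?mono.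
Qed.

(** The factor comes from [1 + (x + y)^2 <= 4 (1 + m^2)], where [m] is the larger of [|x|] and
    [|y|]. *)
Lemma jap_add_le (s x y : R) : 0 <= s -> jap s (x + y) <= 4 `^ (s / 2) * (jap s x + jap s y).
Proof.
move=> s0.
have h z w : 1 + z ^+ 2 <= 4 * (1 + w ^+ 2) -> jap s z <= 4 `^ (s / 2) * jap s w.
  move=> zw; rewrite /jap -powRM//; last by rewrite ltW ?jap_base_gt0.
  by apply: ge0_ler_powR; rewrite ?divr_ge0 ?nnegrE ?mulr_ge0 ?(ltW (jap_base_gt0 _)).
rewrite mulrDr.
have c0 : 0 <= 4 `^ (s / 2) :> R by exact: powR_ge0.
have [xy|/ltW xy] := leP (x ^+ 2) (y ^+ 2).
  by rewrite ler_wpDl ?mulr_ge0 ?jap_ge0// h//; have := sqr_ge0 (x - y); nra.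
by rewrite ler_wpDr ?mulr_ge0 ?jap_ge0// h//; have := sqr_ge0 (x - y); nra.
Qed.

(* From [<x>^s <= C (<z>^s + <x-z>^s)], which cancels one of the two negative powers. *)
Lemma jap_weight (s a x z : R) : 0 <= a -> 0 <= s ->
  jap (s - a) x * (jap (- s) z * jap (- s) (x - z)) <=
  2 * 4 `^ (s / 2) * (jap (- (a + s)) x + jap (- (a + s)) z + jap (- (a + s)) (x - z)).
Proof.
move=> a0 s0; have c0 : 0 <= 4 `^ (s / 2) :> R by exact: powR_ge0.
have h := jap_add_le z (x - z) s0; rewrite addrC subrK in h.
have e1 := jap_prod_le x z a0 s0; have e2 := jap_prod_le x (x - z) a0 s0.
have i1 := jap_inv s z; have i2 := jap_inv s (x - z).
have j0 := jap_ge0 (- a) x; have j1 := jap_ge0 (- s) z; have j2 := jap_ge0 (- s) (x - z).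
rewrite japD.
apply: (@le_trans _ _ (jap (- a) x * (jap (- s) z * jap (- s) (x - z) * (4 `^ (s / 2) * (jap s z + jap s (x - z)))))).
  rewrite [leLHS](_ : _ = jap (- a) x * (jap (- s) z * jap (- s) (x - z) * jap s x)); last by ring.
  by rewrite ler_wpM2l// ler_wpM2l// mulr_ge0.
rewrite [leLHS](_ : _ = 4 `^ (s / 2) * (jap (- a) x * jap (- s) (x - z) * (jap (- s) z * jap s z) +
  jap (- a) x * jap (- s) z * (jap (- s) (x - z) * jap s (x - z)))); last by ring.
rewrite i1 i2 !mulr1 (mulrC 2) -mulrA ler_wpM2l//.
have k1 := jap_ge0 (- (a + s)) z; have k2 := jap_ge0 (- (a + s)) (x - z).
(* The power at [x] occurs twice, those at [z] and [x - z] once; the factor 2 covers all three. *)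
apply: (le_trans (lerD e2 e1)); lra.
Qed.

(** Comparison with [(1 + |x|)^(-2b)], whose antiderivative is explicit and vanishes at infinity as
    [2b > 1]. The factor [2^b] comes from [(1 + |x|)^2 <= 2 (1 + x^2)]. *)
Lemma jap_L2 (b : R) : 1 / 2 < b -> L2 (jap (- b)).
Proof.
move=> b2; split; first exact: msr_jap.
pose f (x : R) : R := (1 + `|x|) `^ (- (2 * b)).
pose F (x : R) : R := (1 + x) `^ (1 - 2 * b) / (1 - 2 * b).
have p1 (x : R) : 0 < 1 + `|x| by rewrite ltr_pwDl.
have nb : 1 - 2 * b != 0 by rewrite lt_eqF//; lra.
have [jf _] : intg (fun x => f `|x|) /\ I (fun x => f `|x|) = 2 * (0 - F 0).
  apply: even_half_line.
  - by move=> x _; exact: powR_ge0.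
  - move=> x; rewrite /f.
    have -> : (fun x : R => (1 + `|x|) `^ (- (2 * b))) = fun x => expR (- (2 * b) * ln (1 + `|x|)).
      by apply/funext => y; rewrite /powR gt_eqF.
    apply: continuous_comp; last exact: continuous_expR.
    apply: cvgMr; apply: (@continuous_comp _ _ _ (fun x : R => 1 + `|x|) (@ln R)).
      by apply: cvgD; [exact: cvg_cst|apply: cvg_norm; exact: cvg_id].
    exact: continuous_ln.
  - move=> x x0; have x1 : 0 < 1 + x by rewrite ltr_pwDl.
    rewrite /F /f ger0_norm//.
    have d1 : is_derive x 1 (fun y : R => 1 + y) 1.
      by apply: is_derive_eq; rewrite add0r mulr1.
    have d2 := is_derive1_powR (1 - 2 * b) x1.
    have d3 := @is_derive1_comp _ (fun y => y `^ (1 - 2 * b)) _ _ _ _ d2 d1.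
    have -> : (fun x : R => (1 + x) `^ (1 - 2 * b) / (1 - 2 * b)) =
      (1 - 2 * b)^-1 *: ((fun y => y `^ (1 - 2 * b)) \o (fun y : R => 1 + y)).
      by apply/funext => y; rewrite mulrC.
    apply: is_derive_eq; rewrite /GRing.scale /= mulr1 mulrA mulVf// mul1r.
    by congr (_ `^ _); ring.
  - have c0 : 0 < 2 * b - 1 by lra.
    have -> : 0 = 0 * (1 - 2 * b)^-1 :> R by rewrite mul0r.
    apply: cvgM; last exact: cvg_cst.
    apply/cvgrPdist_le => e e0.
    (* Beyond [e^(-1/(2b-1))] the power [(1 + x)^(1-2b)] is at most [e]. *)
    apply: filterS (nbhs_pinfty_ge (num_real (e `^ (- (2 * b - 1)^-1)))) => x xM'; rewrite sub0r normrN (ger0_norm (powR_ge0 _ _)).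
    have M0 : 0 < e `^ (- (2 * b - 1)^-1) by exact: powR_gt0.
    have xM : e `^ (- (2 * b - 1)^-1) <= 1 + x by rewrite (le_trans xM')// lerDr.
    rewrite (_ : e = (e `^ (- (2 * b - 1)^-1)) `^ (1 - 2 * b)); last first.
      rewrite -powRrM (_ : - (2 * b - 1)^-1 * (1 - 2 * b) = 1) ?powRr1 ?(ltW e0)//.
      by field; rewrite gt_eqF.
    have -> : 1 - 2 * b = - (2 * b - 1) by ring.
    move: (e `^ _) M0 xM => M M0 xM.
    rewrite !(powRN _ (2 * b - 1)) lef_pV2 ?posrE ?powR_gt0 ?(lt_le_trans M0 xM)//.
    by apply: ge0_ler_powR; rewrite ?nnegrE ?(ltW c0) ?(ltW M0)// (le_trans (ltW M0)).
have c0 : 0 <= 2 `^ b :> R by exact: powR_ge0.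
apply: (intg_le _ _ (intgZ (2 `^ b) jf)); first by apply: measurable_funX; exact: msr_jap.
move=> x; rewrite ger0_norm ?sqr_ge0// expr2 -japD /f normr_id.
have -> : - b + - b = - (2 * b) by ring.
rewrite /jap mulNr !powRN.
have -> : 2 * b / 2 = b by field.
rewrite ler_pdivlMr ?powR_gt0// mulrC ler_pdivrMr ?powR_gt0 ?jap_base_gt0//.
have b0 : 0 <= b by lra.
rewrite powRrM powR_mulrn ?(ltW (p1 x))// -powRM ?(ltW (jap_base_gt0 _))//.
apply: ge0_ler_powR; rewrite ?nnegrE ?exprn_ge0 ?mulr_ge0 ?(ltW (p1 x)) ?(ltW (jap_base_gt0 _))//.
rewrite -(real_normK (num_real x)); have := sqr_ge0 (`|x| - 1); nra.
Qed.

Section Trilinear.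
Lemma fub_abs (F : R * R -> R) : fub F -> fub (fun p => `|F p|).
Proof. by move=> h; have := integrable_abse h. Qed.

(** For fixed [x], Cauchy-Schwarz in the inner variable gives [nrm B * nrm C] whatever [x] is; what
    remains is the integral of [|A|]. *)
Lemma tri_bound A B C : intg A -> L2 B -> L2 C ->
  let F := fun p => A p.1 * (B p.2 * C (p.1 - p.2)) in
  fub F /\ II (fun p => `|F p|) <= I (fun x => `|A x|) * (nrm B * nrm C).
Proof.
move=> jA lB lC F.
have mF : msr2 F.
  apply: measurable_funM; first by apply: msr_fst; exact: intg_msr.
  by apply: measurable_funM; [apply: msr_snd|apply: msr_diff]; exact: L2_msr.
have lr x : L2 (fun y => C (x - y)) by exact: L2_refl.
have jBC x : intg (fun y => `|B y| * `|C (x - y)|) := L2M (L2_abs lB) (L2_abs (lr x)).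
have bBC x : I (fun y => `|B y| * `|C (x - y)|) <= nrm B * nrm C.
  by rewrite -(nrm_refl x lC); exact: cauchy_schwarz_abs.
have e x : I (fun y => `|F (x, y)|) = `|A x| * I (fun y => `|B y| * `|C (x - y)|).
  by rewrite -IZ//; apply: eqI => y; rewrite /F /= !normrM.
have je x : intg (fun y => `|F (x, y)|).
  have := intgZ `|A x| (jBC x); congr intg; apply/funext => y; by rewrite /F /= !normrM.
have jA2 := intgZ (nrm B * nrm C) (intg_abs jA).
have le x : `|A x| * I (fun y => `|B y| * `|C (x - y)|) <= nrm B * nrm C * `|A x|.
  by rewrite mulrC ler_wpM2r.
have hF : fub F.
  apply/(fubP mF); apply: (@le_lt_trans _ _ (\int[mu]_x (nrm B * nrm C * `|A x|)%:E)%E); last by rewrite (intgE jA2) ltry.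
  apply: ge0_le_integral => //.
  - by move=> x _; apply: integral_ge0 => y _; rewrite lee_fin.
  - apply: (@measurable_fun_fubini_tonelli_F _ _ _ _ _ mu (fun p => `|F p|%:E)) => //.
    by apply: measurableT_comp => //; apply: measurableT_comp.
  - exact: (msrE (intg_msr jA2)).
  - by move=> x _; rewrite (intgE (je x)) e lee_fin.
split => //.
have haF := fub_abs hF.
rewrite -(II1 haF) (mulrC (I _)) -(IZ _ (intg_abs jA)).
apply: I_le => //; first exact: (intg_fub1 haF).
by move=> x; rewrite e.
Qed.

Lemma II_swap (F : R * R -> R) : fub F -> II (fun p => F (p.2, p.1)) = II F.
Proof. by move=> h; rewrite -(II1 (fub_swap h)) -(II2 h). Qed.

Lemma fub_refl (F : R * R -> R) : fub F -> let G := fun p => F (p.1, p.1 - p.2) in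
  fub G /\ II (fun p => `|G p|) = II (fun p => `|F p|).
Proof.
move=> hF G; have mF := fub_msr hF.
have mG : msr2 G.
  apply: (measurableT_comp mF); apply: measurable_fun_pair; first exact: measurable_fst.
  by apply: measurable_funB; [exact: measurable_fst|exact: measurable_snd].
have e x : (\int[mu]_y `|G (x, y)|%:E = \int[mu]_y `|F (x, y)|%:E)%E.
  rewrite -(J_refl (f := fun y => `|F (x, y)|%:E) x)//.
  by apply: msrE; apply: measurableT_comp => //; exact: msr_pair1.
have hG : fub G.
  by apply/(fubP mG); under eq_integral do rewrite e; exact: ((fubP mF).1 hF).
split => //; rewrite -(II1 (fub_abs hG)) -(II1 (fub_abs hF)).
by apply: eqI => x; rewrite /I /Rintegral e.
Qed.

(** [jap_weight] puts [o = <.>^(-(a+s))] on one of [x], [z], [x - z]. The function of that variable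
    times [o] is integrable and plays the part of [A] in [tri_bound]; a swap and a reflection of
    coordinates bring the last two cases to this form. Three terms with the constant of [jap_weight]
    give the 6. *)
Lemma trilinear (s a : R) (chi X W : R -> R) : 0 <= a -> 0 <= s -> 1 / 2 < a + s ->
  msr chi -> (forall x, `|chi x| <= jap (s - a) x * `|X x|) -> L2 X -> L2 W ->
  let G := fun p => chi p.1 * (jap (- s) p.2 * W p.2 * (jap (- s) (p.1 - p.2) * W (p.1 - p.2))) in
  fub G /\ II (fun p => `|G p|) <=
    6 * 4 `^ (s / 2) * nrm (jap (- (a + s))) * (nrm X * nrm W ^+ 2).
Proof.
move=> a0 s0 b0 mchi chiX lX lW G.
have lo := jap_L2 b0; set o := jap (- (a + s)) in lo *.
have jA (f : R -> R) (lf : L2 f) : intg (fun x => o x * f x) := L2M lo lf.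
have nA (f : R -> R) (lf : L2 f) : I (fun x => `|o x * f x|) <= nrm o * nrm f.
  by rewrite (eqI (fun x => normrM (o x) (f x))); exact: cauchy_schwarz_abs.
have [f1 n1] := tri_bound (jA _ lX) lW lW.
(* Swapping the coordinates reverses their difference, so [tri_bound] is applied to the reflected
   [W]. *)
have lW' : L2 (fun x => W (- x)) := L2_opp lW.
have [f2' n2'] := tri_bound (jA _ lW) lX lW'.
have f2 := fub_swap f2'; have [f3 n3] := fub_refl f2.
have n2 := II_swap (fub_abs f2').
rewrite /= in f1 n1 f2 f2' n2 n2' f3 n3.
have c0 : 0 <= 2 * 4 `^ (s / 2) :> R by rewrite mulr_ge0// powR_ge0.
have b1 := le_trans n1 (ler_wpM2r (mulr_ge0 (nrm_ge0 W) (nrm_ge0 W)) (nA _ lX)).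
have b2 := le_trans n2' (ler_wpM2r (mulr_ge0 (nrm_ge0 X) (nrm_ge0 _)) (nA _ lW)).
rewrite nrm_opp// in b2.
have mG : msr2 G.
  apply: measurable_funM; first exact: msr_fst.
  have mw : msr (fun x => jap (- s) x * W x) by apply: measurable_funM; [exact: msr_jap|exact: L2_msr].
  by apply: measurable_funM; [exact: (msr_snd mw)|exact: (msr_diff mw)].
have fS := fubZ (2 * 4 `^ (s / 2)) (fubD (fubD (fub_abs f1) (fub_abs f2)) (fub_abs f3)).
have GS p : `|G p| <= 2 * 4 `^ (s / 2) * (`|o p.1 * X p.1 * (W p.2 * W (p.1 - p.2))| +
   `|o p.2 * W p.2 * (X p.1 * W (- (p.2 - p.1)))| +
   `|o (p.1 - p.2) * W (p.1 - p.2) * (X p.1 * W (- (p.1 - p.2 - p.1)))|).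
  case: p => x z; rewrite /G /=.
  have -> : - (z - x) = x - z by ring.
  have -> : - (x - z - x) = z by ring.
  have w := jap_weight x z a0 s0; rewrite -/o in w.
  have o0 y : 0 <= o y by exact: jap_ge0.
  rewrite !normrM !(ger0_norm (o0 _)) !(ger0_norm (jap_ge0 _ _)).
  set T := `|X x| * (`|W z| * `|W (x - z)|).
  have T0 : 0 <= T by rewrite !mulr_ge0.
  apply: (@le_trans _ _ (jap (s - a) x * (jap (- s) z * jap (- s) (x - z)) * T)).
    rewrite [leLHS](_ : _ = `|chi x| * (jap (- s) z * `|W z| * (jap (- s) (x - z) * `|W (x - z)|)))//.
    rewrite [leRHS](_ : _ = jap (s - a) x * `|X x| * (jap (- s) z * `|W z| * (jap (- s) (x - z) * `|W (x - z)|))); last by rewrite /T; ring.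
    by apply: ler_wpM2r => //; rewrite !mulr_ge0// jap_ge0.
  apply: (le_trans (ler_wpM2r T0 w)).
  by rewrite le_eqVlt; apply/orP; left; apply/eqP; rewrite /T; ring.
have hG : fub G := fub_le mG GS fS.
split => //; apply: (le_trans (II_le (fub_abs hG) fS GS)).
rewrite (IIZ _ (fubD (fubD (fub_abs f1) (fub_abs f2)) (fub_abs f3))).
rewrite (IID (fubD (fub_abs f1) (fub_abs f2)) (fub_abs f3)) (IID (fub_abs f1) (fub_abs f2)).
rewrite n3 n2.
have -> : 6 * 4 `^ (s / 2) * nrm o * (nrm X * nrm W ^+ 2) =
   2 * 4 `^ (s / 2) * (3 * (nrm o * (nrm X * nrm W ^+ 2))) by ring.
apply: ler_wpM2l => //.
move: b1 b2.
have -> : nrm o * nrm X * (nrm W * nrm W) = nrm o * (nrm X * nrm W ^+ 2) by ring.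
have -> : nrm o * nrm W * (nrm X * nrm W) = nrm o * (nrm X * nrm W ^+ 2) by ring.
move: (nrm o * _) (II _) (II _) => z x y; clear; lra.
Qed.
End Trilinear.
End Weights.

(** * Duality and the nonlinearity *)

Section Flux.
Context {R : realType}.
Notation mu := (@lebesgue_measure R).
Notation msr f := (measurable_fun [set: R] (f : R -> R)).
Notation msr2 F := (measurable_fun [set: R * R] (F : R * R -> R)).
Notation sq f := (fun x => f x ^+ 2).
Notation K := (@bbm_kernel R).
Implicit Types f g h u phi : R -> R.

Definition flux u : R -> R := fun y => u y + u y ^+ 2 / 2.

Lemma L2_jap_opp r phi : 0 <= r -> L2 phi -> L2 (fun xi => jap (- r) xi * phi xi).
Proof.
move=> r0 lp; apply: (L2_le _ _ (L2_abs lp)); first by apply: measurable_funM; [exact: msr_jap|exact: L2_msr].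
move=> xi; rewrite normrM ger0_norm ?jap_ge0// ler_piMl//.
by rewrite -(jap0 xi); apply: jap_le; rewrite oppr_le0.
Qed.

(* The transpose of convolution with the kernel: [K * h] tested against [hartley1 phi] is [h] tested against [hartley1 (dual_symbol phi)]; the reflection comes from the odd kernel. *)
Definition dual_symbol phi : R -> R := fun xi => symbol (- xi) * phi (- xi).

Lemma symbol_le1 xi : `|symbol xi| <= 1 :> R.
Proof.
apply: (le_trans (symbol_jap xi)).
by have := jap_le xi (lerN10 R); rewrite jap0.
Qed.

Lemma dual_symbol_le phi xi : `|dual_symbol phi xi| <= `|phi (- xi)|.
Proof. by rewrite normrM ler_piMl// symbol_le1. Qed.

Lemma dual_symbol_jap phi xi : `|dual_symbol phi xi| <= jap (-1) xi * `|phi (- xi)|.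
Proof. by rewrite normrM ler_wpM2r// -japN symbol_jap. Qed.

Lemma msr_dual_symbol phi : msr phi -> msr (dual_symbol phi).
Proof. by move=> m; apply: measurable_funM; apply: msr_opp => //; exact: msr_symbol. Qed.

Lemma intg_dual_symbol phi : intg phi -> intg (dual_symbol phi).
Proof.
move=> j; apply: (intg_le _ _ (intg_abs (intg_opp j))); first exact: (msr_dual_symbol (intg_msr j)).
by move=> x; exact: dual_symbol_le.
Qed.

Lemma L2_dual_symbol phi : L2 phi -> L2 (dual_symbol phi).
Proof.
move=> j; apply: (L2_le _ _ (L2_abs (L2_opp j))); first exact: (msr_dual_symbol (L2_msr j)).
by move=> x; exact: dual_symbol_le.
Qed.

(** The constant 6 of [trilinear], times 4 since [even_abs] doubles the norm entering squared,
    halved by the coefficient of [u^2] in [flux]. *)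
Definition form_const (s a : R) : R := 12 * 4 `^ (s / 2) * nrm (jap (- (a + s)) : R -> R).

(** Cauchy-Schwarz once the transform is moved onto [u]; the [<xi>^(-1)] of the symbol pays for the
    [eta] missing derivatives because [eta <= 1]. *)
Lemma linear_form_bound (s eta : R) u phi : 0 <= s -> eta <= 1 -> 0 <= s + eta -> Hs s u -> intg phi -> L2 phi ->
  `|I (fun x => u x * hartley1 (dual_symbol phi) x)| <=
  Hs_norm s u * nrm (fun xi => jap (- (s + eta)) xi * phi xi).
Proof.
move=> s0 e1 r0 [lu hu] jp lp.
have jc := intg_dual_symbol jp; have lc := L2_dual_symbol lp.
rewrite -(hartley_sym lu jc lc).
have lX := L2_opp (L2_jap_opp r0 lp).
rewrite /Hs_norm -(nrm_opp (L2_jap_opp r0 lp)).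
apply: le_trans (cauchy_schwarz_abs hu lX).
apply: I_le_abs; first exact: (L2M (L2_hartley lu) lc).
  exact: (L2M (L2_abs hu) (L2_abs lX)).
move=> x; rewrite japN [leLHS]normrM (normrM (jap s x)) (normrM (jap _ x)) !(ger0_norm (jap_ge0 _ _)).
rewrite [leRHS](_ : _ = `|hartley u x| * (jap s x * jap (- (s + eta)) x * `|phi (- x)|)); last by ring.
rewrite ler_wpM2l// (le_trans (dual_symbol_jap _ _))// ler_wpM2r// -japD; apply: jap_le; lra.
Qed.

(** The transform of the integrable [u^2] is given by an integral and bounded pointwise by
    [hartley1_sq_bound]. Then [trilinear] applies with [a = 1 - eta]: its condition [a + s > 1/2] is
    the upper bound on [eta]. *)
Lemma quadratic_form_bound (s eta : R) u phi : 0 <= s -> eta <= 1 -> 0 <= s + eta -> eta < s + 1 / 2 ->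
  Hs s u -> intg phi -> L2 phi ->
  `|I (fun x => u x ^+ 2 * hartley1 (dual_symbol phi) x)| <=
  2 * form_const s (1 - eta) * Hs_norm s u ^+ 2 * nrm (fun xi => jap (- (s + eta)) xi * phi xi).
Proof.
move=> s0 e1 r0 es [lu hu] jp lp.
have jc := intg_dual_symbol jp; have lc := L2_dual_symbol lp.
have lX := L2_opp (L2_jap_opp r0 lp).
pose X xi := jap (- (s + eta)) (- xi) * phi (- xi).
pose V := even_abs (hartley u); pose W xi := jap s xi * V xi.
have WE xi : jap (- s) xi * W xi = V xi by rewrite /W mulrA jap_inv mul1r.
have lhu := L2_abs hu.
have WE2 : W = fun xi => `|jap s xi * hartley u xi| + `|jap s (- xi) * hartley u (- xi)|.
  by apply/funext => xi; rewrite /W /V /even_abs mulrDr japN !normrM !(ger0_norm (jap_ge0 _ _)).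
have lW : L2 W by rewrite WE2; apply: (L2D lhu); exact: (L2_opp lhu).
have nW : nrm W <= 2 * Hs_norm s u.
  rewrite WE2; apply: (le_trans (nrmD lhu (L2_opp lhu))).
  by rewrite (nrm_opp lhu) nrm_abs /Hs_norm mulr2n mulrDl !mul1r.
(* The exponents [s - (1 - eta)] and [- (s + eta)] add up to the [-1] of the symbol. *)
have cX x : `|dual_symbol phi x| <= jap (s - (1 - eta)) x * `|X x|.
  apply: (le_trans (dual_symbol_jap _ _)); rewrite /X normrM (ger0_norm (jap_ge0 _ _)) japN mulrA -japD.
  by rewrite ler_wpM2r//; apply: jap_le; lra.
have a0 : 0 <= 1 - eta by rewrite subr_ge0.
have b0 : 1 / 2 < 1 - eta + s by lra.
have [fG bG] := trilinear a0 s0 b0 (L2_msr lc) cX lX lW.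
rewrite (hartley1_sym lu.2 jc).
have inner x : I (fun y => `|dual_symbol phi x * (jap (- s) y * W y * (jap (- s) (x - y) * W (x - y)))|) =
   `|dual_symbol phi x| * I (fun z => V z * V (x - z)).
  rewrite -IZ; last by apply: (L2M _ (L2_refl x _)); apply: L2_even_abs; exact: L2_hartley.
  apply: eqI => z; rewrite !WE normrM; congr (_ * _).
  by rewrite ger0_norm// mulr_ge0// even_abs_ge0.
apply: (@le_trans _ _ (I (fun x => `|dual_symbol phi x| * I (fun z => V z * V (x - z))))).
  have jl := intg_fub1 (fub_abs fG).
  have jl' : intg (fun x => `|dual_symbol phi x| * I (fun z => V z * V (x - z))).
    by move: jl; rewrite (_ : (fun x => I _) = fun x => `|dual_symbol phi x| * I (fun z => V z * V (x - z)))//;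
      apply/funext => x; rewrite /= inner.
  apply: (I_le_abs _ jl').
    apply: (intg_le _ _ jl').
      by apply: measurable_funM; [exact: (msr_hartley1 lu.2)|exact: L2_msr].
    by move=> x; rewrite normrM mulrC ler_wpM2l//; exact: hartley1_sq_bound.
  by move=> x; rewrite normrM mulrC ler_wpM2l//; exact: hartley1_sq_bound.
rewrite -(eqI inner) (II1 (fub_abs fG)); apply: (le_trans bG).
rewrite (nrm_opp (L2_jap_opp r0 lp)) /form_const.
have W2 : nrm W ^+ 2 <= 4 * Hs_norm s u ^+ 2.
  have -> : 4 * Hs_norm s u ^+ 2 = (2 * Hs_norm s u) ^+ 2 by rewrite exprMn; congr (_ * _); ring.
  by rewrite ler_sqr ?nnegrE ?nrm_ge0 ?mulr_ge0 ?Hs_norm_ge0.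
rewrite [leRHS](_ : _ = 6 * 4 `^ (s / 2) * nrm (jap (- (1 - eta + s)) : R -> R) *
  (nrm (fun xi => jap (- (s + eta)) xi * phi xi) * (4 * Hs_norm s u ^+ 2))); last by ring.
by rewrite !ler_wpM2l ?mulr_ge0 ?nrm_ge0 ?powR_ge0.
Qed.

Lemma form_bound (s eta : R) u phi : 0 <= s -> eta <= 1 -> 0 <= s + eta -> eta < s + 1 / 2 ->
  Hs s u -> intg phi -> L2 phi ->
  `|I (fun x => flux u x * hartley1 (dual_symbol phi) x)| <=
  (Hs_norm s u + form_const s (1 - eta) * Hs_norm s u ^+ 2) * nrm (fun xi => jap (- (s + eta)) xi * phi xi).
Proof.
move=> s0 e1 r0 es hu jp lp.
have b1 := linear_form_bound s0 e1 r0 hu jp lp.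
have b2 := quadratic_form_bound s0 e1 r0 es hu jp lp.
have jc := intg_dual_symbol jp; have lc := L2_dual_symbol lp.
have j1 := L2M hu.1 (hartley1_L2 jc lc).
have j2 : intg (fun x => u x ^+ 2 * hartley1 (dual_symbol phi) x).
  apply: (intg_bounded hu.1.2 (msr_hartley1 jc)) => x; exact: (hartley1_abs x jc).
have -> : (fun x => flux u x * hartley1 (dual_symbol phi) x) =
  fun x => u x * hartley1 (dual_symbol phi) x + 2^-1 * (u x ^+ 2 * hartley1 (dual_symbol phi) x).
  by apply/funext => x; rewrite /flux; move: (hartley1 _ _) => h; ring.
rewrite (ID j1 (intgZ 2^-1 j2)) (IZ 2^-1 j2).
apply: (le_trans (ler_normD _ _)); rewrite mulrDl; apply: lerD => //.
rewrite normrM (ger0_norm (_ : 0 <= 2^-1)) ?invr_ge0// ler_pdivrMl//.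
by apply: (le_trans b2); rewrite !mulrA.
Qed.

Lemma clip_cvg f x : clip n f x @[n --> \oo] --> f x.
Proof.
rewrite -[X in _ --> X]mulr1 -[X in _ --> f x * X](mulr1 1).
by apply: cvgM; [exact: cvg_cst|apply: cvgM; exact: box_cvg].
Qed.

Lemma L2_nrm_le f (A : R) : msr f -> intg (sq f) -> 0 <= A -> I (sq f) <= A ^+ 2 -> L2 f /\ nrm f <= A.
Proof.
move=> mf jf A0 h; split; first by split.
by rewrite -ler_sqr ?nnegrE ?nrm_ge0// nrm_sq.
Qed.

(* Test with [phi = <xi>^(2r) hartley w], truncated in space and in height. *)
Lemma sobolev_duality r w (A : R) : 0 <= r -> L2 w -> 0 <= A ->
  (forall phi, intg phi -> L2 phi ->
    `|I (fun x => w x * hartley1 phi x)| <= A * nrm (fun xi => jap (- r) xi * phi xi)) ->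
  Hs r w /\ Hs_norm r w <= A.
Proof.
move=> r0 lw A0 h; have lW := L2_hartley lw.
pose g n xi := jap r xi * clip n (hartley w) xi.
have mg n : msr (g n) by apply: measurable_funM; [exact: msr_jap|exact: L2_msr (L2_clip n lW)].
(* The box bounds the growing weight, which keeps [phi n] integrable and square-integrable. *)
pose b n xi := jap (2 * r) xi * box n xi.
have mb n : msr (b n) by apply: measurable_funM; [exact: msr_jap|exact: msr_box].
have bB n xi : `|b n xi| <= jap (2 * r) n%:R.
  rewrite /b boxE ger0_norm ?mulr_ge0 ?jap_ge0//.
  case: (leP `|xi| n%:R) => hn; last by rewrite mulr0 jap_ge0.
  rewrite mulr1 /jap; apply: ge0_ler_powR; rewrite ?nnegrE ?(ltW (jap_base_gt0 _))//.
    by rewrite divr_ge0 ?mulr_ge0.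
  by rewrite lerD2l -(real_normK (num_real xi)) ler_sqr ?nnegrE.
pose phi n xi := clip n (hartley w) xi * b n xi.
have jphi n : intg (phi n) by apply: (intg_bounded (intg_clip n lW) (mb n) (bB n)).
have lphi n : L2 (phi n).
  apply: (L2_le (intg_msr (jphi n)) _ (L2Z (jap (2 * r) n%:R) (L2_abs (L2_clip n lW)))) => xi.
  by rewrite normrM mulrC ler_wpM2r.
have cb n xi : clip n (hartley w) xi * box n xi = clip n (hartley w) xi.
  by rewrite /clip -!mulrA -expr2 box_sq.
have jap_phi n : (fun xi => jap (- r) xi * phi n xi) = g n.
  apply/funext => xi; rewrite /phi /b /g (_ : 2 * r = r + r); last by ring.
  rewrite japD -[in RHS](cb n xi) -[RHS]mul1r -(jap_inv r xi); ring.
have Ig n : intg (sq (g n)) /\ I (sq (g n)) <= A ^+ 2.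
  have e xi : hartley w xi * phi n xi = g n xi ^+ 2.
    rewrite /phi /b /g exprMn (_ : 2 * r = r + r); last by ring.
    rewrite japD /clip.
    transitivity (jap r xi ^+ 2 * hartley w xi ^+ 2 * box n (hartley w xi) * box n xi ^+ 2); first by ring.
    rewrite -{1}[box n (hartley w xi)]box_sq; ring.
  have j : intg (sq (g n)).
    by have := L2M lW (lphi n); congr intg; apply/funext => xi; rewrite e.
  (* The pairing equals the square of [nrm (g n)] and the weighted norm of [phi n] is [nrm (g n)],
     so that [nrm (g n) <= A]. *)
  split => //; have := h _ (jphi n) (lphi n); rewrite jap_phi -(hartley_sym lw (jphi n) (lphi n)) (eqI e).
  rewrite -nrm_sq ger0_norm ?sqr_ge0// => hn.
  have := nrm_ge0 (g n); move: (nrm (g n)) hn => z hn; nra.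
have gc x : g n x ^+ 2 @[n --> \oo] --> (jap r x * hartley w x) ^+ 2.
  apply: (cvg_comp (fun n => g n x) (fun z => z ^+ 2)); last exact: exprn_continuous.
  by apply: cvgM; [exact: cvg_cst|exact: clip_cvg].
have [j b2] := fatou_intg (fun n => measurable_funX 2 (mg n)) (measurable_funX 2 (msr_jap_hartley r lw))
  (fun n x => sqr_ge0 _) gc Ig.
by have [l1 n1] := L2_nrm_le (msr_jap_hartley r lw) j A0 b2.
Qed.

Lemma convolutionE f x : convolution K f x = I (fun y => K (x - y) * f y).
Proof. by []. Qed.

Lemma kabsN x : kabs (- x) = kabs x :> R.
Proof. by rewrite /kabs kernelN normrN. Qed.
Lemma kabs_le1 x : kabs x <= 1 :> R. Proof. exact: kernel_abs_le1. Qed.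

Section Fixed_u.
Context (u : R -> R) (lu : L2 u).

Lemma msr_flux : msr (flux u).
Proof.
apply: measurable_funD; first exact: L2_msr.
by apply: measurable_funM => //; apply: measurable_funX; exact: L2_msr.
Qed.

Lemma intg_kernel_L2 x : intg (fun y => K (x - y) * u y).
Proof. exact: (L2M (L2_refl x L2_kernel) lu). Qed.

Lemma intg_kernel_sq x : intg (fun y => K (x - y) * u y ^+ 2).
Proof.
under eq_fun do rewrite mulrC; apply: (intg_bounded lu.2 (L2_msr (L2_refl x L2_kernel))) => y.
exact: kernel_abs_le1.
Qed.

Lemma intg_kabs_sq x : intg (fun y => kabs (x - y) * u y ^+ 2).
Proof.
have := intg_abs (intg_kernel_sq x); congr intg; apply/funext => y.
by rewrite normrM (ger0_norm (sqr_ge0 _)).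
Qed.

Lemma kernel_fluxE x y : K (x - y) * flux u y = K (x - y) * u y + 2^-1 * (K (x - y) * u y ^+ 2).
Proof. by rewrite /flux; move: (K _) => k; ring. Qed.

Lemma intg_kernel_flux x : intg (fun y => K (x - y) * flux u y).
Proof.
under eq_fun do rewrite kernel_fluxE.
exact: (intgD (intg_kernel_L2 x) (intgZ 2^-1 (intg_kernel_sq x))).
Qed.

Lemma fub_kabs_sq : fub (fun p => kabs (p.1 - p.2) * u p.2 ^+ 2).
Proof. exact: (fub_conv intg_kabs lu.2). Qed.

Lemma I_kabs_sq_le : I (fun x => I (fun y => kabs (x - y) * u y ^+ 2)) <= 2 * I (sq u).
Proof.
rewrite (fubini fub_kabs_sq) /=.
have e y : I (fun x => kabs (x - y) * u y ^+ 2) = I kabs * u y ^+ 2.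
  rewrite -(I_shift (- y) intg_kabs) mulrC -IZ; last exact: (intg_shift (- y) intg_kabs).
  by apply: eqI => x; rewrite mulrC.
rewrite (eqI e) (IZ _ lu.2) ler_wpM2r ?I_sq_ge0//; exact: I_kabs_le.
Qed.

(** Cauchy-Schwarz with [|K|] split into two square roots: one carries the mass of [|K|], at most 2,
    the other produces a majorant that is integrable in [x]. *)
Lemma kernel_L2_sq_le x : I (fun y => K (x - y) * u y) ^+ 2 <= 2 * I (fun y => kabs (x - y) * u y ^+ 2).
Proof.
have mS : msr (fun y => Num.sqrt (kabs (x - y))).
  apply: measurableT_comp; first by apply: continuous_measurable_fun; exact: sqrt_continuous.
  exact: (intg_msr (intg_refl x intg_kabs)).
have sS y : Num.sqrt (kabs (x - y)) ^+ 2 = kabs (x - y) by rewrite sqr_sqrtr ?kabs_ge0.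
have l1 : L2 (fun y => Num.sqrt (kabs (x - y))).
  split=> //; under [X in intg X]eq_fun do rewrite sS; exact: (intg_refl x intg_kabs).
have e y : (Num.sqrt (kabs (x - y)) * u y) ^+ 2 = kabs (x - y) * u y ^+ 2 by rewrite exprMn sS.
have l2 : L2 (fun y => Num.sqrt (kabs (x - y)) * u y).
  split; first by apply: measurable_funM => //; exact: L2_msr.
  by under [X in intg X]eq_fun do rewrite e; exact: intg_kabs_sq.
have cs := cauchy_schwarz_abs l1 l2.
have b : `|I (fun y => K (x - y) * u y)| <= nrm (fun y => Num.sqrt (kabs (x - y))) * nrm (fun y => Num.sqrt (kabs (x - y)) * u y).
  apply: le_trans cs; apply: I_le_abs; [exact: intg_kernel_L2|exact: (L2M (L2_abs l1) (L2_abs l2))|].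
  move=> y; rewrite (normrM (Num.sqrt _)) mulrA -expr2 (ger0_norm (sqrtr_ge0 _)) sS normrM.
  by [].
have := b; rewrite -ler_sqr ?nnegrE ?mulr_ge0 ?nrm_ge0//.
rewrite real_normK ?num_real// exprMn !nrm_sq (eqI sS) (eqI e) => h; apply: (le_trans h).
rewrite ler_wpM2r//; first by apply: I_ge0 => y; rewrite mulr_ge0 ?kabs_ge0 ?sqr_ge0.
by rewrite (I_refl x intg_kabs) I_kabs_le.
Qed.

(** One of the two factors is bounded by [I (u^2)] since [|K| <= 1]; the other is kept, to obtain
    the same integrable majorant as for the linear part. *)
Lemma kernel_sq_sq_le x : I (fun y => K (x - y) * u y ^+ 2) ^+ 2 <= I (sq u) * I (fun y => kabs (x - y) * u y ^+ 2).
Proof.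
have jA := intg_kabs_sq x.
have b : `|I (fun y => K (x - y) * u y ^+ 2)| <= I (fun y => kabs (x - y) * u y ^+ 2).
  by apply: I_le_abs => [||y]; [exact: intg_kernel_sq|exact: jA|rewrite normrM (ger0_norm (sqr_ge0 _))].
have b2 : I (fun y => kabs (x - y) * u y ^+ 2) <= I (sq u).
  by apply: I_le => [||y]; [exact: jA|exact: lu.2|rewrite ler_piMl ?sqr_ge0 ?kabs_le1].
rewrite -real_normK ?num_real//; move: b b2 (normr_ge0 (I (fun y => K (x - y) * u y ^+ 2))).
move: (I _) (I _) `|I _| => p q t h1 h2 p0; nra.
Qed.

(** Measurability is drawn from Fubini, but the square-integrable part of [flux u] need not give an
    integrable function on the plane. Multiplying by [damp 1] in [x] repairs this, and the factor is
    divided out again. *)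
Lemma msr_convolution : msr (convolution K (flux u)).
Proof.
pose F (p : R * R) := damp 1 p.1 * (K (p.1 - p.2) * flux u p.2).
have d0 : 0 < 1 :> R by [].
have mF : msr2 F.
  apply: measurable_funM; first exact: (msr_fst (msr_damp d0)).
  by apply: measurable_funM; [exact: (msr_diff msr_kernel)|exact: (msr_snd msr_flux)].
have h1 := fub_swap (fub_conv intg_kabs (intg_damp d0)); rewrite /= in h1.
have fF : fub F.
  apply: (fub_le mF _ (fubD h1 fub_kabs_sq)) => -[x y]; rewrite /F /=.
  rewrite (normrM (damp _ _)) (normrM (K _)) (ger0_norm (damp_ge0 _ _)) -[kabs (y - x)]kabsN opprB.
  have k0 := kabs_ge0 (x - y); have dd0 := damp_ge0 1 x; have d1 := damp_le1 x (ltW d0).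
  rewrite -/(kabs _) mulrCA -mulrDr ler_wpM2l//.
  have : `|flux u y| <= 1 + u y ^+ 2.
    by rewrite /flux ler_norml; apply/andP; split; move: (u y) => z; have := sqr_ge0 (1 + z); have := sqr_ge0 (1 - z); nra.
  have := sqr_ge0 (u y); move: `|flux u y| (u y ^+ 2) (damp 1 x) dd0 d1 => a b d e f h i; nra.
have m := msr_fub1 fF.
have -> : convolution K (flux u) = fun x => (damp 1 x)^-1 * I (fun y => F (x, y)).
  apply/funext => x; rewrite /F /= IZ ?mulKf ?gt_eqF ?expR_gt0//; exact: intg_kernel_flux.
apply: measurable_funM => //.
have -> : (fun x : R => (damp 1 x)^-1) = fun x => expR `|x|.
  by apply/funext => x; rewrite /damp mul1r expRN invrK.
by apply: measurableT_comp.
Qed.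

(** [(p + t/2)^2 <= 2 p^2 + t^2 / 2], and both squares are multiples of the integrable [A]. *)
Lemma L2_convolution : L2 (convolution K (flux u)) /\
  nrm (convolution K (flux u)) ^+ 2 <= (8 + nrm u ^+ 2) * nrm u ^+ 2.
Proof.
pose A x := I (fun y => kabs (x - y) * u y ^+ 2).
have jA : intg A := intg_fub1 fub_kabs_sq.
have b x : convolution K (flux u) x ^+ 2 <= (4 + 2^-1 * I (sq u)) * A x.
  rewrite convolutionE (eqI (kernel_fluxE x)) (ID (intg_kernel_L2 x) (intgZ 2^-1 (intg_kernel_sq x))).
  rewrite (IZ 2^-1 (intg_kernel_sq x)).
  have := kernel_L2_sq_le x; have := kernel_sq_sq_le x; rewrite -/(A x).
  move: (I _) (I _) (I _) (A x) => p i t a h1 h2; have := sqr_ge0 (p - 2^-1 * t); nra.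
have mP := msr_convolution.
have jP : intg (sq (convolution K (flux u))).
  apply: (intg_le _ _ (intgZ (4 + 2^-1 * I (sq u)) jA)); first exact: measurable_funX.
  by move=> x; rewrite ger0_norm ?sqr_ge0.
split=> //; rewrite !nrm_sq.
apply: (le_trans (I_le jP (intgZ _ jA) b)); rewrite (IZ _ jA).
have := I_kabs_sq_le; rewrite -/A; have := I_sq_ge0 u.
move: (I _) (I _) => p q p0 qp; nra.
Qed.

(** Fubini is justified by using [psi] twice: its square-integrability dominates the linear part
    through [2 |u psi| <= u^2 + psi^2], its bound [B] dominates the quadratic part. *)
Lemma convolution_dual phi : intg phi -> L2 phi ->
  I (fun x => convolution K (flux u) x * hartley1 phi x) = I (fun x => flux u x * hartley1 (dual_symbol phi) x).
Proof.
move=> jp lp; pose psi := hartley1 phi.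
have lpsi : L2 psi := hartley1_L2 jp lp.
have [B hB] : exists B, forall x, `|psi x| <= B by exists (2 * I (fun x => `|phi x|)) => x; exact: hartley1_abs.
pose F (p : R * R) := K (p.1 - p.2) * flux u p.2 * psi p.1.
have fF : fub F.
  have h := fub_swap (fub_conv intg_kabs lpsi.2); rewrite /= in h.
  apply: (fub_le _ _ (fubD h (fubZ (1 + B) fub_kabs_sq))).
    apply: measurable_funM; last exact: (msr_fst (L2_msr lpsi)).
    by apply: measurable_funM; [exact: (msr_diff msr_kernel)|exact: (msr_snd msr_flux)].
  move=> [x y]; rewrite /F /= normrM (normrM (K _)) -[kabs (y - x)]kabsN opprB.
  have k0 := kabs_ge0 (x - y); rewrite -/(kabs _) (mulrCA (1 + B)) -mulrA -mulrDr ler_wpM2l//.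
  have : `|flux u y| <= `|u y| + 2^-1 * u y ^+ 2.
    by rewrite /flux (le_trans (ler_normD _ _))// lerD2l normrM mulrC ger0_norm// ger0_norm// sqr_ge0.
  have := hB x; have := normr_ge0 (psi x); rewrite -[u y ^+ 2]real_normK ?num_real// -[psi x ^+ 2]real_normK ?num_real//.
  have := normr_ge0 (u y); move: `|flux u y| `|u y| `|psi x| => a b c b0 c0 cB ab.
  apply: (@le_trans _ _ ((b + 2^-1 * b ^+ 2) * c)); first by rewrite ler_wpM2r.
  have := sqr_ge0 (b - c); nra.
have := fubini fF; rewrite /F /= => e.
transitivity (I (fun x => I (fun y => K (x - y) * flux u y * psi x))).
  apply: eqI => x; rewrite convolutionE mulrC -(IZ _ (intg_kernel_flux x)).
  by apply: eqI => y; rewrite mulrC.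
rewrite e; apply: eqI => y; rewrite -(kernel_hartley1 y jp) -IZ.
  by apply: eqI => x; rewrite -/(psi x); move: (K _) (flux u y) (psi x) => a b c; ring.
exact: (L2M (L2_shift (- y) L2_kernel) lpsi).
Qed.
End Fixed_u.

(** [u^2 - v^2 = (u + v)(u - v)] and Cauchy-Schwarz. The bound is independent of [x], which makes
    continuity in time uniform in space. *)
Lemma convolution_diff_le u v x : L2 u -> L2 v ->
  `|convolution K (flux u) x - convolution K (flux v) x| <=
  (nrm K + 2^-1 * (nrm u + nrm v)) * nrm (fun y => u y - v y).
Proof.
move=> lu lv; have ld := L2B lu lv; have ls := L2D lu lv.
have lK := L2_refl x L2_kernel.
rewrite !convolutionE -(IB (intg_kernel_flux lu x) (intg_kernel_flux lv x)).
pose d := fun y => u y - v y; pose t := fun y => u y + v y.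
have j1 := L2M (L2_abs lK) (L2_abs ld); have j2 := L2M (L2_abs ls) (L2_abs ld).
apply: (@le_trans _ _ (I (fun y => `|K (x - y)| * `|d y| + 2^-1 * (`|t y| * `|d y|)))).
  apply: I_le_abs.
  - exact: (intgB (intg_kernel_flux lu x) (intg_kernel_flux lv x)).
  - exact: (intgD j1 (intgZ 2^-1 j2)).
  move=> y; rewrite -mulrBr (_ : flux u y - flux v y = d y + 2^-1 * (t y * d y)); last by rewrite /flux /d /t; ring.
  rewrite mulrDr (le_trans (ler_normD _ _))// (normrM (K _)) lerD2l (normrM (K _)) (normrM 2^-1) (ger0_norm (_ : 0 <= 2^-1)) ?invr_ge0//.
  by rewrite (normrM (t y)) ler_piMl ?mulr_ge0// kernel_abs_le1.
rewrite (ID j1 (intgZ 2^-1 j2)) (IZ 2^-1 j2) mulrDl lerD//.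
  by rewrite -(nrm_refl x L2_kernel); exact: cauchy_schwarz_abs.
rewrite -mulrA ler_wpM2l// (le_trans (cauchy_schwarz_abs ls ld))// ler_wpM2r ?nrm_ge0//.
exact: nrmD.
Qed.
End Flux.

(** * Oriented time integrals and the mean value theorem *)

Section OrientedIntegral.
Context {R : realType}.
Notation mu := (@lebesgue_measure R).
Implicit Types p : R -> R.

Lemma continuous_integrable_itv p (a b : R) : continuous p -> mu.-integrable `[a, b] (EFin \o p).
Proof.
move=> cp; apply: continuous_compact_integrable; first exact: segment_compact.
by apply: continuous_subspaceT.
Qed.

(** A common base point to the left of [0] and [t] removes the case distinction on the sign of
    [t]. *)
Lemma oriented_integralE p (a t : R) : continuous p -> a <= 0 -> a <= t ->
  oriented_integral 0 t p = \int[mu]_(x in `[a, t]) p x - \int[mu]_(x in `[a, 0]) p x.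
Proof.
move=> cp a0 a_t.
have B (x y : R) : a <= x -> x <= y -> \int[mu]_(z in `[a, y]) p z - \int[mu]_(z in `[a, x]) p z = \int[mu]_(z in `[x, y]) p z.
  move=> ax xy; rewrite Rintegral_itvB ?bnd_simp//; last exact: continuous_integrable_itv.
  rewrite Rintegral_itv_obnd_cbnd//.
  apply: (@integrableS _ _ _ mu `[x, y]) => //; first exact: subset_itv_oc_cc.
  exact: continuous_integrable_itv.
rewrite /oriented_integral; case: ifP => [t0|/negbT]; first by rewrite B.
by rewrite -ltNge => /ltW t0; rewrite -B// opprB.
Qed.

Lemma mvt_unordered (g dg : R -> R) (a t1 t : R) : (forall z, a < z -> is_derive z 1 g (dg z)) ->
  a < t1 -> a < t -> exists2 c, `|c - t1| <= `|t - t1| & g t - g t1 = dg c * (t - t1).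
Proof.
move=> d a1 a2.
have main (x y : R) : a < x -> x < y -> exists2 c, x < c < y & g y - g x = dg c * (y - x).
  move=> ax xy.
  have dxy z : z \in `]x, y[%R -> is_derive z 1 g (dg z).
    by rewrite in_itv/= => /andP[xz _]; apply: d; exact: lt_trans xz.
  have cg : {within `[x, y], continuous g}.
    apply: derivable_within_continuous => z; rewrite in_itv/= => /andP[xz _].
    by case: (d z (lt_le_trans ax xz)).
  by have [c] := MVT xy dxy cg; rewrite in_itv/= => cxy e; exists c.
case: (ltgtP t1 t) => [h|h|->].
- have [c /andP[c1 c2] e] := main _ _ a1 h; exists c => //.
  by rewrite !ger0_norm ?subr_ge0 ?(ltW h) ?(ltW c1)// lerD2r ltW.
- have [c /andP[c1 c2] e] := main _ _ a2 h; exists c.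
    by rewrite distrC (distrC t) !ger0_norm ?subr_ge0 ?(ltW h) ?(ltW c2)// lerD2l lerN2 ltW.
  by rewrite -[LHS]opprB e -mulrN opprB.
- by exists t; rewrite ?lexx// !subrr mulr0.
Qed.

Lemma oriented_integral_mvt p (t1 t : R) : continuous p -> exists2 c, `|c - t1| <= `|t - t1| &
  oriented_integral 0 t p - oriented_integral 0 t1 p = p c * (t - t1).
Proof.
(* Strictly to the left of [t1], [t] and [0], so that the primitive from [a] is differentiable at
   all times concerned. *)
move=> cp; pose a := Num.min (Num.min t1 t) 0 - 1.
have am : a < Num.min (Num.min t1 t) 0 by rewrite /a ltrBlDr ltrDl.
move: am; rewrite !lt_min => /andP[/andP[a1 a2] a0].
pose F z := \int[mu]_(t in `[a, z]) p t.
have dF z : a < z -> is_derive z 1 F (p z).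
  move=> az; have z1 : z < z + 1 by rewrite ltrDl.
  have [d1 d2] := @continuous_FTC1_closed _ p a z (z + 1) z1 (continuous_integrable_itv _ _ cp) az (cp z).
  apply: (DeriveDef d1); rewrite -derive1E; exact: d2.
have [c c1 e] := mvt_unordered dF a1 a2; exists c => //.
rewrite -e !(oriented_integralE cp (ltW a0)) ?ltW// /F; ring.
Qed.
End OrientedIntegral.

(** * Smoothing of the increments in time *)

Section Evolution.
Context {R : realType}.
Notation mu := (@lebesgue_measure R).
Notation msr f := (measurable_fun [set: R] (f : R -> R)).
Notation sq f := (fun x => f x ^+ 2).
Notation K := (@bbm_kernel R).
Implicit Types f g h phi psi : R -> R.

(** Replacing [g] by the maximum of [g] and [|f|] changes it on a null set only and makes the bound
    hold everywhere. *)
Lemma I_le_abs_ae f g : intg f -> intg g -> {ae mu, forall x, `|f x| <= g x} -> `|I f| <= I g.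
Proof.
move=> jf jg fg; pose m x := Num.max (g x) `|f x|.
have mm : msr m by apply: measurable_maxr; [exact: (intg_msr jg)|exact: (intg_msr (intg_abs jf))].
have gm : ae_eq mu setT g m by apply: ae_mono fg => x h Tx; rewrite /m max_l.
have jm := intg_ae (intg_msr jg) mm gm jg.
rewrite (I_ae (intg_msr jg) mm gm); apply: (I_le_abs jf jm) => x.
by rewrite /m le_max lexx orbT.
Qed.

Lemma le_cvg0 (a b : R) (c : nat -> R) : (forall n, a <= b + c n) -> c n @[n --> \oo] --> 0 -> a <= b.
Proof.
move=> h c0; rewrite -[b]addr0.
have cv : b + c n @[n --> \oo] --> b + 0 by apply: cvgD => //; exact: cvg_cst.
have <- := cvg_lim (@norm_hausdorff _ _) cv.
by apply: limr_ge; [exact: cvgP cv|exact: nearW].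
Qed.

Context (s eta : R) (u : R -> R -> R).
Notation P := (fun t => convolution K (flux (u t))).
Notation W := (fun t x => oriented_integral 0 t (fun t' => P t' x)).

Context (hs : 0 <= s) (hu : forall t, Hs s (u t))
  (cu : forall t0, Hs_norm s (fun x => u t x - u t0 x) @[t --> t0] --> 0)
  (eu : forall t t1, {ae mu, forall x, u t x - u t1 x = - (W t x - W t1 x)}).

Lemma curve_near (t0 e : R) : 0 < e -> exists2 d, 0 < d &
  forall t, `|t - t0| < d -> Hs_norm s (fun x => u t x - u t0 x) <= e.
Proof.
move=> e0; have /cvgrPdist_le/(_ e e0)[d /= d0 h] := @cu t0.
exists d => // t td; have := h t; rewrite /= distrC => /(_ td).
by rewrite sub0r normrN ger0_norm ?Hs_norm_ge0.
Qed.

Lemma curve_bounded (t0 : R) : exists2 d, 0 < d &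
  forall t, `|t - t0| < d -> Hs_norm s (u t) <= Hs_norm s (u t0) + 1.
Proof.
have [d d0 h] := curve_near t0 ltr01; exists d => // t td.
by apply: (le_trans (Hs_normB_le (hu t) (hu t0))); rewrite lerD2l h.
Qed.

(** The Lipschitz factor in [convolution_diff_le] is bounded for times near [t0], where the [H^s]
    norms are. *)
Lemma convolution_unif (t0 e : R) : 0 < e -> exists2 d, 0 < d &
  forall t x, `|t - t0| < d -> `|P t x - P t0 x| <= e.
Proof.
move=> e0; have [d1 d10 h1] := curve_bounded t0.
have N0 := Hs_norm_ge0 s (u t0); have k0 := nrm_ge0 K.
have [C CE] : exists C, C = nrm K + 2^-1 * (Hs_norm s (u t0) + 1 + Hs_norm s (u t0)) by eexists.
have C0 : 0 < C by rewrite CE; lra.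
have [d2 d20 h2] := curve_near t0 (divr_gt0 e0 C0).
exists (Num.min d1 d2); first by rewrite lt_min d10.
move=> t x; rewrite lt_min => /andP[t1 t2].
apply: (le_trans (convolution_diff_le x (hu t).1 (hu t0).1)).
apply: (@le_trans _ _ (C * (e / C))); last by rewrite mulrC divfK// gt_eqF.
apply: ler_pM; rewrite ?nrm_ge0//.
- by rewrite addr_ge0// mulr_ge0// addr_ge0// nrm_ge0.
- rewrite CE lerD2l ler_wpM2l//; apply: lerD; last exact: nrm_le_Hs_norm.
  by apply: le_trans (h1 t t1); exact: nrm_le_Hs_norm.
- by apply: le_trans (h2 t t2); apply: nrm_le_Hs_norm => //; exact: HsB.
Qed.

Lemma continuous_convolution x : continuous (fun t => P t x).
Proof.
move=> t0; apply/cvgrPdist_le => e e0; have [d d0 h] := convolution_unif t0 e0.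
by exists d => // t /= td; rewrite distrC; apply: h; rewrite distrC.
Qed.

(* The mean value theorem pointwise in [x] replaces an exchange of the [t] and [x] integrals, so that no joint measurability of [u] is needed. *)
Lemma derive_pairing psi (t0 : R) : intg psi -> L2 psi ->
  is_derive t0 (1 : R) (fun t => I (fun x => u t x * psi x)) (- I (fun x => P t0 x * psi x)).
Proof.
move=> jp lp; pose g t := I (fun x => u t x * psi x).
have lP := (L2_convolution (hu t0).1).1.
have est (e : R) : 0 < e -> exists2 d, 0 < d & forall t, `|t - t0| < d ->
    `|g t - g t0 + (t - t0) * I (fun x => P t0 x * psi x)| <= e * `|t - t0| * I (fun x => `|psi x|).
  move=> e0; have [d d0 h] := convolution_unif t0 e0; exists d => // t td.
  have jut := L2M (hu t).1 lp; have ju0 := L2M (hu t0).1 lp; have jP := L2M lP lp.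
  rewrite /g -(IB jut ju0) -(IZ _ jP) -(ID (intgB jut ju0) (intgZ (t - t0) jP)).
  rewrite -(IZ _ (intg_abs jp)); apply: I_le_abs_ae.
  - exact: (intgD (intgB jut ju0) (intgZ (t - t0) jP)).
  - exact: (intgZ _ (intg_abs jp)).
  apply: ae_mono (eu t t0) => x ex.
  have [c ct e'] := oriented_integral_mvt t0 t (@continuous_convolution x).
  rewrite -mulrBl ex e' mulrA -mulrDl normrM ler_wpM2r//.
  rewrite mulrC -mulrN -mulrDr normrM mulrC ler_wpM2r// addrC distrC; apply: h.
  exact: le_lt_trans td.
have lim : (fun z : R => z^-1 *: (g (z *: (1 : R) + t0) - g t0)) @ 0^' --> - I (fun x => P t0 x * psi x).
  apply/cvgrPdist_le => e e0.
  have [M ME] : exists M, M = I (fun x => `|psi x|) + 1 by eexists.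
  have M0 : 0 < M by rewrite ME ltr_wpDl// I_ge0.
  have [d d0 hd] := est (e / M) (divr_gt0 e0 M0).
  exists d => // z; rewrite /= sub0r normrN => zd z0.
  have := hd (z + t0); rewrite addrK => /(_ zd).
  rewrite [z *: 1]mulr1 => b.
  rewrite -(ler_pM2l (_ : 0 < `|z|)) ?normr_gt0// -normrM.
  rewrite [X in `|X|](_ : _ = - (g (z + t0) - g t0 + z * I (fun x => P t0 x * psi x))); last first.
    move: (g _ - _) (I _) => p q.
    by rewrite mulrBr (_ : z^-1 *: p = z^-1 * p)// mulVKf// mulrN opprD addrC.
  rewrite normrN (le_trans b)// (mulrC _ `|z|) -!mulrA ler_wpM2l// ler_piMr ?(ltW e0)//.
  by rewrite ler_pdivrMl// mulr1 ME lerDl.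
apply: DeriveDef; first by apply/cvg_ex; exists (- I (fun x => P t0 x * psi x)).
by apply/cvg_lim => //; exact: Rhausdorff.
Qed.

Context (eta1 : eta <= 1) (r0 : 0 <= s + eta) (etas : eta < s + 1 / 2).

(** Duality reduces the increment to its pairing with [psi = hartley1 phi]; the mean value theorem
    in time turns this into [t - t1] times a pairing with [P c], to which [form_bound] applies. *)
Lemma local_smoothing (t1 : R) : exists d C, [/\ 0 < d, 0 <= C & forall t, `|t - t1| < d ->
  Hs (s + eta) (fun x => u t x - u t1 x) /\ Hs_norm (s + eta) (fun x => u t x - u t1 x) <= C * `|t - t1|].
Proof.
have [d d0 hN] := curve_bounded t1.
have N0 : 0 <= Hs_norm s (u t1) + 1 by rewrite addr_ge0// Hs_norm_ge0.
move: (Hs_norm s (u t1) + 1) hN N0 => N hN N0.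
have c0 : 0 <= form_const s (1 - eta) by rewrite /form_const !mulr_ge0 ?powR_ge0 ?nrm_ge0.
have C0 : 0 <= N + form_const s (1 - eta) * N ^+ 2 by rewrite addr_ge0// mulr_ge0// sqr_ge0.
exists d, (N + form_const s (1 - eta) * N ^+ 2); split => // t td.
have lw : L2 (fun x => u t x - u t1 x) := L2B (hu t).1 (hu t1).1.
apply: (sobolev_duality r0 lw); first by rewrite mulr_ge0.
move=> phi jp lp; pose psi := hartley1 phi.
have lpsi : L2 psi := hartley1_L2 jp lp.
pose X := nrm (fun xi => jap (- (s + eta)) xi * phi xi).
(* The intermediate time [c] will depend on the truncation index, so the truncation error needs a
   bound on [nrm (P c)] uniform in [c]. *)
pose B := Num.sqrt ((8 + N ^+ 2) * N ^+ 2).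
have bound c : `|c - t1| < d -> `|I (fun x => P c x * psi x)| <= (N + form_const s (1 - eta) * N ^+ 2) * X /\ nrm (P c) <= B.
  move=> cd; have hNc := hN c cd; split.
    rewrite (convolution_dual (hu c).1 jp lp).
    apply: (le_trans (form_bound hs eta1 r0 etas (hu c) jp lp)).
    rewrite ler_wpM2r ?nrm_ge0// lerD// ler_wpM2l// ler_sqr ?nnegrE ?Hs_norm_ge0//.
  have [_ h] := L2_convolution (hu c).1.
  have uN : nrm (u c) <= N by apply: le_trans hNc; exact: nrm_le_Hs_norm.
  rewrite -[nrm _]ger0_norm ?nrm_ge0// -sqrtr_sqr ler_wsqrtr//; apply: (le_trans h).
  have u0 := nrm_ge0 (u c).
  have u2 : nrm (u c) ^+ 2 <= N ^+ 2 by rewrite ler_sqr ?nnegrE.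
  by apply: ler_pM; rewrite ?sqr_ge0 ?addr_ge0 ?sqr_ge0// lerD2l.
(* [psi] is square-integrable but need not be integrable, as [derive_pairing] demands; the mean
   value theorem is applied to its truncations, at the price of an error that tends to 0. *)
apply: (@le_cvg0 _ _ (fun n => (`|t - t1| * B + nrm (fun x => u t x - u t1 x)) * nrm (fun x => psi x - trunc n psi x))); last first.
  by apply: cvg0Z; exact: nrm_trunc_cvg.
move=> n; have lt := L2_trunc n lpsi; have jt := intg_trunc n lpsi.
pose g t := I (fun x => u t x * trunc n psi x).
pose a := Num.min t1 t - 1.
have : a < Num.min t1 t by rewrite /a ltrBlDr ltrDl.
rewrite lt_min => /andP[a1 a2].
have [c ct ec] := mvt_unordered (fun z (_ : a < z) => derive_pairing z jt lt) a1 a2.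
have [b1 b2] := bound c (le_lt_trans ct td).
have lP := (L2_convolution (hu c).1).1.
have ld := L2B lpsi lt.
have e1 : I (fun x => (u t x - u t1 x) * psi x) = I (fun x => (u t x - u t1 x) * (psi x - trunc n psi x)) +
    - I (fun x => P c x * trunc n psi x) * (t - t1).
  rewrite -ec -(IB (L2M (hu t).1 lt) (L2M (hu t1).1 lt)).
  rewrite -(ID (L2M lw ld) (intgB (L2M (hu t).1 lt) (L2M (hu t1).1 lt))).
  by apply: eqI => x; ring.
have e2 : I (fun x => P c x * trunc n psi x) = I (fun x => P c x * psi x) - I (fun x => P c x * (psi x - trunc n psi x)).
  by rewrite -(IB (L2M lP lpsi) (L2M lP ld)); apply: eqI => x; ring.
rewrite e1 e2 (le_trans (ler_normD _ _))// normrM normrN.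
have b3 := cauchy_schwarz lw ld; have b4 := cauchy_schwarz lP ld.
have b5 : `|I (fun x => P c x * psi x) - I (fun x => P c x * (psi x - trunc n psi x))| <=
   (N + form_const s (1 - eta) * N ^+ 2) * X + B * nrm (fun x => psi x - trunc n psi x).
  apply: (le_trans (ler_normB _ _)); apply: lerD => //; apply: (le_trans b4).
  by rewrite ler_wpM2r ?nrm_ge0.
have b6 := ler_wpM2r (normr_ge0 (t - t1)) b5.
apply: (le_trans (lerD b3 b6)); rewrite -/X.
by rewrite le_eqVlt; apply/orP; left; apply/eqP; ring.
Qed.
End Evolution.

(** * From local increments to the whole time line, and to [Omega] *)

Section Smoothing.
Context {R : realType}.
Notation mu := (@lebesgue_measure R).
Notation K := (@bbm_kernel R).
Implicit Types f g F : R -> R.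

(** [A] is open, closed and non-empty in a connected space. *)
Lemma locally_constant_setT (A : set R) t0 :
  (forall a, exists2 d, 0 < d & forall b, `|b - a| < d -> A a <-> A b) -> A t0 -> forall t, A t.
Proof.
move=> loc A0 t.
have oA : open A.
  rewrite openE => a Aa; have [d d0 h] := loc a.
  apply/nbhs_ballP; exists d => // b; rewrite /ball /= distrC => bd.
  exact: (h b bd).1 Aa.
have cA : closed A.
  move=> a ca; have [d d0 h] := loc a.
  have [b [Ab]] := ca (ball a d) (nbhsx_ballx a d d0).
  by rewrite /ball /= distrC => /h[_]; apply.
have cT : connected [set: R] by apply/connected_intervalP.
have AT : A = setT by apply: cT; [exists t0|exists A; rewrite ?setTI|exists A; rewrite ?setTI].
by rewrite AT.
Qed.

Lemma oriented_integral_refl f (a : R) : oriented_integral a a f = 0.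
Proof. by rewrite /oriented_integral lexx set_itv1 Rintegral_set1. Qed.

Context (s eta : R) (u0 : R -> R) (u : R -> R -> R) (hs : 0 <= s) (sol : bbm_solution s u0 u).

Lemma solution_Hs t : Hs s (u t).
Proof. by apply/sobolevP; case: sol.1. Qed.

Lemma solution_cvg t0 : Hs_norm s (fun x => u t x - u t0 x) @[t --> t0] --> 0.
Proof.
have /fine_cvgP[_] := sol.1.2 t0; apply: cvg_trans; apply: near_eq_cvg.
apply: nearW => t /=; rewrite sobolev_normE//; apply: HsB; exact: solution_Hs.
Qed.

Lemma solution_incr t t1 : {ae mu, forall x, u t x - u t1 x =
  - (oriented_integral 0 t (fun t' => convolution K (flux (u t')) x) -
     oriented_integral 0 t1 (fun t' => convolution K (flux (u t')) x))}.
Proof.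
apply: ae_mono2 (sol.2 t) (sol.2 t1) => x /(_ Logic.I) -> /(_ Logic.I) ->.
rewrite /flux; move: (oriented_integral _ _ _) (oriented_integral _ _ _) => a b; ring.
Qed.

Lemma solution0 : ae_eq mu setT (u 0) u0.
Proof.
by apply: ae_mono (sol.2 0) => x h Tx; rewrite h// oriented_integral_refl subr0.
Qed.

Context (eta1 : eta <= 1) (r0 : 0 <= s + eta) (etas : eta < s + 1 / 2).
Notation smoother f := (Hs (s + eta) f).

(** Increments between nearby times lie in [H^(s+eta)], so membership does not change locally. No
    lower bound on the local radius is available, so steps of a fixed length cannot be iterated. *)
Lemma global_smoothing t t0 : smoother (fun x => u t x - u t0 x).
Proof.
apply: (@locally_constant_setT (fun t => smoother (fun x => u t x - u t0 x)) t0); last first.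
  have [d [C [d0 _ h]]] := local_smoothing hs solution_Hs solution_cvg solution_incr eta1 r0 etas t0.
  by apply: (h t0 _).1; rewrite subrr normr0.
move=> a; have [d [C [d0 _ h]]] := local_smoothing hs solution_Hs solution_cvg solution_incr eta1 r0 etas a.
exists d; first exact: d0.
move=> b bd; have [hb _] := h b bd; split=> h2.
  have -> : (fun x => u b x - u t0 x) = fun x => (u b x - u a x) + (u a x - u t0 x).
    by apply/funext => x; rewrite addrA subrK.
  exact: HsD hb h2.
have -> : (fun x => u a x - u t0 x) = fun x => (u b x - u t0 x) - (u b x - u a x).
  by apply/funext => x; ring.
exact: HsB h2 hb.
Qed.

Lemma smoothing_cvg t0 : sobolev_norm (s + eta) (fun x => u t x - u t0 x) @[t --> t0] --> 0%E.
Proof.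
have [d [C [d0 C0 h]]] := local_smoothing hs solution_Hs solution_cvg solution_incr eta1 r0 etas t0.
have -> : (fun t => sobolev_norm (s + eta) (fun x => u t x - u t0 x)) =
   fun t => (Hs_norm (s + eta) (fun x => u t x - u t0 x))%:E.
  by apply/funext => t; rewrite sobolev_normE//; exact: global_smoothing.
apply: cvg_EFin; first exact: nearW.
apply/cvgrPdist_le => e e0.
have C1 : 0 < C + 1 by rewrite ltr_wpDl.
exists (Num.min d (e / (C + 1))); first by rewrite /= lt_min d0 divr_gt0.
move=> t /=; rewrite distrC lt_min => /andP[/h[_ b] te].
rewrite sub0r normrN ger0_norm ?Hs_norm_ge0// (le_trans b)//.
apply: (@le_trans _ _ ((C + 1) * (e / (C + 1)))); last by rewrite mulrC divfK// gt_eqF.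
by apply: ler_pM => //; [rewrite lerDl|exact: ltW].
Qed.

Lemma smoothing_transfer (Omega : set R) f g t t0 :
  ae_eq mu Omega f g ->
  sobolev_on (s + eta) Omega f ->
  sobolev_on (s + eta) Omega (fun x => g x + (u t x - u t0 x)).
Proof.
move=> fg [F [/sobolevP sF eF]]; exists (fun x => F x + (u t x - u t0 x)); split.
  by apply/sobolevP; exact: HsD (global_smoothing t t0).
by apply: ae_mono2 eF fg => x h1 h2 Ox; rewrite h1// h2.
Qed.

(** The forward direction gives membership in (a) and (c); the converse, by contraposition, gives
    (b) and (d). *)
Lemma sobolev_on_solution (Omega : set R) t :
  sobolev_on (s + eta) Omega u0 <-> sobolev_on (s + eta) Omega (u t).
Proof.
have e0 : ae_eq mu Omega u0 (u 0) by apply: ae_mono solution0 => x h _; rewrite h.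
have e1 : ae_eq mu Omega (u t) (u t) by apply: aeW.
split=> h.
  by have := smoothing_transfer t 0 e0 h; congr sobolev_on; apply/funext => x; rewrite addrC subrK.
have [F [sF eF]] := smoothing_transfer 0 t e1 h; exists F; split => //.
by apply: ae_mono2 eF e0 => x h1 h2 Ox; rewrite h1// h2// addrC subrK.
Qed.

Lemma sobolev_norm_ge0 r F : sobolev r F -> (0 <= sobolev_norm r F)%E.
Proof. by move=> /sobolevP h; rewrite sobolev_normE// lee_fin Hs_norm_ge0. Qed.

Lemma smoothing_curve (Omega : set R) : sobolev_on (s + eta) Omega u0 ->
  continuous_curve (sobolev_on (s + eta) Omega) (sobolev_on_norm (s + eta) Omega) u.
Proof.
move=> h; split=> [t|t0]; first by apply/sobolev_on_solution.
apply: (@squeeze_cvge _ _ _ _ (cst 0%E) _ (fun t => sobolev_norm (s + eta) (fun x => u t x - u t0 x))).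
- apply: nearW => t; apply/andP; split.
    by apply: le_ereal_inf_tmp => _ [F [sF _] <-]; exact: sobolev_norm_ge0.
  (* The increment on the whole line is an extension of its own restriction to [Omega], so its
     global norm bounds the infimum. *)
  apply: ereal_inf_lbound; exists (fun x => u t x - u t0 x) => //; split.
    by apply/sobolevP; exact: global_smoothing.
  by apply: aeW.
- exact: cvg_cst.
- exact: smoothing_cvg.
Qed.
End Smoothing.

Theorem theorem1p17 (R : realType) (s : R) (u0 : R -> R) (Omega : set R)
    (u : R -> R -> R) (hs : 0 <= s) (hu0 : sobolev s u0) (hOmega : open Omega)
    (hu : bbm_solution s u0 u) :
  (* (a) *)
  (forall eta : R, s <= 1 / 2 -> 0 < eta -> eta < s + 1 / 2 ->
     sobolev_on (s + eta) Omega u0 ->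
     continuous_curve (sobolev_on (s + eta) Omega)
       (sobolev_on_norm (s + eta) Omega) u) /\
  (* (b) *)
  (forall eta : R, s <= 1 / 2 -> 0 < eta -> eta < s + 1 / 2 ->
     ~ sobolev_on (s + eta) Omega u0 ->
     forall t : R, ~ sobolev_on (s + eta) Omega (u t)) /\
  (* (c) *)
  (forall eta : R, 1 / 2 < s -> 0 < eta -> eta <= 1 ->
     sobolev_on (s + eta) Omega u0 ->
     continuous_curve (sobolev_on (s + eta) Omega)
       (sobolev_on_norm (s + eta) Omega) u) /\
  (* (d) *)
  (forall eta : R, 1 / 2 < s -> 0 < eta -> eta <= 1 ->
     ~ sobolev_on (s + eta) Omega u0 ->
     forall t : R, ~ sobolev_on (s + eta) Omega (u t)).
Proof.
(* Both regimes lead to the same conditions: if [s <= 1/2] then [eta < s + 1/2 <= 1], and if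
   [s > 1/2] then [eta <= 1 < s + 1/2]. *)
have low eta : s <= 1 / 2 -> 0 < eta -> eta < s + 1 / 2 ->
    [/\ eta <= 1, 0 <= s + eta & eta < s + 1 / 2] by split; lra.
have high eta : 1 / 2 < s -> 0 < eta -> eta <= 1 ->
    [/\ eta <= 1, 0 <= s + eta & eta < s + 1 / 2] by split; lra.
split; [|split; [|split]].
- by move=> eta h1 h2 h3; have [a b c] := low eta h1 h2 h3; exact: smoothing_curve.
- move=> eta h1 h2 h3 n t; have [a b c] := low eta h1 h2 h3.
  by move=> /(sobolev_on_solution hs hu a b c Omega t).
- by move=> eta h1 h2 h3; have [a b c] := high eta h1 h2 h3; exact: smoothing_curve.
- move=> eta h1 h2 h3 n t; have [a b c] := high eta h1 h2 h3.
  by move=> /(sobolev_on_solution hs hu a b c Omega t).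
Qed.
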